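(* Let $\frac12<\alpha<1$ and let $\overline f:\mathbb R\to\mathbb R$ be a continuous function; put $\overline F(\xi)=\int_0^\xi \overline f(\sigma)\,d\sigma$. Assume: $(f_0)$ $\overline f(\xi)\ge 0$ if $\xi\ge 0$ and $\overline f(\xi)=0$ if $\xi\le 0$; $(f_1)$ there exists $\theta>2$ such that $0<\theta\,\overline F(\xi)\le \xi\,\overline f(\xi)$ for all $\xi>0$; $(f_2)$ $\overline f(\xi)=o(|\xi|)$ as $\xi\to 0$; $(f_3)$ $\lim_{|\xi|\to\infty}\frac{\overline f(\xi)}{|\xi|^{p_0}}=0$ for some $p_0$ with $p_0+1>\theta$; $(f_4)$ for every $\xi>0$ the function $\sigma\mapsto \frac{\overline f(\sigma\xi)\,\xi}{\sigma}$ is (strictly) increasing on $(0,\infty)$. Then the equation $$ {}_tD_\infty^\alpha\,{}_{-\infty}D_t^\alpha u(t)+u(t)=\overline f(u(t)),\qquad t\in\mathbb R, $$ has a nontrivial weak solution, i.e. there is $u\in H^\alpha(\mathbb R)$, $u\neq 0$, such that $$ \int_{\mathbb R}\big[{}_{-\infty}D_t^\alpha u(t)\,{}_{-\infty}D_t^\alpha v(t)+u(t)v(t)\big]dt=\int_{\mathbb R}\overline f(u(t))v(t)\,dt\quad\text{for all } v\in H^\alpha(\mathbb R). $$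
   Context: All functions are real valued. The Fourier transform is $\widehat u(w)=\int_{\mathbb R}e^{-ixw}u(x)\,dx$. $H^\alpha(\mathbb R)$ is the completion of $C_0^\infty(\mathbb R)$ under the norm $\|u\|_\alpha=(\|u\|_{L^2}^2+\||w|^\alpha\widehat u\|_{L^2}^2)^{1/2}$. It coincides, with equivalent norms, with the completion of $C_0^\infty(\mathbb R)$ under $(\|u\|_{L^2}^2+\|{}_{-\infty}D_x^\alpha u\|_{L^2}^2)^{1/2}$. For $0<\alpha<1$ the Liouville-Weyl fractional derivatives are $${}_{-\infty}D_x^\alpha u(x)=\frac{d}{dx}\,\frac{1}{\Gamma(1-\alpha)}\int_{-\infty}^x(x-\xi)^{-\alpha}u(\xi)\,d\xi,\qquad {}_xD_\infty^\alpha u(x)=-\frac{d}{dx}\,\frac{1}{\Gamma(1-\alpha)}\int_x^\infty(\xi-x)^{-\alpha}u(\xi)\,d\xi.$$ Their Fourier transforms are $(iw)^\alpha\widehat u(w)$ and $(-iw)^\alpha\widehat u(w)$ respectively, with $(\pm iw)^\alpha=|w|^\alpha e^{\pm i\pi\alpha\,\mathrm{sgn}(w)/2}$. On $H^\alpha(\mathbb R)$ they are understood through these Fourier multipliers, and so map $H^\alpha(\mathbb R)$ into $L^2(\mathbb R)$. *)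

(* Defs.v *)
From HB Require Import structures.
From mathcomp Require Import all_boot all_order all_algebra.
From mathcomp Require Import complex.
From mathcomp Require Import all_classical all_reals all_analysis.

Set Implicit Arguments.
Unset Strict Implicit.
Unset Printing Implicit Defensive.

Import Order.TTheory GRing.Theory Num.Theory.
Import numFieldNormedType.Exports.

Local Open Scope classical_set_scope.
Local Open Scope complex_scope.
Local Open Scope ring_scope.

Section Defs.
Variable R : realType.
Implicit Types (u v g : R -> R) (U : R -> R[i]) (alpha : R).

Local Notation mu := (@lebesgue_measure R).

(* Functions represent their classes modulo equality almost everywhere. *)
Definition L2 u : Prop := u \in Lfun mu 2%:E.

Definition L2norm u : \bar R := 'N[mu]_2%:E[EFin \o u].

Definition cL2 U : Prop :=
  L2 (fun w => complex.Re (U w)) /\ L2 (fun w => complex.Im (U w)).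

Definition cL2norm U : \bar R :=
  L2norm (fun w => ComplexField.Normc.normc (U w)).

(* [\int e^{-ixw} u(x) dx], split into real and imaginary part; meaningful for
   integrable [u]. *)
Definition fourier u (w : R) : R[i] :=
  (\int[mu]_x (cos (x * w) * u x)) +i* (- \int[mu]_x (sin (x * w) * u x)).

(* The Fourier transform on L^2, as the limit in the mean of the transforms of
   the truncations of [u], which are integrable; it determines [U] only up to
   equality almost everywhere. *)
Definition is_fourierL2 u U : Prop :=
  [/\ L2 u, cL2 U &
    cL2norm (fun w => fourier (u \_ `[- n%:R, n%:R]) w - U w)
      @[n --> \oo] --> 0%E].

Definition test_function (phi : R -> R) : Prop :=
  (forall (n : nat) (x : R), derivable (derive1n n phi) x 1) /\
  (exists M : R, forall x : R, M < `|x| -> phi x = 0).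

Definition Hnorm alpha (phi : R -> R) : \bar R :=
  ((L2norm phi ^+ 2 +
    cL2norm (fun w => (`|w| `^ alpha)%:C * fourier phi w)%R ^+ 2) `^ 2^-1)%E.

(* The completion of the test functions under [Hnorm alpha], realised inside
   L^2: an abstract limit of a Cauchy sequence is identified with its L^2
   limit. *)
Definition Halpha alpha u : Prop :=
  L2 u /\ exists phi : nat -> R -> R,
    [/\ forall n, test_function (phi n),
        forall e : R, 0 < e -> exists N, forall m n, (N <= m)%N -> (N <= n)%N ->
          (Hnorm alpha (phi m \- phi n)%R < e%:E)%E
      & L2norm (phi n \- u) @[n --> \oo] --> 0%E].

(* [(iw)^alpha]; at [w = 0] it vanishes for [alpha != 0]. *)
Definition LW_symbol alpha (w : R) : R[i] :=
  (`|w| `^ alpha)%:C *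
  (cos (pi * alpha * Num.sg w / 2) +i* sin (pi * alpha * Num.sg w / 2)).

(* [g] is (a representative of) the left Liouville-Weyl derivative of order
   [alpha] of [u], defined through its Fourier multiplier. *)
Definition is_left_LW_derivative alpha u g : Prop :=
  exists U, is_fourierL2 u U /\
            is_fourierL2 g (fun w => LW_symbol alpha w * U w).

Definition primitive0 (f : R -> R) (x : R) : R :=
  if 0 <= x then \int[mu]_(s in `[0, x]) f s
  else - \int[mu]_(s in `[x, 0]) f s.

(* The integrals are extended-real valued. The left one is finite because its
   integrand is integrable, so the equality also forces [f(u) v] to be
   integrable. The existential for [Dv] asserts that the derivative of each [v]
   exists; as it is unique almost everywhere, the choice is irrelevant. *)
Definition weak_solution alpha (f : R -> R) u : Prop :=
  Halpha alpha u /\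
  exists2 Du, is_left_LW_derivative alpha u Du &
    forall v, Halpha alpha v ->
      exists2 Dv, is_left_LW_derivative alpha v Dv &
        (\int[mu]_t (Du t * Dv t + u t * v t)%:E =
         \int[mu]_t (f (u t) * v t)%:E)%E.

End Defs.

(* Main.v *)
Require Import Defs.
From HB Require Import structures.
From mathcomp Require Import all_boot all_order all_algebra.
From mathcomp Require Import complex ring lra.
From mathcomp Require Import all_classical all_reals all_analysis.
From mathcomp Require Import measurable_realfun.

(** The solution is a limit of functions that almost minimise the action
    [energy u / 2 - \int F(u)] over the Nehari manifold, made of the [u] that are
    somewhere positive and satisfy [energy u = \int u f(u)].

    All of the variational argument takes place among test functions, where every
    integral converges. The Fourier transform is replaced by the Hartley transform
    [hart], with kernel [cos + sin], so that only real functions occur; inversion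
    and Plancherel's theorem ([hart_inversion], [plancherel]) come from the Poisson
    kernel. The fractional energy of a test function is read on the transform side,
    and [alpha > 1/2] makes it control the supremum and a modulus of continuity
    ([energy_sup], [energy_equicontinuous]).

    On the manifold the Ambrosetti-Rabinowitz condition bounds the energy by the
    action ([nehari_coercive]), superlinearity at the origin forces a peak of a
    definite height ([nehari_peak]), and by the monotonicity of [f s / s] the action
    is maximal at [u] along the ray of [u] ([nehari_fibre_max]), a ray that crosses
    the manifold transversally ([nehari_crossing]). An element of the manifold
    whose action is almost minimal is therefore almost critical: descending along a
    test function and coming back along the ray would otherwise lead below the
    infimum ([nehari_almost_critical]). A minimising sequence, translated so that
    its peaks are at the origin, is thus a sequence of almost critical points
    ([palais_smale]).

    Being equicontinuous it converges at every point, along a subsequence, to some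
    [u] that is positive near the origin. Convex combinations of the tails converge in
    energy ([mazur]), which puts [u] in the completed space; against a fixed test
    function the nonlinear term sees a bounded set only, so pointwise convergence is
    enough for it to pass to the limit ([critical_limit]).

    It remains to translate this into Fourier multipliers. The symbol [(iw)^alpha]
    rotates the pair of values of a Hartley transform at [w] and [- w]
    ([LW_symbol_mul]). The derivative of a test function is a bounded continuous
    function whose transform is the expected one ([hartL2_LWd]), and the transform of
    square integrable functions is closed ([hartL2_closed]); so limits in energy
    have a derivative ([energy_limit]), and density of the test functions concludes
    ([weak_solution_of_limit]). *)

Set Implicit Arguments.
Unset Strict Implicit.
Unset Printing Implicit Defensive.

Import Order.TTheory GRing.Theory Num.Theory.
Import numFieldNormedType.Exports.

Local Open Scope classical_set_scope.
Local Open Scope ring_scope.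

(** * Integrals of real functions over the line *)

Section LineIntegrals.
Context {R : realType}.
Local Notation mu := (@lebesgue_measure R).
Local Notation "'\I' f" := (\int[mu]_x f x) (at level 10, f at level 9).
Implicit Types f g u v : R -> R.

(** Unlocks the filter lemmas for almost everywhere statements: the structure is
    found on the measurable carrier of the Lebesgue measure, not on [R]. *)
#[global] Instance ae_lebesgue_filter : Filter (nbhs (almost_everywhere mu)).
Proof. exact: (@ae_filter_ringOfSetsType _ (measurableTypeR R) R mu). Qed.

Lemma eq_ler (x y : R) : x = y -> x <= y.
Proof. by move=> ->. Qed.

Definition intg f : Prop := mu.-integrable setT (EFin \o f).

Lemma intg_meas f : intg f -> measurable_fun setT f.
Proof. by move=> /measurable_int /measurable_EFinP. Qed.

Lemma intgD f g : intg f -> intg g -> intg (fun x => f x + g x).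
Proof. by move=> hf hg; exact: (integrableD measurableT hf hg). Qed.

Lemma intgB f g : intg f -> intg g -> intg (fun x => f x - g x).
Proof. by move=> hf hg; exact: (integrableB measurableT hf hg). Qed.

Lemma intgZ k f : intg f -> intg (fun x => k * f x).
Proof. by move=> hf; exact: (integrableZl measurableT k hf). Qed.

Lemma le_intg f g : measurable_fun setT f -> intg g ->
  (forall x, `|f x| <= g x) -> intg f.
Proof.
move=> mf ig fg; apply: (le_integrable measurableT) ig; first exact/measurable_EFinP.
by move=> x _ /=; rewrite lee_fin (le_trans (fg x))// ler_norm.
Qed.

Lemma intg_norm f : intg f -> intg (fun x => `|f x|).
Proof. by move=> hf; exact: (integrable_norm hf). Qed.

Lemma intgM f g M : intg f -> measurable_fun setT g ->
  (forall x, `|g x| <= M) -> intg (fun x => f x * g x).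
Proof.
move=> hf mg gM; apply: (@le_intg _ (fun x => M * `|f x|)).
- by apply: measurable_funM => //; exact: intg_meas.
- exact/intgZ/intg_norm.
- by move=> x; rewrite normrM mulrC ler_wpM2r.
Qed.

Lemma RintgD f g : intg f -> intg g ->
  \int[mu]_x (f x + g x) = \I f + \I g.
Proof. by move=> hf hg; rewrite RintegralD. Qed.

Lemma RintgB f g : intg f -> intg g ->
  \int[mu]_x (f x - g x) = \I f - \I g.
Proof. by move=> hf hg; rewrite RintegralB. Qed.

Lemma RintgZ k f : intg f -> \int[mu]_x (k * f x) = k * \I f.
Proof. by move=> hf; rewrite RintegralZl. Qed.

Lemma le_Rintg f g : intg f -> intg g -> (forall x, f x <= g x) ->
  \I f <= \I g.
Proof. by move=> hf hg fg; apply: le_Rintegral => // x _; exact: fg. Qed.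

Lemma Rintg_ge0 f : (forall x, 0 <= f x) -> 0 <= \I f.
Proof. by move=> f0; apply: Rintegral_ge0 => x _. Qed.

Lemma le_norm_Rintg f : intg f -> `|\I f| <= \int[mu]_x `|f x|.
Proof. by move=> hf; apply: le_normr_Rintegral. Qed.

Lemma RintgE f : intg f -> (\int[mu]_x (f x)%:E)%E = (\I f)%:E.
Proof. by move=> hf; rewrite fineK//; exact: integrable_fin_num. Qed.

Lemma Rintg_dct (F : nat -> R -> R) f g :
  (forall n, measurable_fun setT (F n)) -> measurable_fun setT f ->
  {ae mu, forall x, F n x @[n --> \oo] --> f x} ->
  intg g -> (forall n x, `|F n x| <= g x) ->
  intg f /\ \I (F n) @[n --> \oo] --> \I f.
Proof.
move=> mF mf Ff ig Fg.
have [|||||iF _ cF] := @dominated_convergence _ _ R mu setT measurableT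
   (fun n => EFin \o F n) (EFin \o f) (EFin \o g).
- by move=> n; apply: measurableT_comp (mF n) => //.
- by apply: measurableT_comp mf.
- have := Ff; apply: filterS => x h _; apply: cvg_EFin; first exact: nearW.
  exact: h.
- exact: ig.
- by apply: aeW => x n _ /=; rewrite lee_fin.
split => //.
by apply: fine_cvg; rewrite fineK//; exact: integrable_fin_num.
Qed.

Lemma measurable_pinv f : measurable_fun setT f -> (forall x, 0 < f x) ->
  measurable_fun setT (fun x => (f x)^-1).
Proof.
move=> mf f0; rewrite (_ : (fun x => (f x)^-1) = (fun x => f x `^ (-1))).
  exact: (measurableT_comp (measurable_powR (-1)) mf).
by apply/funext => x; rewrite powR_inv1// ltW.
Qed.

Lemma cont_meas f : continuous f -> measurable_fun setT f.
Proof. exact: continuous_measurable_fun. Qed.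

Lemma intg_indic_itv (M : R) : intg (\1_`[-M, M]).
Proof.
rewrite /intg; exact: integrable_indic_itv.
Qed.

Lemma intg_bounded_supp f (M C : R) : measurable_fun setT f ->
  (forall x, M < `|x| -> f x = 0) -> (forall x, `|f x| <= C) -> intg f.
Proof.
move=> mf f0 fC; apply: (@le_intg _ (fun x => C * \1_`[-M, M] x)) => //.
  exact/intgZ/intg_indic_itv.
move=> x; rewrite indicE; case: (boolP (x \in _)) => [_|xM].
  by rewrite mulr1.
rewrite f0 ?normr0 ?mulr0// ltNge; apply/negP => xM'.
by move/negP: xM; apply; rewrite inE/= in_itv/= -ler_norml.
Qed.

(** ** Affine changes of variable *)

Let affm (a b : R) : measurableTypeR R -> measurableTypeR R := fun z => a * z + b.

Lemma measurable_affine (a b : R) : measurable_fun setT (fun z : R => a * z + b).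
Proof. by apply: measurable_funD => //; exact: measurable_funM. Qed.

Let mmaffine (a b : R) : measurable_fun setT (affm a b).
Proof. exact: measurable_affine. Qed.

Let pf a b : {measure set (measurableTypeR R) -> \bar R} :=
  measure_function_pushforward__canonical__measure_function_Measure
    mu (mmaffine a b).

Lemma lebesgue_measure_affine (a b : R) (A : set R) : 0 < a -> measurable A ->
  (a%:E * pf a b A)%E = mu A.
Proof.
move=> a0 mA.
pose na : {nonneg R} := NngNum (ltW a0).
suff h X : ocitv X -> mu X = mscale na (pf a b) X.
  exact: (esym (lebesgue_measure_unique h mA)).
move=> [[c d]] /= _ <-.
rewrite /mscale/= /pf/= /pushforward.
have -> : affm a b @^-1` `]c, d] = `](c - b) / a, (d - b) / a]%classic.
  apply/seteqP; split=> x /=; rewrite /affm !in_itv/= ltr_pdivrMr// ler_pdivlMr//;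
    by rewrite ltrBlDr lerBrDr mulrC.
rewrite !lebesgue_measure_itv/= !lte_fin ltr_pM2r ?invr_gt0// ltrD2r.
case: ifPn => cd; last by rewrite mule0.
rewrite -!EFinB -EFinM -mulrBl; congr EFin.
by field; rewrite gt_eqF.
Qed.

Lemma measurable_comp_affine f (a b : R) : measurable_fun setT f ->
  measurable_fun setT (fun z : R => f (a * z + b)).
Proof.
by move=> mf; apply: (measurableT_comp mf); exact: measurable_affine.
Qed.

Lemma ge0_integral_affine (g : R -> \bar R) (a b : R) : 0 < a ->
  measurable_fun setT g -> (forall x, 0 <= g x)%E ->
  (a%:E * \int[mu]_z g (a * z + b)%R = \int[mu]_x g x)%E.
Proof.
move=> a0 mg g0.
pose na : {nonneg R} := NngNum (ltW a0).
transitivity (\int[mscale na (pf a b)]_x g x)%E; last first.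
  by apply: eq_measure_integral => A mA _; exact: lebesgue_measure_affine.
have e := @ge0_integral_mscale _ (measurableTypeR R) R (pf a b) setT measurableT na g.
apply: esym; apply: eq_trans (e _ _) _ => //; congr (_ * _)%E.
by have := @ge0_integral_pushforward _ _ _ _ R (affm a b) (@mmaffine a b) mu setT g measurableT mg (fun x _ => g0 x).
Qed.

(** The effect of a substitution on nonnegative functions determines it on all
    integrable ones, as [f] is the difference of [f + `|f|] and [`|f|]. *)
Lemma intg_subst (k : R) (p : R -> R) : 0 < k -> measurable_fun setT p ->
  (forall g : R -> \bar R, measurable_fun setT g -> (forall x, 0 <= g x)%E ->
     (k%:E * \int[mu]_z g (p z) = \int[mu]_x g x)%E) ->
  forall f, intg f -> intg (fun z => f (p z)) /\ k * \int[mu]_z (f (p z)) = \I f.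
Proof.
move=> k0 mp chg.
have ig f : intg f -> intg (fun z => f (p z)).
  move=> /integrableP [/= mf fi]; apply/integrableP; split => /=.
    by apply/measurable_EFinP; apply: measurableT_comp mp; exact/measurable_EFinP.
  have mf' : measurable_fun setT (fun x => `|(f x)%:E|)%E by exact: measurableT_comp.
  move: fi; rewrite -(chg _ mf' (fun x => abse_ge0 _)).
  by rewrite muleC -lte_pdivlMr// mulyr gtr0_sg ?invr_gt0// mul1e.
have pos g : intg g -> (forall x, 0 <= g x) -> k * \int[mu]_z (g (p z)) = \I g.
  move=> hg g0; apply: EFin_inj; rewrite EFinM -!RintgE//; last exact: ig.
  apply: (chg (EFin \o g)) => //.
  by apply/measurable_EFinP; exact: intg_meas.
move=> f hf; split; first exact: ig.
have i2 := intg_norm hf; have i1 := intgD hf i2.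
have e : f = (fun x => (f x + `|f x|) - `|f x|) by apply/funext => x; rewrite addrK.
rewrite [in RHS]e RintgB// -(pos _ i1); last first.
  by move=> x; rewrite -lerBlDr sub0r lerNl -normrN ler_norm.
rewrite -(pos _ i2)// -mulrBr -(RintgB (ig _ i1) (ig _ i2)).
by congr (_ * _); apply: eq_Rintegral => x _; rewrite addrK.
Qed.

Lemma intg_affine f (a b : R) : 0 < a -> intg f -> intg (fun z : R => f (a * z + b)).
Proof.
move=> a0 hf; have h (g : R -> \bar R) := @ge0_integral_affine g a b a0.
exact: (intg_subst a0 (measurable_affine a b) h hf).1.
Qed.

Lemma Rintg_affine f (a b : R) : 0 < a -> intg f ->
  a * \int[mu]_z (f (a * z + b)) = \I f.
Proof.
move=> a0 hf; have h (g : R -> \bar R) := @ge0_integral_affine g a b a0.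
exact: (intg_subst a0 (measurable_affine a b) h hf).2.
Qed.

End LineIntegrals.

(** * Square-integrable functions *)

Section SquareIntegrable.
Context {R : realType}.
Local Notation mu := (@lebesgue_measure R).
Implicit Types f g u v : R -> R.

Lemma intg_eq f g : f =1 g -> intg f -> intg g.
Proof. by move=> /funext ->. Qed.

Lemma ge0_integralN (g : R -> \bar R) :
  measurable_fun setT g -> (forall x, 0 <= g x)%E ->
  (\int[mu]_z g (- z)%R = \int[mu]_x g x)%E.
Proof.
move=> mg g0.
have mo : measurable_fun setT (-%R : measurableTypeR R -> measurableTypeR R).
  exact: oppr_measurable.
have := @ge0_integral_pushforward _ _ _ _ R _ mo mu setT g measurableT mg
  (fun x _ => g0 x).
move=> /= <-.
by apply: eq_measure_integral => A mA _; exact: (lebesgue_measureN mA).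
Qed.

Lemma meas_oppr f : measurable_fun setT f -> measurable_fun setT (fun x : R => f (- x)).
Proof. by move=> mf; apply: (measurableT_comp mf); exact: oppr_measurable. Qed.

Let substN f : intg f -> intg (fun z : R => f (- z)) /\
  1 * \int[mu]_z (f (- z)) = \int[mu]_x f x.
Proof.
have mo := @oppr_measurable R setT.
apply: (intg_subst ltr01 mo) => g mg g0.
by rewrite mul1e; exact: ge0_integralN.
Qed.

Lemma intgNx f : intg f -> intg (fun z : R => f (- z)).
Proof. by move=> /substN[]. Qed.

Lemma RintgNx f : intg f -> \int[mu]_z (f (- z)) = \int[mu]_x f x.
Proof. by move=> /substN[_]; rewrite mul1r. Qed.

Definition sqi u : Prop := measurable_fun setT u /\ intg (fun x => u x ^+ 2).
Definition nsq u : R := \int[mu]_x (u x ^+ 2).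

Lemma nsq_ge0 u : 0 <= nsq u.
Proof. by apply: Rintg_ge0 => x; exact: sqr_ge0. Qed.

Lemma le_sqi u v : measurable_fun setT u -> intg v ->
  (forall x, u x ^+ 2 <= v x) -> sqi u.
Proof.
move=> mu' iv uv; split => //; apply: le_intg iv _; first exact: measurable_funX.
by move=> x; rewrite ger0_norm ?sqr_ge0.
Qed.

Lemma sqiM u v : sqi u -> sqi v -> intg (fun x => u x * v x).
Proof.
move=> [mu' iu] [mv iv].
apply: (@le_intg _ _ (fun x => u x ^+ 2 + v x ^+ 2)).
- exact: measurable_funM.
- exact: intgD.
- move=> x; rewrite normrM -(real_normK (num_real (u x))) -(real_normK (num_real (v x))).
  have := sqr_ge0 (`|u x| - `|v x|); have := normr_ge0 (u x); have := normr_ge0 (v x).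
  nra.
Qed.

Lemma sqiD u v : sqi u -> sqi v -> sqi (fun x => u x + v x).
Proof.
move=> su sv; split; first by apply: measurable_funD; [case: su|case: sv].
apply: (@intg_eq (fun x => u x ^+ 2 + 2 * (u x * v x) + v x ^+ 2)).
  by move=> x; ring.
apply: intgD; last by case: sv.
by apply: intgD; [case: su|apply/intgZ/sqiM].
Qed.

Lemma sqiZ k u : sqi u -> sqi (fun x => k * u x).
Proof.
move=> [mu' iu]; split; first exact: measurable_funM.
apply: (@intg_eq (fun x => k ^+ 2 * u x ^+ 2)); last exact: intgZ.
by move=> x; rewrite exprMn.
Qed.

Lemma sqiB u v : sqi u -> sqi v -> sqi (fun x => u x - v x).
Proof.
move=> su sv; have := sqiD su (sqiZ (-1) sv).
by under eq_fun do rewrite mulN1r.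
Qed.

Lemma nsqZ k u : sqi u -> nsq (fun x => k * u x) = k ^+ 2 * nsq u.
Proof.
by case=> _ iu; rewrite /nsq -RintgZ//; apply: eq_Rintegral => x _; rewrite exprMn.
Qed.

Lemma nsqD u v : sqi u -> sqi v ->
  nsq (fun x => u x + v x) = nsq u + 2 * \int[mu]_x (u x * v x) + nsq v.
Proof.
move=> su sv; have iuv := sqiM su sv; have [_ iu] := su; have [_ iv] := sv.
rewrite /nsq -RintgZ// -RintgD//; last exact: intgZ.
rewrite -RintgD//; last by apply: intgD => //; exact: intgZ.
by apply: eq_Rintegral => x _; ring.
Qed.

Lemma nsqB u v : sqi u -> sqi v ->
  nsq (fun x => u x - v x) = nsq u - 2 * \int[mu]_x (u x * v x) + nsq v.
Proof.
move=> su sv; have := nsqD su (sqiZ (-1) sv); rewrite nsqZ// sqrrN expr1n mul1r.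
under eq_fun do rewrite mulN1r.
move=> ->; congr (_ + _ + _); rewrite -mulrN; congr (_ * _).
rewrite -[RHS]mulN1r -RintgZ//; last exact: sqiM.
by apply: eq_Rintegral => x _; ring.
Qed.

Lemma nsqD_le u v : sqi u -> sqi v ->
  nsq (fun x => u x + v x) <= 2 * nsq u + 2 * nsq v.
Proof.
move=> su sv; have := nsqD su sv; have := nsqB su sv.
have := nsq_ge0 (fun x => u x - v x); lra.
Qed.

Lemma nsqBC u v : nsq (fun x => u x - v x) = nsq (fun x => v x - u x).
Proof. by apply: eq_Rintegral => x _; rewrite -opprB sqrrN. Qed.

(** By the sign of the discriminant of the quadratic [t |-> nsq (u + t v) >= 0]. *)
Lemma cauchy_schwarz u v : sqi u -> sqi v ->
  (\int[mu]_x (u x * v x)) ^+ 2 <= nsq u * nsq v.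
Proof.
move=> su sv; set b := \int[mu]_x _.
have h t : 0 <= nsq u + 2 * t * b + t ^+ 2 * nsq v.
  have := nsqD su (sqiZ t sv); rewrite nsqZ// => e.
  have := nsq_ge0 (fun x => u x + t * v x); rewrite e.
  suff -> : \int[mu]_x (u x * (t * v x)) = t * b by rewrite mulrA.
  rewrite -RintgZ//; last exact: sqiM.
  by apply: eq_Rintegral => x _; ring.
have [v0|v0] := eqVneq (nsq v) 0.
  rewrite v0 mulr0; have [->|b0] := eqVneq b 0; first by rewrite expr0n.
  have := h (- (nsq u + 1) / (2 * b)); rewrite v0 mulr0 addr0.
  have -> : 2 * (- (nsq u + 1) / (2 * b)) * b = - (nsq u + 1) by field.
  by lra.
have vp : 0 < nsq v by rewrite lt_neqAle eq_sym v0 nsq_ge0.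
have := h (- b / nsq v).
have -> : nsq u + 2 * (- b / nsq v) * b + (- b / nsq v) ^+ 2 * nsq v =
  (nsq u * nsq v - b ^+ 2) / nsq v by field.
by rewrite pmulr_lge0 ?invr_gt0// subr_ge0.
Qed.

Lemma nsqE u : sqi u -> (\int[mu]_x ((u x) ^+ 2)%:E)%E = (nsq u)%:E.
Proof. by case=> _ iu; rewrite RintgE. Qed.

Lemma sqi_fin u (K : R) : measurable_fun setT u ->
  (\int[mu]_x ((u x) ^+ 2)%:E <= K%:E)%E -> sqi u /\ nsq u <= K.
Proof.
move=> mu' uK.
have su : sqi u.
  split => //; apply/integrableP; split.
    by apply/measurable_EFinP; exact: measurable_funX.
  apply: le_lt_trans (ltry K); apply: le_trans uK.
  by under eq_integral => x _ do rewrite /= ger0_norm ?sqr_ge0//.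
by split => //; rewrite -lee_fin -nsqE.
Qed.

(** Fatou's lemma. A mere bound along the sequence makes the limit square
    integrable, which is why no integrability is asked of it. *)
Lemma nsq_fatou (u_ : nat -> R -> R) u K :
  (forall n, sqi (u_ n)) -> (forall x, u_ n x @[n --> \oo] --> u x) ->
  (forall n, nsq (u_ n) <= K) -> sqi u /\ nsq u <= K.
Proof.
move=> su uu uK.
have mu' : measurable_fun setT u.
  by apply: (measurable_fun_cvg (fun n => (su n).1)) => x _; exact: uu.
apply: sqi_fin => //.
have lim x : limn_einf (fun n => ((u_ n x) ^+ 2)%:E) = ((u x) ^+ 2)%:E.
  have h : ((u_ n x) ^+ 2)%:E @[n --> \oo] --> ((u x) ^+ 2)%:E.
    apply: cvg_EFin; first exact: nearW.
    by rewrite expr2; under eq_fun do rewrite expr2; apply: cvgM.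
  by rewrite is_cvg_limn_einfE ?(cvg_lim _ h)//; apply/cvg_ex; eexists; exact: h.
rewrite -(funext lim).
apply: le_trans (fatou mu measurableT _ _) _.
- by move=> n; apply/measurable_EFinP; apply: measurable_funX; case: (su n).
- by move=> n x _; rewrite lee_fin sqr_ge0.
- rewrite limn_einf_lim; apply: lime_le.
    exact: is_cvg_einfs.
  apply: nearW => n; apply: ereal_inf_le; exists (nsq (u_ n))%:E.
    by exists n => //=; rewrite nsqE.
  by rewrite lee_fin.
Qed.

End SquareIntegrable.

(** * Completeness of the space of square integrable functions *)

Section RieszFischer.
Context {R : realType}.
Local Notation mu := (@lebesgue_measure R).
Implicit Types f g u v : R -> R.

Lemma nsq_ae u v : measurable_fun setT u -> measurable_fun setT v ->
  {ae mu, forall x, u x = v x} -> nsq u = nsq v.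
Proof.
move=> mu' mv uv; congr fine; apply: (@ae_eq_integral _ (measurableTypeR R)) => //.
- by apply/measurable_EFinP; exact: measurable_funX.
- by apply/measurable_EFinP; exact: measurable_funX.
- by have := uv; apply: filterS => x -> _.
Qed.

Lemma sqi_ae u v : measurable_fun setT v ->
  {ae mu, forall x, u x = v x} -> sqi u -> sqi v.
Proof.
move=> mv uv [mu' iu]; have := @sqi_fin R v (nsq u) mv; case => //.
rewrite -RintgE// le_eqVlt; apply/orP; left; apply/eqP.
apply: (@ae_eq_integral _ (measurableTypeR R)) => //.
- by apply/measurable_EFinP; exact: measurable_funX.
- by apply/measurable_EFinP; exact: measurable_funX.
- by have := uv; apply: filterS => x -> _.
Qed.

Let halfsum n : \sum_(0 <= k < n) (2^-1 : R) ^+ k <= 2.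
Proof.
suff -> : \sum_(0 <= k < n) (2^-1 : R) ^+ k = 2 - 2 * 2^-1 ^+ n.
  by rewrite lerBlDr lerDl mulr_ge0// exprn_ge0// invr_ge0.
elim: n => [|n IH]; first by rewrite big_geq// expr0 mulr1 subrr.
by rewrite big_nat_recr//= IH exprS; field.
Qed.

(** A sequence whose consecutive distances decay fast converges almost
    everywhere, because the series of weighted squared increments has a finite
    integral. *)
Lemma sqi_fast_cvg (w : nat -> R -> R) :
  (forall k, sqi (w k)) ->
  (forall k, nsq (fun x => w k.+1 x - w k x) <= 8^-1 ^+ k) ->
  exists2 N : set R, measurable N /\ mu N = 0%E &
    forall x, ~ N x -> cvgn (fun k => w k x).
Proof.
move=> sw dw.
pose t k x : \bar R := (4 ^+ k * (w k.+1 x - w k x) ^+ 2)%:E.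
have t0 k x : (0 <= t k x)%E by rewrite lee_fin mulr_ge0 ?sqr_ge0 ?exprn_ge0.
have sd k : sqi (fun x => w k.+1 x - w k x) by exact: sqiB.
have mt k : measurable_fun setT (t k).
  apply/measurable_EFinP; apply: measurable_funM => //.
  by apply: measurable_funX; case: (sd k).
pose S x := (\sum_(k <oo) t k x)%E.
have S0 x : (0 <= S x)%E by apply: nneseries_ge0.
have iS : mu.-integrable setT S.
  apply/integrableP; split.
    by apply: ge0_emeasurable_sum => // k _; exact: mt.
  apply: (@le_lt_trans _ _ (2 : R)%:E); last exact: ltry.
  under eq_integral => x _ do rewrite gee0_abs//.
  rewrite integral_nneseries//.
  apply: lime_le; first by apply: is_cvg_nneseries => k _ _; exact: integral_ge0.
  apply: nearW => n.
  apply: (@le_trans _ _ (\sum_(0 <= k < n) (2^-1 ^+ k)%:E)%E).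
    apply: lee_sum => k _; rewrite RintgE; last by apply: intgZ; case: (sd k).
    rewrite lee_fin RintgZ; last by case: (sd k).
    apply: (@le_trans _ _ (4 ^+ k * 8^-1 ^+ k)).
      by rewrite ler_wpM2l// ?exprn_ge0//; exact: dw.
    by rewrite -exprMn; apply: lerXn2r; rewrite ?nnegrE; lra.
  by rewrite sumEFin lee_fin.
have := @integrable_ae _ _ _ _ _ measurableT _ iS.
case=> N [mN N0 NS]; exists N; first by split.
move=> x Nx.
have Sx : S x \is a fin_num by apply: contrapT => h; apply: Nx; apply: NS => /(_ Logic.I).
pose c := fine (S x).
have c0 : 0 <= c by exact: fine_ge0.
have bd k : `|w k.+1 x - w k x| <= geometric (c + 1) 2^-1 k.
  have : (t k x <= S x)%E.
    apply: le_trans (@nneseries_lim_ge R (t ^~ x) xpredT 0 k.+1 _) => //.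
    by rewrite big_nat_recr//= leeDr// sume_ge0.
  rewrite /t -(fineK Sx) lee_fin -/c => h.
  have p0 : (0 : R) < 2 ^+ k by rewrite exprn_gt0.
  rewrite /geometric/= exprVn ler_pdivlMr//.
  have e4 : (4 : R) ^+ k = 2 ^+ k * 2 ^+ k by rewrite -exprMn; congr (_ ^+ _); ring.
  move: h; rewrite e4 -(real_normK (num_real (w k.+1 x - w k x))).
  set d := `|_|; set p := 2 ^+ k => h.
  have : (d * p - 2^-1) ^+ 2 >= 0 by exact: sqr_ge0.
  nra.
have : cvgn (series (telescope (w ^~ x))).
  apply: normed_cvg; apply: (series_le_cvg (v_ := geometric (c + 1) 2^-1)).
  - by move=> n /=.
  - by move=> n; apply: geometric_ge0; lra.
  - by move=> n /=; rewrite /telescope/=; exact: bd.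
  - by apply: is_cvg_geometric_series; rewrite ger0_norm; lra.
rewrite telescopeK => h.
have -> : (fun k => w k x) = (fun k => (w k x - w 0%N x) + w 0%N x).
  by apply/funext => k; rewrite subrK.
by apply: is_cvgD => //; exact: is_cvg_cst.
Qed.

(** Riesz-Fischer. A subsequence with geometrically small increments converges
    off a null set, on which it is replaced by zero; Fatou's lemma then compares
    every late term with the limit. *)
Lemma sqi_complete (u : nat -> R -> R) : (forall n, sqi (u n)) ->
  (forall e, 0 < e -> exists N, forall m n, (N <= m)%N -> (N <= n)%N ->
     nsq (fun x => u m x - u n x) < e) ->
  exists2 v, sqi v & nsq (fun x => u n x - v x) @[n --> \oo] --> 0.
Proof.
move=> su cu.
have {}cu k : exists N, forall m n, (N <= m)%N -> (N <= n)%N ->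
    nsq (fun x => u m x - u n x) < 8^-1 ^+ k.
  by apply: cu; rewrite exprn_gt0.
have [K hK] := choice cu.
pose p k := (k + \sum_(i < k.+1) K i)%N.
have pK k : (K k <= p k)%N.
  by rewrite /p big_ord_recr/= addnA leq_addl.
have pS k : (p k <= p k.+1)%N.
  by rewrite /p [X in (_ <= _ + X)%N]big_ord_recr/= leq_add// leq_addr.
have [||N [mN N0] cN] := @sqi_fast_cvg (fun k => u (p k)).
- by move=> k; exact: su.
- by move=> k; apply/ltW/hK => //; exact: leq_trans (pK k) (pS k).
pose w k x := u (p k) x * \1_(~` N) x.
have mI : measurable_fun setT (\1_(~` N) : R -> R).
  by apply: measurable_indic; exact: measurableC.
have mw k : measurable_fun setT (w k) by apply: measurable_funM => //; case: (su (p k)).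
have aw k : {ae mu, forall x, u (p k) x = w k x}.
  exists N; split => // x /= h; apply: contrapT => Nx; apply: h.
  by rewrite /w indicE mem_set// mulr1.
have cw x : cvgn (fun k => w k x).
  have [Nx|Nx] := pselect (N x).
    rewrite /w indicE memNset//=.
    under eq_fun do rewrite mulr0; exact: is_cvg_cst.
  rewrite /w indicE mem_set//=.
  by under eq_fun do rewrite mulr1; exact: cN.
pose v x := limn (fun k => w k x).
have wv x : w k x @[k --> \oo] --> v x by exact: cw.
have sw k : sqi (w k) by apply: sqi_ae (aw k) (su _).
have key j m : (K j <= m)%N -> sqi (fun x => u m x - v x) /\
    nsq (fun x => u m x - v x) <= 8^-1 ^+ j.
  move=> jm; apply: (@nsq_fatou _ (fun k x => u m x - w (k + j)%N x)).
  - by move=> n; apply: sqiB.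
  - move=> x; apply: cvgB; first exact: cvg_cst.
    by have := wv x; rewrite -(cvg_shiftn j).
  - move=> n; apply: (@le_trans _ _ (nsq (fun x => u m x - u (p (n + j)%N) x))).
      apply/eq_ler/nsq_ae.
      + by apply: measurable_funB => //; case: (su m).
      + by apply: measurable_funB; [case: (su m)|case: (su (p (n + j)))].
      + by have := aw (n + j)%N; apply: filterS => x ->.
    apply/ltW/hK => //; elim: n => [|n IH]; first exact: pK.
    exact: leq_trans IH (pS _).
exists v.
  have [s1 _] := key 0%N (K 0%N) (leqnn _).
  have := sqiB (su (K 0%N)) s1; congr (sqi _).
  by apply/funext => x; ring.
apply/cvgrPdist_le => e e0.
have := @cvg_geometric R 1 (8^-1); rewrite ger0_norm; last by lra.
move=> /(_ ltac:(lra)) /cvgrPdist_le /(_ _ e0) [j _ /(_ j (leqnn _))/=].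
rewrite sub0r normrN mul1r ger0_norm ?exprn_ge0// => je.
near=> m; rewrite sub0r normrN ger0_norm ?nsq_ge0//.
by apply: le_trans je; apply: (key j m _).2; near: m; exists (K j).
Unshelve. all: by end_near. Qed.

(** ** Comparison with the L^2 norm *)

Lemma L2P u : L2 u <-> sqi u.
Proof.
split=> [h|[mu' iu]].
  split; last exact: Lfun2_integrable_sqr.
  by move: h; rewrite /L2 inE => /andP[]; rewrite inE.
rewrite /L2 inE; apply/andP; split; first by rewrite inE.
rewrite inE/= /finite_norm unlock.
apply: poweR_lty.
have <- : (\int[mu]_x ((u x ^+ 2)%:E) = \int[mu]_x (`|(EFin \o u) x| `^ 2))%E.
  by apply: eq_integral => x _ /=; rewrite powR_mulrn// real_normK// num_real.
by rewrite RintgE// ltry.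
Qed.

Lemma L2normE u : sqi u -> L2norm u = (Num.sqrt (nsq u))%:E.
Proof.
move=> [mu' iu]; rewrite /L2norm unlock.
have <- : (\int[mu]_x ((u x ^+ 2)%:E) = \int[mu]_x (`|(EFin \o u) x| `^ 2))%E.
  by apply: eq_integral => x _ /=; rewrite powR_mulrn// real_normK// num_real.
by rewrite RintgE//= powR12_sqrt// nsq_ge0.
Qed.

Lemma L2norm_cvg0 (u : nat -> R -> R) : (forall n, sqi (u n)) ->
  L2norm (u n) @[n --> \oo] --> 0%E <-> nsq (u n) @[n --> \oo] --> 0.
Proof.
move=> su; under eq_fun do rewrite L2normE//.
split.
  move=> /fine_cvgP[_] /= h.
  have -> : (fun n => nsq (u n)) =
      (fun n => Num.sqrt (nsq (u n)) * Num.sqrt (nsq (u n))).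
    by apply/funext => n; rewrite -expr2 sqr_sqrtr// nsq_ge0.
  by rewrite -(mulr0 0); apply: cvgM; exact: h.
move=> h; apply: cvg_EFin; first exact: nearW.
rewrite -[X in _ --> X]sqrtr0.
exact: (continuous_cvg _ (@sqrt_continuous R 0) h).
Qed.

End RieszFischer.

(** * The Hartley transform *)

Section Hartley.
Context {R : realType}.
Local Notation mu := (@lebesgue_measure R).
Implicit Types f g u v k : R -> R.

(** The kernel [cas] replaces [e^(-ixw)]: on real functions the transform carries
    the same information as that of Fourier, but it is real valued, self-adjoint,
    and its square is a multiple of the identity. *)
Definition cas (x : R) : R := cos x + sin x.

Definition hart u (w : R) : R := \int[mu]_x (cas (x * w) * u x).

Lemma cas_le2 x : `|cas x| <= 2.
Proof.
apply: le_trans (ler_normD _ _) _.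
have -> : (2 : R) = 1 + 1 by ring.
by rewrite lerD// ler_norml ?cos_geN1 ?cos_le1 ?sin_geN1 ?sin_le1.
Qed.

Lemma casD a b : cas (a + b) = cos b * cas a + sin b * cas (- a).
Proof. by rewrite /cas cosD sinD cosN sinN; ring. Qed.

Lemma casM a b : cas a * cas b = cos (a - b) + sin (a + b).
Proof. by rewrite /cas cosB sinD; ring. Qed.

Lemma continuous_cas : continuous cas.
Proof. by move=> x; apply: cvgD; [exact: continuous_cos|exact: continuous_sin]. Qed.

Lemma measurable_cas : measurable_fun setT cas.
Proof. exact: cont_meas continuous_cas. Qed.

Lemma measurable_casM (a : R) : measurable_fun setT (fun x : R => cas (x * a)).
Proof.
apply: (measurableT_comp measurable_cas).
by apply: measurable_funM => //; exact: measurable_id.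
Qed.

Lemma measurable_Mcas (a : R) : measurable_fun setT (fun x : R => cas (a * x)).
Proof.
by under eq_fun do rewrite mulrC; exact: measurable_casM.
Qed.

Lemma intg_cas u w : intg u -> intg (fun x => cas (x * w) * u x).
Proof.
move=> iu; apply: (@intg_eq _ (fun x => u x * cas (x * w))).
  by move=> x; rewrite mulrC.
by apply: (intgM (M := 2) iu); [exact: measurable_casM|move=> x; exact: cas_le2].
Qed.

Lemma hartD u v w : intg u -> intg v ->
  hart (fun x => u x + v x) w = hart u w + hart v w.
Proof.
move=> iu iv; rewrite /hart -RintgD; [|exact: intg_cas..].
by apply: eq_Rintegral => x _; rewrite mulrDr.
Qed.

Lemma hartZ c u w : intg u -> hart (fun x => c * u x) w = c * hart u w.
Proof.
move=> iu; rewrite /hart -RintgZ; last exact: intg_cas.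
by apply: eq_Rintegral => x _; rewrite mulrCA.
Qed.

Lemma hartB u v w : intg u -> intg v ->
  hart (fun x => u x - v x) w = hart u w - hart v w.
Proof.
move=> iu iv; rewrite /hart -RintgB; [|exact: intg_cas..].
by apply: eq_Rintegral => x _; rewrite mulrBr.
Qed.

Lemma le_hart u w : intg u -> `|hart u w| <= 2 * \int[mu]_x `|u x|.
Proof.
move=> iu; apply: le_trans (le_norm_Rintg (intg_cas _ iu)) _.
rewrite -RintgZ; last exact: intg_norm.
apply: le_Rintg; [exact/intg_norm/intg_cas|exact/intgZ/intg_norm|].
by move=> x; rewrite normrM ler_wpM2r// cas_le2.
Qed.

Lemma continuous_seq f (x : R) :
  (forall s : nat -> R, s n @[n --> \oo] --> x -> f (s n) @[n --> \oo] --> f x) ->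
  {for x, continuous f}.
Proof. by move=> h; apply/(@cvg_nbhsP _ R^o) => s; exact: h. Qed.

Lemma seq_continuous f (x : R) (s : nat -> R) :
  {for x, continuous f} -> s n @[n --> \oo] --> x -> f (s n) @[n --> \oo] --> f x.
Proof. by move=> h sx; apply: (cvg_comp _ _ sx h). Qed.

Lemma continuous_hart u : intg u -> continuous (hart u).
Proof.
move=> iu w; apply: continuous_seq => s sw.
apply: (@Rintg_dct _ (fun n x => cas (x * s n) * u x) _
   (fun x => 2 * `|u x|) _ _ _ _ _).2.
- by move=> n; exact: intg_meas (intg_cas _ iu).
- exact: intg_meas (intg_cas _ iu).
- apply: aeW => x; apply: cvgM; last exact: cvg_cst.
  apply: (@seq_continuous cas (x * w) (fun n => x * s n)); first exact: continuous_cas.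
  by apply: cvgM => //; exact: cvg_cst.
- exact/intgZ/intg_norm.
- by move=> n x; rewrite normrM ler_wpM2r// cas_le2.
Qed.

Lemma measurable_hart u : intg u -> measurable_fun setT (hart u).
Proof. by move=> iu; apply: cont_meas; exact: continuous_hart. Qed.

Lemma intgM_hart k u : intg k -> intg u -> intg (fun w => k w * hart u w).
Proof.
move=> ik iu; apply: (intgM (M := 2 * \int[mu]_x `|u x|)) => //.
  exact: measurable_hart.
by move=> w; exact: le_hart.
Qed.

(** The Hartley transform is self-adjoint: its kernel is symmetric. *)
Lemma hart_dual k u : intg k -> intg u ->
  \int[mu]_w (k w * hart u w) = \int[mu]_x (u x * hart k x).
Proof.
move=> ik iu.
pose T := measurableTypeR R.
pose F (z : T * T) : \bar R := (k z.1 * (cas (z.2 * z.1) * u z.2))%:E.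
have mF : measurable_fun setT F.
  apply/measurable_EFinP; apply: measurable_funM.
    by apply: (measurableT_comp (intg_meas ik)); exact: measurable_fst.
  apply: measurable_funM.
    apply: (measurableT_comp measurable_cas); apply: measurable_funM.
      exact: measurable_snd.
    exact: measurable_fst.
  by apply: (measurableT_comp (intg_meas iu)); exact: measurable_snd.
have iF : (mu \x mu)%E.-integrable setT F.
  apply/integrable12ltyP => //.
  apply: (@le_lt_trans _ _ (\int[mu]_w (2 * (\int[mu]_x `|u x|) * `|k w|)%:E)%E).
    apply: ge0_le_integral => //.
    - by move=> w _; exact: integral_ge0.
    - apply: (measurable_fun_fubini_tonelli_F (abse \o F)) => //=.
      exact: measurableT_comp.
    - by apply/measurable_EFinP; exact: intg_meas (intgZ _ (intg_norm ik)).
    - move=> w _.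
      under eq_integral => x _ do rewrite /F/= normrM.
      rewrite (_ : (\int[mu]_x _)%E = (\int[mu]_x (`|k w| * `|cas (x * w) * u x|))%:E).
        rewrite lee_fin RintgZ; last exact/intg_norm/intg_cas.
        rewrite mulrC ler_wpM2r// -RintgZ; last exact: intg_norm.
        apply: le_Rintg; [exact/intg_norm/intg_cas|exact/intgZ/intg_norm|].
        by move=> x; rewrite normrM ler_wpM2r// cas_le2.
      by rewrite RintgE//; exact/intgZ/intg_norm/intg_cas.
  by rewrite RintgE ?ltry//; exact/intgZ/intg_norm.
have := Fubini iF; rewrite /F/=.
under eq_integral => w _.
  rewrite RintgE; last exact/intgZ/intg_cas.
  rewrite RintgZ; last exact: intg_cas.
  over.
under [in X in _ = X -> _]eq_integral => x _.
  rewrite (_ : (\int[mu]_w _)%E = (u x * hart k x)%:E).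
    over.
  rewrite /hart -RintgZ; last exact: intg_cas.
  rewrite -RintgE; last exact/intgZ/intg_cas.
  by apply: eq_integral => w _; congr EFin; rewrite [x * w]mulrC; ring.
rewrite RintgE; last exact: intgM_hart.
by rewrite RintgE; [case|exact: intgM_hart].
Qed.

(** ** The Poisson kernel *)

Definition pexp (e w : R) : R := expR (- (e * `|w|)).

Lemma pexp_ge0 (e w : R) : 0 <= pexp e w.
Proof. exact: expR_ge0. Qed.

Lemma pexp_le1 (e w : R) : 0 <= e -> pexp e w <= 1.
Proof. by move=> e0; rewrite /pexp -expR0 ler_expR lerNl oppr0 mulr_ge0. Qed.

Lemma continuous_pexp (e : R) : continuous (pexp e).
Proof.
move=> w; rewrite /pexp.
apply: (@continuous_comp _ _ _ (fun w => - (e * `|w|)) expR); last exact: continuous_expR.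
by apply: cvgN; apply: cvgM; [exact: cvg_cst|exact: norm_continuous].
Qed.

(** An antiderivative of [e^(-ew) (1 + cos (a w))] on the half line. The constant
    [1] makes the integrand nonnegative, as integration up to infinity by means of
    an antiderivative requires. *)
Let F0 (e a w : R) := - (e^-1 * expR (- (e * w))) +
  expR (- (e * w)) * (a * sin (a * w) - e * cos (a * w)) / (e ^+ 2 + a ^+ 2).

Let F0_derive (e a w : R) : e != 0 -> e ^+ 2 + a ^+ 2 != 0 ->
  is_derive w 1 (F0 e a) (expR (- (e * w)) * (1 + cos (a * w))).
Proof.
move=> e0 ea0; rewrite /F0.
have d1 : is_derive w 1 (fun w : R => expR (- (e * w))) (- e * expR (- (e * w))).
  by apply: is_derive_eq; rewrite /GRing.scale/=; ring.
have d2 : is_derive w 1 (fun w : R => sin (a * w)) (a * cos (a * w)).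
  by apply: is_derive_eq; rewrite /GRing.scale/=; ring.
have d3 : is_derive w 1 (fun w : R => cos (a * w)) (- a * sin (a * w)).
  by apply: is_derive_eq; rewrite /GRing.scale/=; ring.
apply: is_derive_eq. rewrite /GRing.scale/=.
by field; rewrite e0 ea0.
Qed.

Let F0_at0 (e a : R) : e != 0 -> F0 e a 0 = - (e^-1 + e / (e ^+ 2 + a ^+ 2)).
Proof.
move=> e0; rewrite /F0 !mulr0 oppr0 expR0 sin0 cos0 mulr0 mulr1 sub0r mul1r.
by rewrite mulr1 opprD mulNr.
Qed.

Let F0_cvgy (e a : R) : 0 < e -> F0 e a w @[w --> +oo] --> 0.
Proof.
move=> e0.
pose K := `|e^-1| + (`|a| + `|e|) * `|(e ^+ 2 + a ^+ 2)^-1|.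
have E0 : expR (- (e * w)) @[w --> +oo] --> 0.
  by apply: (cvg_comp _ _ _ (@cvgr_expR R)); apply: gt0_cvgMry => //; exact: cvg_id.
have E1 : K * expR (- (e * w)) @[w --> +oo] --> 0.
  by rewrite -(mulr0 K); apply: cvgM => //; exact: cvg_cst.
apply/cvgr0Pnorm_le => d d0.
move/cvgr0Pnorm_le : E1 => /(_ _ d0); apply: filterS => w.
apply: le_trans.
have K0 : 0 <= K by rewrite addr_ge0 ?mulr_ge0 ?addr_ge0.
rewrite normrM (ger0_norm K0) (ger0_norm (expR_ge0 _)) /K mulrDl.
apply: le_trans (ler_normD _ _) _; rewrite normrN normrM (ger0_norm (expR_ge0 _)).
rewrite lerD2l -mulrA normrM (ger0_norm (expR_ge0 _)) mulrC ler_wpM2r ?expR_ge0//.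
rewrite normrM ler_wpM2r//; apply: le_trans (ler_normB _ _) _.
by rewrite lerD// normrM ler_piMr// ler_norml ?cos_geN1 ?cos_le1 ?sin_geN1 ?sin_le1.
Qed.

Let pc_cont (e a : R) : continuous (fun w => pexp e w * (1 + cos (a * w))).
Proof.
move=> w; apply: cvgM; first exact: continuous_pexp.
apply: cvgD; first exact: cvg_cst.
apply: (@continuous_comp _ _ _ (fun w : R => a * w) cos); last exact: continuous_cos.
by apply: cvgM => //; exact: cvg_cst.
Qed.

Let pc_ge0 (e a w : R) : 0 <= pexp e w * (1 + cos (a * w)).
Proof. by rewrite mulr_ge0 ?pexp_ge0// -lerBlDl sub0r cos_geN1. Qed.

Let pc_integral (e a : R) : 0 < e ->
  (\int[mu]_w (pexp e w * (1 + cos (a * w)))%:E =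
    (2 * (e^-1 + e / (e ^+ 2 + a ^+ 2)))%:E)%E.
Proof.
move=> e0; have en0 : e != 0 by rewrite gt_eqF.
have ea0 : e ^+ 2 + a ^+ 2 != 0.
  by rewrite gt_eqF// ltr_pwDl ?exprn_gt0// sqr_ge0.
rewrite (ge0_symfun_integralT (@pc_ge0 e a) (@pc_cont e a)); last first.
  by move=> w /=; rewrite /pexp normrN mulrN cosN.
rewrite [RHS]EFinM; congr (_ * _)%E.
have -> : [set x : R | 0 <= x] = `[0, +oo[%classic.
  by apply/seteqP; split=> x /=; rewrite in_itv/= andbT.
have cF w : {for w, continuous (F0 e a)}.
  apply: differentiable_continuous; apply/derivable1_diffP.
  by have [] := F0_derive w en0 ea0.
rewrite (@ge0_continuous_FTC2y _ _ (F0 e a) 0 0).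
- by rewrite F0_at0// EFinN oppeK add0e.
- by move=> x _; exact: pc_ge0.
- exact: continuous_subspaceT (@pc_cont e a).
- exact: F0_cvgy.
- by move=> x _; have [] := F0_derive x en0 ea0.
- apply: cvg_at_right_filter; exact: cF.
- move=> x; rewrite in_itv/= andbT => x0.
  rewrite derive1E; have [_ ->] := F0_derive x en0 ea0.
  by rewrite /pexp ger0_norm// ltW.
Qed.

Let intg_pc (e a : R) : 0 < e -> intg (fun w => pexp e w * (1 + cos (a * w))).
Proof.
move=> e0; apply/integrableP; split.
  by apply/measurable_EFinP; exact: cont_meas (@pc_cont e a).
under eq_integral => w _ do rewrite /= ger0_norm ?pc_ge0//.
by rewrite pc_integral// ltry.
Qed.

Lemma intg_pexp (e : R) : 0 < e -> intg (pexp e).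
Proof.
move=> e0; apply: (@intg_eq _ (fun w => 2^-1 * (pexp e w * (1 + cos (0 * w))))).
  by move=> w; rewrite mul0r cos0; field.
exact/intgZ/intg_pc.
Qed.

Lemma Rintg_pexp_cos (e a : R) : 0 < e ->
  \int[mu]_w (pexp e w * cos (a * w)) = 2 * e / (e ^+ 2 + a ^+ 2).
Proof.
move=> e0.
have i a' : \int[mu]_w (pexp e w * (1 + cos (a' * w))) =
    2 * (e^-1 + e / (e ^+ 2 + a' ^+ 2)).
  by rewrite /Rintegral pc_integral.
have := i 0; have := i a.
have := intg_pc a e0; have := intg_pc 0 e0 => i0 ia ea ez.
transitivity (\int[mu]_w (pexp e w * (1 + cos (a * w)) -
    2^-1 * (pexp e w * (1 + cos (0 * w))))).
  by apply: eq_Rintegral => w _; rewrite mul0r cos0; field.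
rewrite RintgB//; last exact: intgZ.
rewrite RintgZ// ea ez.
by field; rewrite !gt_eqF ?ltr_pwDl ?exprn_gt0 ?sqr_ge0.
Qed.

Lemma Rintg_odd f : intg f -> (forall x, f (- x) = - f x) -> \int[mu]_x f x = 0.
Proof.
move=> i_f fN; have := RintgNx i_f.
have -> : \int[mu]_z f (- z) = - \int[mu]_z f z.
  rewrite -[RHS]mulN1r -RintgZ//; apply: eq_Rintegral => x _.
  by rewrite fN mulN1r.
move=> /eqP; rewrite -subr_eq0 -opprD oppr_eq0 -mulr2n mulrn_eq0/=.
by move=> /eqP.
Qed.

(** The transform of a damped character is the Poisson kernel: the product of two
    [cas] is a cosine of the difference plus an odd function. *)
Lemma hart_pexp_cas (e x y : R) : 0 < e ->
  hart (fun w => pexp e w * cas (x * w)) y = 2 * e / (e ^+ 2 + (y - x) ^+ 2).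
Proof.
move=> e0; have ip := intg_pexp e0.
rewrite -Rintg_pexp_cos//.
have i1 : intg (fun w => pexp e w * cos ((y - x) * w)).
  apply: (intgM (M := 1) ip); last by move=> w; rewrite ler_norml cos_geN1 cos_le1.
  apply: (measurableT_comp (cont_meas (@continuous_cos R))).
  by apply: measurable_funM => //; exact: measurable_id.
have i2 : intg (fun w => pexp e w * sin ((y + x) * w)).
  apply: (intgM (M := 1) ip); last by move=> w; rewrite ler_norml sin_geN1 sin_le1.
  apply: (measurableT_comp (cont_meas (@continuous_sin R))).
  by apply: measurable_funM => //; exact: measurable_id.
rewrite -[RHS]addr0 -(@Rintg_odd _ i2); last first.
  by move=> w; rewrite /pexp normrN mulrN sinN mulrN.
rewrite -RintgD//; apply: eq_Rintegral => w _.
rewrite mulrCA casM -mulrDr; congr (_ * (cos _ + sin _)); ring.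
Qed.

(** ** Inversion and Plancherel *)

Definition twopi : R := pi * 2.

Let kernel_int : (\int[mu]_z ((oneDsqr z)^-1)%:E = (pi : R)%:E)%E.
Proof.
rewrite ge0_symfun_integralT.
- have -> : [set x : R | 0 <= x] = `[0, +oo[%classic.
    by apply/seteqP; split=> x /=; rewrite in_itv/= andbT.
  by rewrite integral0y_oneDsqr -EFinM; congr EFin; field.
- by move=> x /=.
- exact: continuous_oneDsqrV.
- by move=> x; rewrite /= /oneDsqr sqrrN.
Qed.

Let ik1 : intg (fun z : R => (oneDsqr z)^-1).
Proof.
apply/integrableP; split.
  apply/measurable_EFinP; exact: cont_meas (@continuous_oneDsqrV R).
under eq_integral => w _ do rewrite /= ger0_norm//.
by rewrite kernel_int ltry.
Qed.

Let ik : intg (fun z : R => 2 * (oneDsqr z)^-1).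
Proof. exact: intgZ. Qed.

Let k_int : \int[mu]_z (2 * (oneDsqr z)^-1) = twopi.
Proof. by rewrite RintgZ// /Rintegral kernel_int /= mulrC. Qed.

(** The Poisson integral of [u] at height [e], rescaled so that the kernel does
    not depend on [e]; the mass of the kernel is [twopi]. *)
Let poisson u (e x : R) := \int[mu]_z (u (e * z + x) * (2 * (oneDsqr z)^-1)).

Lemma damped_inversion u (e x : R) : 0 < e -> intg u ->
  \int[mu]_w (pexp e w * cas (x * w) * hart u w) = poisson u e x.
Proof.
move=> e0 iu.
have ip : intg (fun w => pexp e w * cas (x * w)).
  apply: (intgM (M := 2) (intg_pexp e0)); last by move=> w; exact: cas_le2.
  exact: measurable_Mcas.
rewrite hart_dual//.
under eq_Rintegral do rewrite hart_pexp_cas//.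
have e2 (y : R) : 0 < e ^+ 2 + (y - x) ^+ 2.
  by rewrite ltr_pwDl ?exprn_gt0// sqr_ge0.
have ig : intg (fun y => u y * (2 * e / (e ^+ 2 + (y - x) ^+ 2))).
  apply: (intgM (M := 2 / e) iu) => [|y].
    apply: cont_meas => y; apply: cvgM; first exact: cvg_cst.
    apply: cvgV; first by rewrite gt_eqF.
    apply: cvgD; first exact: cvg_cst.
    rewrite expr2; under eq_fun do rewrite expr2.
    by apply: cvgM; apply: cvgB => //; exact: cvg_cst.
  rewrite ger0_norm; last by rewrite divr_ge0 ?mulr_ge0 ?(ltW e0)// ltW.
  rewrite ler_pdivrMr// mulrDr -[leLHS]addr0 lerD//.
    by apply: eq_ler; field; rewrite gt_eqF.
  by rewrite mulr_ge0 ?sqr_ge0// divr_ge0// ltW.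
rewrite -(Rintg_affine x e0 ig) -RintgZ; last exact: (intg_affine x e0 ig).
apply: eq_Rintegral => z _; rewrite addrK mulrCA; congr (_ * _).
by rewrite /oneDsqr; field; rewrite !gt_eqF ?ltr_pwDl ?exprn_gt0 ?sqr_ge0.
Qed.

Let e_ (n : nat) : R := n.+1%:R^-1.

Let e_gt0 n : 0 < e_ n. Proof. by rewrite invr_gt0. Qed.

Let e_cvg : e_ n @[n --> \oo] --> 0.
Proof. exact: cvg_harmonic. Qed.

Let poisson_le u (M e x : R) : 0 < e -> measurable_fun setT u ->
  (forall y, `|u y| <= M) -> `|poisson u e x| <= M * twopi.
Proof.
move=> e0 mu' uM; rewrite -k_int -RintgZ//.
have i : intg (fun z => u (e * z + x) * (2 * (oneDsqr z)^-1)).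
  apply: (@intg_eq _ (fun z => (2 * (oneDsqr z)^-1) * u (e * z + x))).
    by move=> z; rewrite mulrC.
  by apply: (intgM (M := M) ik) => //; exact: measurable_comp_affine.
apply: le_trans (le_norm_Rintg i) _; apply: le_Rintg.
- exact: intg_norm.
- exact: intgZ.
- move=> z; rewrite normrM (ger0_norm (_ : 0 <= 2 / oneDsqr z)).
    by rewrite ler_wpM2r// mulr_ge0.
  by rewrite mulr_ge0.
Qed.

Let poisson_cvg u (M x : R) : measurable_fun setT u ->
  (forall y, `|u y| <= M) -> {for x, continuous u} ->
  poisson u (e_ n) x @[n --> \oo] --> twopi * u x.
Proof.
move=> mu' uM ux.
have -> : twopi * u x = \int[mu]_z (u x * (2 * (oneDsqr z)^-1)).
  by rewrite RintgZ// k_int mulrC.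
apply: (@Rintg_dct _ (fun n z => u (e_ n * z + x) * (2 * (oneDsqr z)^-1)) _
   (fun z => M * (2 * (oneDsqr z)^-1)) _ _ _ _ _).2.
- move=> n; apply: measurable_funM; first exact: measurable_comp_affine.
  exact: intg_meas ik.
- by apply: measurable_funM => //; exact: intg_meas ik.
- apply: aeW => z; apply: cvgM; last exact: cvg_cst.
  apply: (@seq_continuous u x (fun n => e_ n * z + x)) => //.
  rewrite -[X in _ --> X]add0r -(mul0r z); apply: cvgD; last exact: cvg_cst.
  by apply: cvgM => //; exact: cvg_cst.
- exact: intgZ.
- move=> n z; rewrite normrM (ger0_norm (_ : 0 <= 2 / oneDsqr z)).
    by rewrite ler_wpM2r// mulr_ge0.
  by rewrite mulr_ge0.
Qed.

Let pexp_cvg (w : R) : pexp (e_ n) w @[n --> \oo] --> (1 : R).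
Proof.
rewrite /pexp -expR0.
apply: (@seq_continuous expR 0 (fun n => - (e_ n * `|w|))); first exact: continuous_expR.
rewrite -[X in _ --> X]oppr0; apply: cvgN; rewrite -(mul0r `|w|).
by apply: cvgM => //; exact: cvg_cst.
Qed.

(** The limit of [damped_inversion] as the damping disappears. *)
Lemma hart_inversion u (M x : R) : intg u -> (forall y, `|u y| <= M) ->
  {for x, continuous u} -> intg (hart u) -> hart (hart u) x = twopi * u x.
Proof.
move=> iu uM ux ih; apply: (cvg_unique _ _ (poisson_cvg (intg_meas iu) uM ux)) => //.
rewrite -(_ : (fun n => \int[mu]_w (pexp (e_ n) w * cas (x * w) * hart u w)) =
   (fun n => poisson u (e_ n) x)); last first.
  by apply/funext => n; rewrite damped_inversion.
have -> : hart (hart u) x = \int[mu]_w (cas (x * w) * hart u w).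
  by apply: eq_Rintegral => w _; rewrite [w * x]mulrC.
have mc := measurable_Mcas x.
apply: (@Rintg_dct _ (fun n w => pexp (e_ n) w * cas (x * w) * hart u w) _
  (fun w => 2 * `|hart u w|) _ _ _ _ _).2.
- move=> n; apply: measurable_funM; last exact: intg_meas.
  by apply: measurable_funM => //; exact: cont_meas (@continuous_pexp _).
- by apply: measurable_funM => //; exact: intg_meas.
- apply: aeW => w; apply: cvgM; last exact: cvg_cst.
  rewrite -[X in _ --> X]mul1r; apply: cvgM; last exact: cvg_cst.
  exact: pexp_cvg.
- exact/intgZ/intg_norm.
- move=> n w; rewrite normrM ler_wpM2r// normrM (ger0_norm (pexp_ge0 _ _)).
  rewrite -[leRHS]mul1r ler_pM ?pexp_ge0 ?cas_le2// pexp_le1//.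
  exact: ltW.
Qed.

Let pexp_sq (e w : R) : pexp (e / 2) w ^+ 2 = pexp e w.
Proof. by rewrite /pexp expr2 -expRD; congr expR; field. Qed.

(** The squared norm of the damped transform is the Poisson integral of [u] tested
    against [u]; as the damping disappears it increases to the squared norm of the
    transform, while the Poisson integral tends to [twopi * u]. *)
Theorem plancherel u (M : R) : intg u -> (forall y, `|u y| <= M) ->
  {ae mu, forall x, {for x, continuous u}} ->
  sqi (hart u) /\ nsq (hart u) = twopi * nsq u.
Proof.
move=> iu uM uc.
pose v n w := pexp (e_ n / 2) w * hart u w.
have mh := measurable_hart iu.
have ik' n : intg (fun w => pexp (e_ n) w * hart u w).
  exact: intgM_hart (intg_pexp _) iu.
have vE n w : v n w ^+ 2 = (pexp (e_ n) w * hart u w) * hart u w.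
  by rewrite /v exprMn pexp_sq expr2 mulrA.
have sv n : sqi (v n).
  apply: (@le_sqi _ _ (fun w => (pexp (e_ n) w * hart u w) * hart u w)).
  - by apply: measurable_funM => //; exact: cont_meas (@continuous_pexp _).
  - exact: intgM_hart.
  - by move=> w; rewrite vE.
have nv n : nsq (v n) = \int[mu]_x (u x * poisson u (e_ n) x).
  rewrite /nsq; under eq_Rintegral do rewrite vE.
  rewrite (hart_dual (ik' n) iu); apply: eq_Rintegral => x _; congr (_ * _).
  rewrite -damped_inversion//; apply: eq_Rintegral => w _.
  by rewrite [w * x]mulrC; ring.
have uu : twopi * nsq u = \int[mu]_x (u x * (twopi * u x)).
  have iu2 : intg (fun x => u x ^+ 2).
    apply: (@intg_eq _ (fun x => u x * u x)) => [x|]; first by rewrite expr2.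
    by apply: (intgM (M := M) iu) => //; exact: intg_meas.
  by rewrite -RintgZ//; apply: eq_Rintegral => x _; ring.
have cv : nsq (v n) @[n --> \oo] --> twopi * nsq u.
  rewrite uu; under eq_fun do rewrite nv.
  apply: (@Rintg_dct _ (fun n x => u x * poisson u (e_ n) x) _
    (fun x => M * twopi * `|u x|) _ _ _ _ _).2.
  - move=> n; apply: measurable_funM; first exact: intg_meas.
    have -> : poisson u (e_ n) = hart (fun w => pexp (e_ n) w * hart u w).
      apply/funext => x; rewrite -damped_inversion//; apply: eq_Rintegral => w _.
      by rewrite [w * x]mulrC; ring.
    exact: measurable_hart.
  - apply: measurable_funM; first exact: intg_meas.
    by apply: measurable_funM => //; exact: intg_meas.
  - have := uc; apply: filterS => x ux; apply: cvgM; first exact: cvg_cst.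
    exact: poisson_cvg (intg_meas iu) uM ux.
  - exact/intgZ/intg_norm.
  - move=> n x; rewrite normrM mulrC ler_wpM2r//.
    exact: (poisson_le x (e_gt0 n) (intg_meas iu) uM).
have vh n w : v n w ^+ 2 <= hart u w ^+ 2.
  by rewrite /v exprMn ler_piMl ?sqr_ge0// exprn_ile1 ?pexp_ge0// pexp_le1// divr_ge0// ltW.
have nd : {homo (fun n => nsq (v n)) : n m / (n <= m)%N >-> n <= m}.
  move=> n m nm; apply: le_Rintg; [by case: (sv n)|by case: (sv m)|].
  move=> w; rewrite /v !exprMn ler_wpM2r ?sqr_ge0// !pexp_sq /pexp ler_expR lerN2.
  by rewrite ler_wpM2r// /e_ lef_pV2 ?posrE// ler_nat.
have [sh hle] : sqi (hart u) /\ nsq (hart u) <= twopi * nsq u.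
  apply: (@nsq_fatou _ v) => //.
    move=> w; rewrite -[X in _ --> X]mul1r; apply: cvgM; last exact: cvg_cst.
    suff : pexp (e_ n / 2) w @[n --> \oo] --> expR (- (0 / 2 * `|w|)).
      by rewrite mul0r mul0r oppr0 expR0.
    apply: (@seq_continuous expR _ (fun n => - (e_ n / 2 * `|w|))).
      exact: continuous_expR.
    apply: cvgN; apply: cvgM; last exact: cvg_cst.
    by apply: cvgM => //; exact: cvg_cst.
  move=> n; rewrite -(cvg_lim _ cv)//.
  by apply: nondecreasing_cvgn_le => //; apply/cvg_ex; eexists; exact: cv.
split => //; apply: le_anti; rewrite hle/=.
rewrite -(cvg_lim _ cv)//; apply: limr_le; first by apply/cvg_ex; eexists; exact: cv.
by apply: nearW => n; apply: le_Rintg; [by case: (sv n)|by case: sh|exact: vh].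
Qed.

End Hartley.

(** * Test functions *)

Section TestFunctions.
Context {R : realType}.
Local Notation mu := (@lebesgue_measure R).
Implicit Types f g u v phi psi : R -> R.

(** Differentiability up to a finite order, by recursion on the derivative:
    the form in which the Leibniz rule is proved by induction. *)
Fixpoint diffn (n : nat) f : Prop :=
  if n is m.+1 then (forall x, derivable f x 1) /\ diffn m (derive1 f) else True.

Lemma diffn_smooth f : (forall n, diffn n f) ->
  forall n x, derivable (derive1n n f) x 1.
Proof.
move=> h n; elim: n f h => [|n IH] f h x; first by have [] := h 1%N.
by rewrite derive1Sn; apply: IH => m; have [] := h m.+1.
Qed.

Lemma smooth_diffn f : (forall n x, derivable (derive1n n f) x 1) ->
  forall n, diffn n f.
Proof.
move=> h n; elim: n f h => [//|n IH] f h; split; first exact: (h 0%N).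
by apply: IH => m x; rewrite -derive1Sn; exact: h.
Qed.

Lemma diffnS n f : diffn n.+1 f -> diffn n f.
Proof. by elim: n f => [//|n IH] f [h1 h2]; split => //; exact: IH. Qed.

Lemma diffnD n f g : diffn n f -> diffn n g -> diffn n (fun x => f x + g x).
Proof.
elim: n f g => [//|n IH] f g [df nf] [dg ng]; split.
  by move=> x; apply: derivableD.
have -> : derive1 (fun x => f x + g x) = (fun x => (derive1 f) x + (derive1 g) x).
  by apply/funext => x; rewrite !derive1E deriveD.
exact: IH.
Qed.

Lemma diffnM n f g : diffn n f -> diffn n g -> diffn n (fun x => f x * g x).
Proof.
elim: n f g => [//|n IH] f g hf hg; have [df nf] := hf; have [dg ng] := hg; split.
  by move=> x; apply: derivableM.
have -> : derive1 (fun x => f x * g x) = (fun x => f x * (derive1 g) x + g x * (derive1 f) x).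
  by apply/funext => x; rewrite !derive1E deriveM.
by apply: diffnD; apply: IH => //; exact: diffnS.
Qed.

Lemma diffn_cst n (c : R) : diffn n (fun=> c).
Proof.
elim: n c => [//|n IH] c; split; first by move=> x; exact: derivable_cst.
have -> : derive1 (fun=> c) = (fun=> 0) by apply/funext => x; rewrite derive1_cst.
exact: IH.
Qed.

Let derive_affine f (a b x : R) : derivable f (a * x + b) 1 ->
  is_derive x 1 (fun y : R => f (a * y + b)) (a * (derive1 f) (a * x + b)).
Proof.
move=> df.
have d1 : is_derive x 1 (fun y : R => a * y + b) a.
  by apply: is_derive_eq; rewrite addr0 /GRing.scale/= mulr1.
have d2 : is_derive (a * x + b) 1 f ((derive1 f) (a * x + b)).
  by rewrite derive1E; exact: derivableP.
have := @is_derive1_comp _ f (fun y : R => a * y + b) x _ _ d2 d1.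
by move=> d; apply: is_derive_eq; rewrite mulrC.
Qed.

Lemma diffn_affine n f (a b : R) : diffn n f -> diffn n (fun x => f (a * x + b)).
Proof.
elim: n f => [//|n IH] f [df nf]; split.
  by move=> x; have [] := derive_affine (df (a * x + b)).
have -> : derive1 (fun x => f (a * x + b)) = (fun x => a * (derive1 f) (a * x + b)).
  apply/funext => x; rewrite derive1E.
  by have [_ ->] := derive_affine (df (a * x + b)).
by apply: diffnM; [exact: diffn_cst|exact: IH].
Qed.

Lemma test_functionP phi : test_function phi <->
  (forall n, diffn n phi) /\ (exists M : R, forall x : R, M < `|x| -> phi x = 0).
Proof.
by split => -[h1 h2]; split => //; [exact: smooth_diffn|exact: diffn_smooth].
Qed.

Lemma test_functionD phi psi : test_function phi -> test_function psi ->
  test_function (fun x => phi x + psi x).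
Proof.
move=> /test_functionP[sf [M fM]] /test_functionP[sg [N gN]].
apply/test_functionP; split; first by move=> n; exact: diffnD.
exists (Num.max M N) => x; rewrite gt_max => /andP[xM xN].
by rewrite fM// gN// addr0.
Qed.

Lemma test_functionZ c phi : test_function phi -> test_function (fun x => c * phi x).
Proof.
move=> /test_functionP[sf [M fM]]; apply/test_functionP; split.
  by move=> n; apply: diffnM => //; exact: diffn_cst.
by exists M => x xM; rewrite fM// mulr0.
Qed.

Lemma test_functionB phi psi : test_function phi -> test_function psi ->
  test_function (fun x => phi x - psi x).
Proof.
move=> tf tg; have := test_functionD tf (test_functionZ (-1) tg).
by under eq_fun do rewrite mulN1r.
Qed.

Lemma test_function_shift phi (y : R) : test_function phi ->
  test_function (fun x => phi (x + y)).
Proof.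
move=> /test_functionP[sf [M fM]]; apply/test_functionP; split.
  move=> n; have -> : (fun x => phi (x + y)) = (fun x => phi (1 * x + y)).
    by apply/funext => x; rewrite mul1r.
  exact: diffn_affine.
exists (M + `|y|) => x xM; apply: fM; rewrite -ltrBDr in xM.
apply: lt_le_trans xM _; rewrite lerBlDr.
by have := ler_normB (x + y) y; rewrite addrK.
Qed.

Lemma test_function_derive phi : test_function phi -> test_function (derive1 phi).
Proof.
move=> [sf [M fM]]; split.
  by move=> n x; rewrite -derive1Sn; exact: sf.
exists M => x xM; rewrite derive1E.
rewrite (near_eq_derive (g := cst 0)) ?derive_cst ?oner_neq0//.
have : \forall y \near x, M < `|y|.
  move: xM; apply: (cvgr_gt _ (@norm_continuous _ R x)).
by apply: filterS => y yM /=; rewrite fM.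
Qed.

Lemma test_function_continuous phi : test_function phi -> continuous phi.
Proof.
move=> [sf _] x; apply: differentiable_continuous; apply/derivable1_diffP.
exact: (sf 0%N).
Qed.

(** Continuous functions with bounded support: all that integration theory
    needs to know about a test function. *)
Definition contc f := continuous f /\ exists M : R, forall x : R, M < `|x| -> f x = 0.

Lemma test_function_contc phi : test_function phi -> contc phi.
Proof. by move=> tf; split; [exact: test_function_continuous|case: tf]. Qed.

Lemma bounded_on_itv f (M : R) : continuous f ->
  exists2 K : R, 0 <= K & forall x, `|x| <= M -> `|f x| <= K.
Proof.
move=> cf; have [M0|M0] := leP 0 M; last first.
  by exists 0 => // s sM; have := le_lt_trans (le_trans (normr_ge0 s) sM) M0; rewrite ltxx.
have N0 : - M <= M by lra.
have [|c _ hc] := @EVT_max R (fun x => `|f x|) (- M) M N0.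
  apply: continuous_subspaceT => x; apply: continuous_comp; first exact: cf.
  exact: norm_continuous.
by exists `|f c| => // s sM; apply: hc; rewrite in_itv/= -ler_norml.
Qed.

Lemma contc_bounded f : contc f -> exists C, forall x, `|f x| <= C.
Proof.
move=> [cf [M fM]]; have [K K0 hK] := bounded_on_itv M cf.
by exists K => x; have [/hK//|/fM->] := lerP `|x| M; rewrite normr0.
Qed.

Lemma contc_intg f : contc f -> intg f.
Proof.
move=> cf; have [C fC] := contc_bounded cf; have [c [M fM]] := cf.
exact: intg_bounded_supp (cont_meas c) fM fC.
Qed.

Lemma contcM f g : contc f -> continuous g -> contc (fun x => f x * g x).
Proof.
move=> [cf [M fM]] cg; split; first by move=> x; apply: cvgM; [exact: cf|exact: cg].
by exists M => x xM; rewrite fM// mul0r.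
Qed.

Lemma contc_sqi f : contc f -> sqi f.
Proof.
move=> cf; split; first exact: cont_meas cf.1.
apply: contc_intg; have -> : (fun x => f x ^+ 2) = (fun x => f x * f x) by [].
exact: contcM cf cf.1.
Qed.

(** ** Decay of the transform of a test function *)

(** Integration by parts; the derivative of [cas] is [cas] reflected. *)
Lemma hart_derive phi (w : R) : test_function phi ->
  hart (derive1 phi) w = - (w * hart phi (- w)).
Proof.
move=> tf; have [sf [M fM]] := tf.
have tf' := test_function_derive tf; have [_ [M' fM']] := tf'.
pose N := `|M| + `|M'| + 1.
have N0 : - N < N by rewrite gt0_cp// /N ltr_wpDl// addr_ge0.
have ri g : (forall x, N < `|x| -> g x = 0) ->
    \int[mu]_x g x = \int[mu]_(x in `[-N, N]) g x.
  move=> gN; rewrite [RHS]Rintegral_mkcond; apply: eq_Rintegral => x _.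
  rewrite patchE; case: ifPn => // h; rewrite gN// ltNge; apply/negP.
  rewrite ler_norml => h'; move/negP: h; apply.
  by rewrite inE/= in_itv/=.
have fN x : N < `|x| -> phi x = 0.
  move=> xN; apply: fM; apply: le_lt_trans xN.
  by rewrite /N -addrA (le_trans (ler_norm M))// lerDl addr_ge0.
have fN' x : N < `|x| -> (derive1 phi) x = 0.
  move=> xN; apply: fM'; apply: le_lt_trans xN.
  by rewrite /N addrAC (le_trans (ler_norm M'))// lerDr addr_ge0.
have fE (x : R) : `|x| = N -> phi x = 0.
  move=> xN; apply: fM; rewrite xN /N -addrA.
  by rewrite (le_lt_trans (ler_norm M))// ltrDl ltr_wpDl.
have dcas (x : R) : is_derive x 1 (fun x : R => cas (x * w)) (w * cas (- (x * w))).
  rewrite /cas; apply: is_derive_eq; rewrite /GRing.scale/= cosN sinN; ring.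
have ccas : continuous (fun x : R => cas (x * w)).
  move=> x; apply: (@continuous_comp _ _ _ (fun x : R => x * w) cas).
    by apply: cvgM => //; exact: cvg_cst.
  exact: continuous_cas.
have ccas' : continuous (fun x : R => w * cas (- (x * w))).
  move=> x; apply: cvgM; first exact: cvg_cst.
  apply: (@continuous_comp _ _ _ (fun x : R => - (x * w)) cas).
    by apply: cvgN; apply: cvgM => //; exact: cvg_cst.
  exact: continuous_cas.
have h1 : {within `[- N, N], continuous (derive1 phi)}.
  by apply: continuous_subspaceT; exact: test_function_continuous.
have h2 : derivable_oo_LRcontinuous phi (- N) N.
  split; first by move=> x _; exact: (sf 0%N).
    by apply: cvg_at_right_filter; exact: test_function_continuous.
  by apply: cvg_at_left_filter; exact: test_function_continuous.
have h3 : derivable_oo_LRcontinuous (fun x : R => cas (x * w)) (- N) N.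
  split; first by move=> x _; have [] := dcas x.
    by apply: cvg_at_right_filter; exact: ccas.
  by apply: cvg_at_left_filter; exact: ccas.
have h4 : {in `]- N, N[, derive1 (fun x : R => cas (x * w)) =1
    (fun x => w * cas (- (x * w)))}.
  by move=> x _; rewrite derive1E; have [_ ->] := dcas x.
have := Rintegration_by_parts N0 h1 h2 (fun _ _ => erefl)
  (continuous_subspaceT ccas') h3 h4.
have NN : `|N| = N by rewrite ger0_norm// /N addr_ge0// addr_ge0.
rewrite (fE N NN) (fE (- N)) ?normrN// !mul0r subrr sub0r.
rewrite -ri; last by move=> x /fN ->; rewrite mul0r.
rewrite -ri; last by move=> x /fN' ->; rewrite mul0r.
move=> e; rewrite /hart -RintgZ; last exact/intg_cas/contc_intg/test_function_contc.
transitivity (\int[mu]_x ((derive1 phi) x * cas (x * w))).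
  by apply: eq_Rintegral => x _; rewrite mulrC.
rewrite -[LHS]opprK -e; congr (- _).
by apply: eq_Rintegral => x _; rewrite mulrN; ring.
Qed.

Lemma contc_plancherel f : contc f -> sqi (hart f) /\ nsq (hart f) = twopi * nsq f.
Proof.
move=> cf; have [C fC] := contc_bounded cf.
apply: (plancherel (contc_intg cf) fC); apply: aeW => x; exact: cf.1.
Qed.

Lemma sqiNx u : sqi u -> sqi (fun x => u (- x)).
Proof.
move=> [mu' iu]; split; first exact: meas_oppr.
exact: (intgNx iu).
Qed.

Lemma nsqNx u : sqi u -> nsq (fun x => u (- x)) = nsq u.
Proof. by move=> [_ iu]; exact: (RintgNx iu). Qed.

Lemma nsq_sym u : sqi u -> 2 * nsq u = \int[mu]_x (u x ^+ 2 + u (- x) ^+ 2).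
Proof.
move=> su; have sN := sqiNx su; rewrite (RintgD su.2 sN.2).
have -> : \int[mu]_x (u (- x) ^+ 2) = nsq u by exact: (nsqNx su).
by rewrite mulr_natl mulr2n.
Qed.

Lemma sqi_mul_hart phi : test_function phi -> sqi (fun w => w * hart phi w).
Proof.
move=> tf; have [s _] := contc_plancherel (test_function_contc (test_function_derive tf)).
have := sqiNx s; congr (sqi _); apply/funext => w.
by rewrite hart_derive// opprK mulNr opprK.
Qed.

(** ** A test function that is positive somewhere *)

(** The functions [p(1/x) e^(-1/x)], extended by zero, are closed under derivation:
    their smoothness at the origin follows by induction on the order. *)
Let gp (p : {poly R}) (x : R) : R :=
  if 0 < x then p.[x^-1] * expR (- x^-1) else 0.

Let poly_exp_cvg (p : {poly R}) (a : R) : 0 < a ->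
  p.[y] * expR (- (a * y)) @[y --> +oo] --> 0.
Proof.
elim/poly_ind: p a => [|p c IH] a a0.
  by under eq_fun do rewrite horner0 mul0r; exact: cvg_cst.
have E (b : R) : 0 < b -> expR (- (b * w)) @[w --> +oo] --> (0 : R).
  move=> b0.
  by apply: (cvg_comp _ _ _ (@cvgr_expR R)); apply: gt0_cvgMry => //; exact: cvg_id.
have a20 : 0 < a / 2 by rewrite divr_gt0.
under eq_fun do rewrite hornerMXaddC mulrDl.
rewrite -(addr0 0); apply: cvgD; last first.
  by rewrite -(mulr0 c); apply: cvgM; [exact: cvg_cst|exact: E].
have := IH _ a20 => /cvgr0Pnorm_le h.
apply/cvgr0Pnorm_le => e e0.
have ea : 0 < e * (a / 2) by rewrite mulr_gt0.
near=> y.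
have y0 : 0 < y by near: y; exact: nbhs_pinfty_gt.
have -> : p.[y] * y * expR (- (a * y)) =
    (p.[y] * expR (- (a / 2 * y))) * (y * expR (- (a / 2 * y))).
  have -> : - (a * y) = - (a / 2 * y) + - (a / 2 * y) by field.
  by rewrite expRD; ring.
rewrite normrM; have -> : e = (e * (a / 2)) * (a / 2)^-1 by rewrite mulfK// gt_eqF.
apply: ler_pM => //; first by near: y; exact: h.
rewrite ger0_norm; last by rewrite mulr_ge0 ?expR_ge0// ltW.
rewrite expRN ler_pdivrMr ?expR_gt0// mulrC ler_pdivlMr//.
rewrite mulrC; apply: le_trans (expR_ge1Dx _).
by rewrite lerDr.
Unshelve. all: by end_near. Qed.

Let gp_cvg0 (p : {poly R}) : gp p h @[h --> 0] --> 0.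
Proof.
apply/cvgr0Pnorm_le => e e0.
have /cvgr0Pnorm_le /(_ _ e0) [M [Mr hM]] := @poly_exp_cvg p 1 ltr01.
have N0 : 0 < (`|M| + 1)^-1 by rewrite invr_gt0 ltr_wpDl.
near=> h; rewrite /gp; case: ifPn => h0; last by rewrite normr0 ltW.
have := hM h^-1; rewrite mul1r; apply.
apply: le_lt_trans (ler_norm M) _; apply: (@lt_le_trans _ _ (`|M| + 1)).
  by rewrite ltrDl.
rewrite -[leLHS]invrK lef_pV2 ?posrE//; apply: ltW.
by near: h; exact: lt_nbhsl.
Unshelve. all: by end_near. Qed.

Let gp_derive (p : {poly R}) (x : R) :
  is_derive x 1 (gp p) (gp ('X ^+ 2 * (p - p^`()%R)) x).
Proof.
have [x0|x0|x0] := ltrgtP x 0.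
- have -> : gp ('X ^+ 2 * (p - p^`()%R)) x = 0 by rewrite /gp ltNge (ltW x0).
  apply: (@near_eq_is_derive _ _ _ (cst 0)).
  have : \forall y \near x, y < 0 by exact: lt_nbhsl.
  by apply: filterS => y y0; rewrite /gp ltNge (ltW y0).
- have xn : x != 0 by rewrite gt_eqF.
  have -> : gp ('X ^+ 2 * (p - p^`()%R)) x =
      x^-1 ^+ 2 * (p.[x^-1] - p^`().[x^-1]) * expR (- x^-1).
    by rewrite /gp x0 hornerM hornerXn hornerD hornerN.
  apply: (@near_eq_is_derive _ _ _ (fun x : R => p.[x^-1] * expR (- x^-1))).
  + have : \forall y \near x, 0 < y by exact: lt_nbhsr.
    by apply: filterS => y y0; rewrite /gp y0.
  have dV : is_derive x 1 (fun y : R => y^-1) (- x ^- 2).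
    by apply: is_derive_eq; first exact: is_deriveV; rewrite scaler1.
  have dp : is_derive (x^-1) 1 (horner p) (p^`().[x^-1]).
    rewrite -[p^`().[_]]/(horner p^`() _) derivE derive1E; exact/derivableP/derivable_horner.
  have dc := @is_derive1_comp _ (horner p) (fun y : R => y^-1) x _ _ dp dV.
  by apply: is_derive_eq; rewrite /GRing.scale/= exprVn; ring.
- rewrite x0 [gp _ 0]/gp ltxx.
  have L : h^-1 *: (gp p (h *: 1 + 0) - gp p 0) @[h --> 0^'] --> (0 : R).
    have -> : (fun h : R => h^-1 *: (gp p (h *: 1 + 0) - gp p 0)) = gp (p * 'X).
      apply/funext => h; rewrite addr0 [h *: 1]mulr1 /gp ltxx subr0 /GRing.scale/=.
      by case: ifPn => _; rewrite ?mulr0// hornerMX; ring.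
    by apply: cvg_trans (gp_cvg0 (p * 'X)); apply: cvg_app; exact: nbhs_dnbhs.
  apply: DeriveDef; first by apply/cvg_ex; exists 0.
  by apply/cvg_lim.
Qed.

Let gp_diffn n p : diffn n (gp p).
Proof.
elim: n p => [//|n IH] p; split; first by move=> x; have [] := gp_derive p x.
have -> : derive1 (gp p) = gp ('X ^+ 2 * (p - p^`()%R)).
  by apply/funext => x; rewrite derive1E; have [_ ->] := gp_derive p x.
exact: IH.
Qed.

Lemma exists_test_function : exists2 phi : R -> R, test_function phi & exists x, 0 < phi x.
Proof.
exists (fun x => gp 1 x * gp 1 (- 1 * x + 1)).
  apply/test_functionP; split.
    by move=> n; apply: diffnM; [exact: gp_diffn|apply: diffn_affine; exact: gp_diffn].
  exists 1 => x.
  have [x0 _|x0] := lerP x 0; first by rewrite /gp ltNge x0/= mul0r.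
  rewrite ger0_norm ?ltW// => x1; rewrite [gp 1 (_ + _)]/gp ifN ?mulr0//.
  by rewrite -leNgt mulN1r addrC subr_le0 ltW.
exists 2^-1; have e : - 1 * 2^-1 + 1 = 2^-1 :> R by field.
by rewrite e /gp invr_gt0 ltr0n !hornerC mul1r mulr_gt0// expR_gt0.
Qed.

End TestFunctions.

(** * The energy of a test function *)

Section Energy.
Context {R : realType}.
Local Notation mu := (@lebesgue_measure R).
Implicit Types f g u v phi psi : R -> R.
Variable alpha : R.
Hypothesis halpha : 2^-1 < alpha < 1.

Definition wt (w : R) : R := `|w| `^ alpha.

Let alpha0 : 0 < alpha.
Proof. by case/andP: halpha => h _; apply: lt_trans h; rewrite invr_gt0. Qed.

Lemma wt_ge0 w : 0 <= wt w.
Proof. exact: powR_ge0. Qed.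

Lemma wt0 : wt 0 = 0.
Proof. by rewrite /wt normr0 powR0// gt_eqF. Qed.

Lemma wtN w : wt (- w) = wt w.
Proof. by rewrite /wt normrN. Qed.

Lemma measurable_wt : measurable_fun setT wt.
Proof.
apply: (measurableT_comp (measurable_powR alpha)).
exact: cont_meas (@norm_continuous _ R).
Qed.

Lemma wt_le w : wt w ^+ 2 <= 1 + w ^+ 2.
Proof.
have [w1|w1] := lerP `|w| 1.
  rewrite ler_wpDr ?sqr_ge0// exprn_ile1 ?wt_ge0// /wt.
  apply: (@le_trans _ _ (1 `^ alpha)); last by rewrite powR1.
  by apply: ge0_ler_powR; rewrite ?nnegrE// ltW.
rewrite ler_wpDl// -(real_normK (num_real w)); apply: lerXn2r; rewrite ?nnegrE//.
  exact: wt_ge0.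
rewrite /wt -[leRHS]powRr1//; apply: ler_powR; first exact: ltW.
by case/andP: halpha => _ /ltW.
Qed.

Let ws w : R := 1 + wt w ^+ 2.

Let ws_gt0 w : 0 < ws w.
Proof. by rewrite /ws ltr_wpDr ?sqr_ge0. Qed.

Let measurable_ws : measurable_fun setT ws.
Proof. by apply: measurable_funD => //; apply: measurable_funX; exact: measurable_wt. Qed.

Let measurable_wsV : measurable_fun setT (fun w => (ws w)^-1).
Proof. exact: measurable_pinv. Qed.

Let b : R := 1 - 2 * alpha.

Let b0 : b < 0.
Proof. by case/andP: halpha => h _; rewrite /b subr_lt0 mulrC -ltr_pdivrMr// mul1r. Qed.

Let powb_cvg : (w `^ b / b) @[w --> +oo] --> 0.
Proof.
rewrite -(mul0r b^-1); apply: cvgM; last exact: cvg_cst.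
apply/cvgr0Pnorm_le => e e0.
have nb : 0 < - b by rewrite oppr_gt0.
have M0 : 0 < (e^-1) `^ (- b)^-1 by apply: powR_gt0; rewrite invr_gt0.
near=> w.
have w0 : (e^-1) `^ (- b)^-1 < w.
  by near: w; apply: nbhs_pinfty_gt; exact: num_real.
rewrite ger0_norm ?powR_ge0// -[b]opprK powRN.
rewrite -[leRHS]invrK lef_pV2 ?posrE ?invr_gt0//; last exact: powR_gt0 (lt_trans M0 w0).
have -> : e^-1 = ((e^-1) `^ (- b)^-1) `^ (- b).
  by rewrite -powRrM mulVf ?gt_eqF// powRr1// invr_ge0 ltW.
by apply: ge0_ler_powR; rewrite ?nnegrE// ?ltW// (lt_trans M0 w0).
Unshelve. all: by end_near. Qed.

Let G (w : R) : R := (1 + `|w|) `^ (- (2 * alpha)).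

Let G_cont : continuous G.
Proof.
move=> w; rewrite /G.
have c1 : 1 + `|v| @[v --> w] --> 1 + `|w|.
  by apply: cvgD; [exact: cvg_cst|exact: norm_continuous].
have c2 : {for 1 + `|w|, continuous (fun t : R => t `^ (- (2 * alpha)))}.
  apply: differentiable_continuous; apply/derivable1_diffP.
  by have [] := @is_derive1_powR R (- (2 * alpha)) (1 + `|w|) (ltr_wpDr (normr_ge0 w) ltr01).
exact: (cvg_comp (fun w : R => 1 + `|w|) (fun t => t `^ (- (2 * alpha))) c1 c2).
Qed.

Let intg_G : intg G.
Proof.
apply/integrableP; split.
  by apply/measurable_EFinP; exact: cont_meas G_cont.
under eq_integral => w _ do rewrite /= ger0_norm ?powR_ge0//.
rewrite ge0_symfun_integralT//; last 2 first.
- by move=> w; exact: powR_ge0.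
- by move=> w; rewrite /G /= normrN.
have -> : [set x : R | 0 <= x] = `[0, +oo[%classic.
  by apply/seteqP; split=> x /=; rewrite in_itv/= andbT.
have dF (x : R) : 0 <= x -> is_derive x 1 (fun x : R => (1 + x) `^ b / b) (G x).
  move=> x0; have x1 : 0 < 1 + x by rewrite ltr_wpDr.
  have d1 : is_derive x 1 (fun y : R => 1 + y) 1.
    by apply: is_derive_eq; rewrite add0r mulr1.
  have d2 := @is_derive1_powR R b (1 + x) x1.
  have := @is_derive1_comp _ (fun t : R => t `^ b) (fun y : R => 1 + y) x _ _ d2 d1.
  move=> d; apply: is_derive_eq; rewrite scaler0 add0r /GRing.scale/= mulr1 mulrA.
  rewrite mulVf ?lt_eqF// mul1r /G ger0_norm//; congr (_ `^ _); rewrite /b; ring.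
have cF0 : {for 0, continuous (fun x : R => (1 + x) `^ b / b)}.
  by apply: differentiable_continuous; apply/derivable1_diffP; have [] := dF 0 (lexx _).
rewrite (@ge0_continuous_FTC2y _ _ (fun x : R => (1 + x) `^ b / b) 0 0).
- by rewrite -EFinB -EFinM ltry.
- by move=> x _; exact: powR_ge0.
- exact: continuous_subspaceT.
- apply: (cvg_comp (fun x : R => 1 + x) _ _ powb_cvg).
  apply/cvgryPge => A; near=> x; rewrite ler_wpDl//; near: x.
- by move=> x /ltW/dF[].
- by apply: cvg_at_right_filter; exact: cF0.
- move=> x; rewrite in_itv/= andbT => /ltW/dF[_ <-].
  by rewrite derive1E.
Unshelve. all: by end_near. Qed.

(** This is where [alpha > 1/2] enters: it makes functions of finite energy bounded
    and continuous. *)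
Lemma intg_wsV : intg (fun w => (1 + wt w ^+ 2)^-1).
Proof.
apply: (@le_intg _ _ (fun w => 4 * G w)) => //; first exact: intgZ.
move=> w; rewrite ger0_norm; last by rewrite invr_ge0 ltW// ws_gt0.
have p0 : 0 < 1 + `|w| by rewrite ltr_wpDr.
rewrite /G powRN ler_pdivlMr ?powR_gt0// mulrC ler_pdivrMr ?ws_gt0//.
rewrite (mulrC 2 alpha) powRrM powR_mulrn ?powR_ge0//.
have a2 : 2 `^ alpha <= 2 :> R.
  by rewrite -[leRHS]powRr1//; apply: ler_powR; [lra|case/andP: halpha => _ /ltW].
have [w1|w1] := lerP `|w| 1.
  have : (1 + `|w|) `^ alpha <= 2.
    apply: le_trans a2; apply: ge0_ler_powR; rewrite ?nnegrE ?(ltW p0) ?(ltW alpha0)//.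
    by lra.
  have := powR_ge0 (1 + `|w|) alpha; have := sqr_ge0 (wt w); nra.
have : (1 + `|w|) `^ alpha <= 2 * wt w.
  apply: (@le_trans _ _ ((2 * `|w|) `^ alpha)).
    by apply: ge0_ler_powR; rewrite ?nnegrE ?mulr_ge0 ?(ltW p0) ?(ltW alpha0)//; lra.
  by rewrite powRM// ler_wpM2r// wt_ge0.
have := powR_ge0 (1 + `|w|) alpha; have := wt_ge0 w; nra.
Qed.

Lemma twopi_gt0 : 0 < twopi :> R.
Proof. by rewrite mulr_gt0// pi_gt0. Qed.

Definition mform phi psi : R :=
  \int[mu]_w ((wt w * hart phi w) * (wt w * hart psi w)).

(** The inner product of the fractional Sobolev space, read on the side of the
    transform; dividing by [twopi] compensates Plancherel's constant. *)
Definition energyB phi psi : R :=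
  \int[mu]_x (phi x * psi x) + twopi^-1 * mform phi psi.

Definition energy phi : R := energyB phi phi.

Lemma test_function_sqi phi : test_function phi -> sqi phi.
Proof. by move=> t; exact/contc_sqi/test_function_contc. Qed.

Lemma test_function_intg phi : test_function phi -> intg phi.
Proof. by move=> t; exact/contc_intg/test_function_contc. Qed.

Lemma test_function_hart phi : test_function phi -> sqi (hart phi) /\ nsq (hart phi) = twopi * nsq phi.
Proof. by move=> t; exact/contc_plancherel/test_function_contc. Qed.

Lemma sqi_wt_hart phi : test_function phi -> sqi (fun w => wt w * hart phi w).
Proof.
move=> tf; have [sh _] := test_function_hart tf.
apply: (@le_sqi _ _ (fun w => hart phi w ^+ 2 + (w * hart phi w) ^+ 2)).
- apply: measurable_funM; first exact: measurable_wt.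
  exact: measurable_hart (test_function_intg tf).
- by apply: intgD; [case: sh|case: (sqi_mul_hart tf)].
- move=> w; rewrite !exprMn -[X in _ <= X + _]mul1r -mulrDl.
  by rewrite ler_wpM2r ?sqr_ge0// wt_le.
Qed.

Lemma energyE phi : energy phi = nsq phi + twopi^-1 * nsq (fun w => wt w * hart phi w).
Proof. by []. Qed.

Lemma energyBC phi psi : energyB phi psi = energyB psi phi.
Proof.
congr (_ + _ * _); apply: eq_Rintegral => x _; exact: mulrC.
Qed.

Lemma energyBD phi psi chi c : test_function phi -> test_function psi ->
  test_function chi ->
  energyB (fun x => phi x + c * psi x) chi = energyB phi chi + c * energyB psi chi.
Proof.
move=> tp ts tc; rewrite /energyB mulrDr addrACA.
have sp := test_function_sqi tp; have ss := test_function_sqi ts; have sc := test_function_sqi tc.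
congr (_ + _).
  rewrite -RintgZ; last exact: sqiM.
  rewrite -RintgD; [|exact: sqiM|apply: intgZ; exact: sqiM].
  by apply: eq_Rintegral => x _; ring.
rewrite mulrCA -mulrDr; congr (_ * _); rewrite /mform.
have wp := sqi_wt_hart tp; have wss := sqi_wt_hart ts; have wc := sqi_wt_hart tc.
rewrite -RintgZ; last exact: sqiM.
rewrite -RintgD; [|exact: sqiM|apply: intgZ; exact: sqiM].
apply: eq_Rintegral => w _; rewrite hartD ?hartZ; try exact: test_function_intg.
  by ring.
exact/intgZ/test_function_intg.
Qed.

Lemma energyBZ phi psi c : test_function phi -> test_function psi ->
  energyB (fun x => c * phi x) psi = c * energyB phi psi.
Proof.
move=> tp ts; have := energyBD (c - 1) tp tp ts.
have -> : (fun x => phi x + (c - 1) * phi x) = (fun x => c * phi x).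
  by apply/funext => x; ring.
by move=> ->; ring.
Qed.

Lemma energyD phi psi c : test_function phi -> test_function psi ->
  energy (fun x => phi x + c * psi x) =
  energy phi + 2 * c * energyB phi psi + c ^+ 2 * energy psi.
Proof.
move=> tp ts; have tc := test_functionD tp (test_functionZ c ts).
have e1 := energyBD c tp ts tc; have e2 := energyBD c tp ts tp.
have e3 := energyBD c tp ts ts.
rewrite /energy e1 (energyBC phi) (energyBC psi) e2 e3 (energyBC psi phi).
by move: (energyB _ _) (energyB _ _) (energyB _ _) => p r s; ring.
Qed.

Lemma energy_nsq phi : nsq phi <= energy phi.
Proof.
rewrite energyE lerDl mulr_ge0 ?nsq_ge0// invr_ge0 ltW//; exact: twopi_gt0.
Qed.

Lemma energy_ge0 phi : 0 <= energy phi.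
Proof. exact: le_trans (nsq_ge0 _) (energy_nsq _). Qed.

Lemma energyZ c phi : test_function phi ->
  energy (fun x => c * phi x) = c ^+ 2 * energy phi.
Proof.
move=> tp; rewrite !energyE mulrDr nsqZ; last exact: test_function_sqi.
congr (_ + _); rewrite mulrCA; congr (_ * _); rewrite -nsqZ; last exact: sqi_wt_hart.
apply: eq_Rintegral => w _; rewrite hartZ; last exact: test_function_intg.
by congr (_ ^+ _); ring.
Qed.

(** Translating a function rotates the pair made of the values of its transform
    at [w] and [- w]. *)
Lemma hart_shift phi (y w : R) : intg phi ->
  hart (fun x => phi (x + y)) w =
  cos (y * w) * hart phi w - sin (y * w) * hart phi (- w).
Proof.
move=> ip.
have e := @Rintg_affine R (fun x => cas ((x - y) * w) * phi x) 1 y ltr01.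
have i1 : intg (fun x => cas ((x - y) * w) * phi x).
  apply: (@intg_eq _ (fun x => phi x * cas ((x - y) * w))) => [x|]; first exact: mulrC.
  apply: (intgM (M := 2) ip); last by move=> x; exact: cas_le2.
  apply: (measurableT_comp measurable_cas).
  by apply: measurable_funM => //; apply: measurable_funB.
transitivity (\int[mu]_x (cas ((x - y) * w) * phi x)).
  rewrite -e// mul1r; apply: eq_Rintegral => x _.
  by rewrite mul1r addrK.
rewrite /hart -RintgZ; last exact: intg_cas.
rewrite -RintgZ; last exact: intg_cas.
rewrite -RintgB; [|exact/intgZ/intg_cas..].
apply: eq_Rintegral => x _.
rewrite mulrBl casD cosN sinN mulrN; ring.
Qed.

Lemma energy_shift phi (y : R) : test_function phi ->
  energy (fun x => phi (x + y)) = energy phi.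
Proof.
move=> tp; have ts := test_function_shift y tp; rewrite !energyE; congr (_ + _ * _).
  have := @Rintg_affine R (fun x => phi x ^+ 2) 1 y ltr01 (test_function_sqi tp).2.
  by rewrite mul1r => h; rewrite /nsq -h; apply: eq_Rintegral => x _; rewrite mul1r.
have sp := sqi_wt_hart tp; have ss := sqi_wt_hart ts.
have two0 : 2 != 0 :> R by [].
apply: (mulfI two0 (eq_trans (nsq_sym ss) (eq_trans _ (esym (nsq_sym sp))))).
apply: eq_Rintegral => w _.
have ip := test_function_intg tp; rewrite !wtN !(hart_shift _ _ ip) opprK mulrN cosN sinN.
have := cos2Dsin2 (y * w).
set c := cos _; set s := sin _; set h := hart _ _; set h' := hart _ _; set p := wt w.
move=> e; transitivity ((c ^+ 2 + s ^+ 2) * ((p * h) ^+ 2 + (p * h') ^+ 2)).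
  by ring.
by rewrite e mul1r.
Qed.

Let sw (w : R) : R := Num.sqrt (ws w).

Let sw_gt0 w : 0 < sw w.
Proof. by rewrite sqrtr_gt0 ws_gt0. Qed.

Let swE w : sw w ^+ 2 = ws w.
Proof. by rewrite sqr_sqrtr// ltW// ws_gt0. Qed.

Let measurable_sw : measurable_fun setT sw.
Proof.
by apply: (measurableT_comp (cont_meas (@sqrt_continuous R))); exact: measurable_ws.
Qed.

Let sqi_sw_hart phi : test_function phi ->
  sqi (fun w => sw w * hart phi w) /\
  nsq (fun w => sw w * hart phi w) = twopi * energy phi.
Proof.
move=> tp; have [sh nh] := test_function_hart tp; have swh := sqi_wt_hart tp.
have e w : (sw w * hart phi w) ^+ 2 = hart phi w ^+ 2 + (wt w * hart phi w) ^+ 2.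
  by rewrite exprMn swE /ws; ring.
split.
  apply: (@le_sqi _ _ (fun w => hart phi w ^+ 2 + (wt w * hart phi w) ^+ 2)).
  - by apply: measurable_funM => //; case: sh.
  - by apply: intgD; [case: sh|case: swh].
  - by move=> w; rewrite e.
rewrite /nsq; under eq_Rintegral do rewrite e.
rewrite RintgD; [|by case: sh|by case: swh].
rewrite -![\int[mu]_w _]/(nsq _) nh energyE mulrDr mulrA divff ?mul1r//.
by rewrite gt_eqF// twopi_gt0.
Qed.

Let sqi_div_sw (m : R -> R) (C : R) : measurable_fun setT m ->
  (forall w, m w ^+ 2 <= C) -> sqi (fun w => m w / sw w).
Proof.
move=> mm mC; apply: (@le_sqi _ _ (fun w => C * (ws w)^-1)).
- by apply: measurable_funM => //; exact: measurable_pinv.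
- exact: intgZ intg_wsV.
- by move=> w; rewrite expr_div_n swE ler_wpM2r// invr_ge0 ltW.
Qed.

Lemma intg_hart phi : test_function phi -> intg (hart phi).
Proof.
move=> tp; have [s _] := sqi_sw_hart tp.
have s1 : sqi (fun w => 1 / sw w).
  by apply: (@sqi_div_sw _ 1) => // w; rewrite expr1n.
apply: (intg_eq _ (sqiM s1 s)) => w; rewrite div1r mulrA mulVf ?mul1r//.
by rewrite gt_eqF.
Qed.

(** Cauchy-Schwarz against the weight [1 + |w| ^ (2 alpha)]. *)
Let weighted_cs (m : R -> R) (C : R) phi : test_function phi -> measurable_fun setT m ->
  (forall w, m w ^+ 2 <= C) ->
  (\int[mu]_w (m w * hart phi w)) ^+ 2 <=
  \int[mu]_w (m w ^+ 2 * (1 + wt w ^+ 2)^-1) * (twopi * energy phi).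
Proof.
move=> tp mm mC; have [s <-] := sqi_sw_hart tp.
have s1 := sqi_div_sw mm mC.
have := cauchy_schwarz s1 s.
rewrite (_ : \int[mu]_x _ = \int[mu]_w (m w * hart phi w)).
  rewrite (_ : nsq (fun w => m w / sw w) = \int[mu]_w (m w ^+ 2 * (1 + wt w ^+ 2)^-1))//.
  by apply: eq_Rintegral => w _; rewrite expr_div_n swE.
apply: eq_Rintegral => w _; rewrite mulrA -(mulrA (m w)) mulVf ?mulr1//.
by rewrite gt_eqF.
Qed.

Lemma test_function_inversion phi (x : R) : test_function phi ->
  \int[mu]_w (cas (w * x) * hart phi w) = twopi * phi x.
Proof.
move=> tp; have [C pC] := contc_bounded (test_function_contc tp).
apply: (hart_inversion (test_function_intg tp) pC); last exact: intg_hart.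
exact: test_function_continuous.
Qed.

Let measurable_casr (x : R) : measurable_fun setT (fun w : R => cas (w * x)).
Proof. exact: measurable_casM. Qed.

Let intg_casr (x : R) (h : R -> R) : intg h -> intg (fun w => cas (w * x) * h w).
Proof. exact: intg_cas. Qed.

(** Inversion at [x], then [weighted_cs]. *)
Lemma energy_sup : exists2 C : R, 0 <= C &
  forall phi x, test_function phi -> phi x ^+ 2 <= C * energy phi.
Proof.
pose I := \int[mu]_w (4 * (1 + wt w ^+ 2)^-1).
have I0 : 0 <= I.
  by apply: Rintg_ge0 => w; rewrite mulr_ge0// invr_ge0 ltW// ws_gt0.
have tp0 := twopi_gt0.
exists (I / twopi); first by rewrite divr_ge0// ltW.
move=> phi x tp.
have c4 w : cas (w * x) ^+ 2 <= 4.
  rewrite -(real_normK (num_real _)); have := cas_le2 (w * x).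
  have := normr_ge0 (cas (w * x)); nra.
have := weighted_cs tp (measurable_casr x) c4.
rewrite test_function_inversion//.
have iV := intg_wsV.
have : \int[mu]_w (cas (w * x) ^+ 2 * (1 + wt w ^+ 2)^-1) <= I.
  apply: le_Rintg.
  - apply: (@le_intg _ _ (fun w => 4 * (1 + wt w ^+ 2)^-1)).
    + apply: measurable_funM; last exact: intg_meas iV.
      by apply: measurable_funX; exact: measurable_casr.
    + exact: intgZ.
    + move=> w; rewrite ger0_norm; last first.
        by apply: mulr_ge0; [exact: sqr_ge0|rewrite invr_ge0 ltW// ws_gt0].
      by rewrite ler_wpM2r ?invr_ge0 ?(ltW (ws_gt0 w)).
  - exact: intgZ.
  - by move=> w; rewrite ler_wpM2r ?invr_ge0 ?(ltW (ws_gt0 w)).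
set J := \int[mu]_w _ => JI h.
have h2 : (twopi * phi x) ^+ 2 <= I * (twopi * energy phi).
  by apply: le_trans h _; rewrite ler_wpM2r// mulr_ge0 ?energy_ge0// ltW.
rewrite mulrAC ler_pdivlMr//; rewrite -(ler_pM2l tp0).
by apply: le_trans (le_trans h2 _); apply: eq_ler; ring.
Qed.

Let cas_diff (a b' : R) : (cas a - cas b') ^+ 2 <= 4 * (1 - cos (a - b')).
Proof.
have -> : (cas a - cas b') ^+ 2 = 2 * (1 - cos (a - b')) * (1 - sin (a + b')).
  rewrite cosB sinD /cas; have := cos2Dsin2 a; have := cos2Dsin2 b'.
  set ca := cos a; set sa := sin a; set cb := cos b'; set sb := sin b' => eb ea.
  have e1 : ca ^+ 2 = 1 - sa ^+ 2 by rewrite -ea addrK.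
  have e2 : cb ^+ 2 = 1 - sb ^+ 2 by rewrite -eb addrK.
  transitivity ((ca ^+ 2 + sa ^+ 2) + (cb ^+ 2 + sb ^+ 2) + 2 * sa * ca + 2 * sb * cb
    - 2 * (ca * cb + sa * sb + sa * cb + ca * sb)); first by ring.
  rewrite ea eb.
  transitivity (2 - 2 * (ca * cb + sa * sb) - 2 * (sa * cb + ca * sb)
    + 2 * (sa * ca * (cb ^+ 2 + sb ^+ 2) + sb * cb * (ca ^+ 2 + sa ^+ 2))).
    by rewrite ea eb; ring.
  by ring.
have := cos_le1 (a - b'); have := sin_geN1 (a + b').
set c := cos _; set s := sin _ => h1 h2.
have -> : 4 * (1 - c) = 2 * (1 - c) * 2 by ring.
by rewrite ler_wpM2l ?mulr_ge0 ?subr_ge0//; lra.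
Qed.

(** The same for the difference of the inversion formulas at [x] and [y]: the
    squared weighted norm of the difference of the two kernels is bounded by a
    function of [x - y] that tends to zero by dominated convergence. *)
Lemma energy_equicontinuous (e : R) : 0 < e -> exists2 d : R, 0 < d &
  forall phi x y, test_function phi -> `|x - y| < d ->
    (phi x - phi y) ^+ 2 <= e * energy phi.
Proof.
move=> e0; have tp0 := twopi_gt0.
pose Om (z : R) := \int[mu]_w (4 * (1 - cos (w * z)) * (1 + wt w ^+ 2)^-1).
have iV := intg_wsV.
have cosm (z : R) : measurable_fun setT (fun w : R => 4 * (1 - cos (w * z)) * (1 + wt w ^+ 2)^-1).
  apply: measurable_funM; last exact: intg_meas iV.
  apply: measurable_funM => //; apply: measurable_funB => //.
  apply: (measurableT_comp (cont_meas (@continuous_cos R))).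
  by apply: measurable_funM => //; exact: measurable_id.
have cosb (z w : R) : `|4 * (1 - cos (w * z)) * (1 + wt w ^+ 2)^-1| <= 8 * (1 + wt w ^+ 2)^-1.
  have := cos_le1 (w * z); have := cos_geN1 (w * z) => h1 h2.
  rewrite ger0_norm; last first.
    by rewrite !mulr_ge0 ?subr_ge0 ?invr_ge0 ?(ltW (ws_gt0 w)).
  by rewrite ler_wpM2r ?invr_ge0 ?(ltW (ws_gt0 w))//; lra.
have Om0 : {for 0, continuous Om}.
  apply: continuous_seq => s s0.
  apply: (@Rintg_dct _ (fun n w => 4 * (1 - cos (w * s n)) * (1 + wt w ^+ 2)^-1) _
    (fun w => 8 * (1 + wt w ^+ 2)^-1) _ _ _ _ _).2 => //; last exact: intgZ.
  apply: aeW => w; apply: cvgM; last exact: cvg_cst.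
  apply: cvgM; first exact: cvg_cst.
  apply: cvgB; first exact: cvg_cst.
  apply: (@seq_continuous _ cos (w * 0) (fun n => w * s n)); first exact: continuous_cos.
  by apply: cvgM => //; exact: cvg_cst.
have Om00 : Om 0 = 0.
  rewrite /Om; under eq_Rintegral do rewrite mulr0 cos0 subrr mulr0 mul0r.
  by rewrite Rintegral_cst// mul0r.
have et : 0 < e * twopi by rewrite mulr_gt0.
move/cvgrPdist_lt : Om0 => /(_ _ et) [d /= d0 hd].
exists d => // phi x y tp xy.
have := hd (x - y); rewrite /ball_/= sub0r normrN Om00 sub0r normrN => /(_ xy) h.
have {}h : Om (x - y) <= e * twopi by apply: le_trans (ltW h); exact: ler_norm.
pose m w := cas (w * x) - cas (w * y).
have m8 w : m w ^+ 2 <= 8.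
  apply: le_trans (cas_diff _ _) _.
  by have := cos_geN1 (w * x - w * y); lra.
have mm : measurable_fun setT m by apply: measurable_funB; exact: measurable_casr.
have := weighted_cs tp mm m8.
have -> : \int[mu]_w (m w * hart phi w) = twopi * (phi x - phi y).
  rewrite mulrBr -!test_function_inversion// -RintgB; [|exact/intg_casr/intg_hart..].
  by apply: eq_Rintegral => w _; rewrite mulrBl.
have : \int[mu]_w (m w ^+ 2 * (1 + wt w ^+ 2)^-1) <= Om (x - y).
  apply: le_Rintg.
  - apply: (@le_intg _ _ (fun w => 8 * (1 + wt w ^+ 2)^-1)).
    + by apply: measurable_funM; [exact: measurable_funX|exact: intg_meas iV].
    + exact: intgZ.
    + move=> w; rewrite ger0_norm; last first.
        by apply: mulr_ge0; [exact: sqr_ge0|rewrite invr_ge0 ltW// ws_gt0].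
      by rewrite ler_wpM2r ?invr_ge0 ?(ltW (ws_gt0 w)).
  - by apply: (@le_intg _ _ (fun w => 8 * (1 + wt w ^+ 2)^-1)) => //; exact: intgZ.
  - move=> w; rewrite ler_wpM2r ?invr_ge0 ?(ltW (ws_gt0 w))//.
    by rewrite [w * (x - y)]mulrBr; exact: cas_diff.
set J := \int[mu]_w _ => JI h1.
have h2 : (twopi * (phi x - phi y)) ^+ 2 <= e * twopi * (twopi * energy phi).
  apply: le_trans h1 _; apply: ler_wpM2r; last exact: le_trans JI h.
  by apply: mulr_ge0; [exact: ltW|exact: energy_ge0].
have tp2 : 0 < twopi ^+ 2 :> R by rewrite exprn_gt0.
rewrite -(ler_pM2l tp2) -exprMn.
by apply: le_trans h2 _; apply: eq_ler; ring.
Qed.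

End Energy.

(** * The nonlinearity *)

Section RealFunctions.
Context {R : realType}.
Implicit Types j : R -> R.

Lemma heine j (K e : R) : continuous j -> 0 < e ->
  exists2 d : R, 0 < d & forall x y, `|x| <= K -> `|y - x| < d -> `|j y - j x| <= e.
Proof.
move=> cj e0.
have /compact_near_coveringP nc := @segment_compact R (- K) K.
have := nc R (nbhs 0^'+) (fun d x => forall y, `|y - x| < d -> `|j y - j x| <= e) _.
have e20 : 0 < e / 2 by rewrite divr_gt0.
case=> [x _|d /= d0 hd].
  have /cvgrPdist_lt /(_ _ e20) [r /= r0 hr] := cj x.
  have r20 : 0 < r / 2 by rewrite divr_gt0.
  exists (ball x (r / 2), [set d : R | d < r / 2]) => /=.
    split; first exact: nbhsx_ballx.
    exact: nbhs_right_lt.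
  move=> [z d] /= [xz dr] y yz.
  have h1 := hr z; have h2 := hr y.
  have xz' : `|x - z| < r / 2 by exact: xz.
  have {}h1 : `|j x - j z| < e / 2 by apply: h1; rewrite /ball_/=; lra.
  have {}h2 : `|j x - j y| < e / 2.
    apply: h2; rewrite /ball_/=.
    have := ler_distD z x y; rewrite (distrC z y); lra.
  have := ler_distD (j x) (j y) (j z); rewrite (distrC (j y) (j x)); lra.
have d2 : 0 < d / 2 by rewrite divr_gt0.
exists (d / 2) => // x y xK yx.
apply: (hd (d / 2)) => //=.
- by rewrite sub0r normrN ger0_norm ?ltW// ltr_pdivrMr// ltr_pMr// ltrDl.
- by rewrite in_itv/= -ler_norml.
Qed.

Lemma pos_min j (a b : R) : a <= b -> continuous j ->
  (forall x, a <= x <= b -> 0 < j x) ->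
  exists2 k, 0 < k & forall x, a <= x <= b -> k <= j x.
Proof.
move=> ab cj jp.
have [c cab hc] := @EVT_min R j a b ab (continuous_subspaceT cj).
by exists (j c) => [|x xab]; [apply: jp; move: cab; rewrite in_itv|apply: hc; rewrite in_itv].
Qed.

End RealFunctions.

Section Nonlinearity.
Context {R : realType}.
Local Notation mu := (@lebesgue_measure R).
Variables (f : R -> R) (theta : R).
Hypothesis hcont : continuous f.
Hypothesis hf0 : forall xi : R, xi <= 0 -> f xi = 0.
Hypothesis htheta : 2 < theta.
Hypothesis hf1 : forall xi : R, 0 < xi -> 0 < theta * primitive0 f xi <= xi * f xi.
Hypothesis hf2 : f =o_ (0 : R) (fun xi : R => `|xi|).
Hypothesis hf4 : forall xi : R, 0 < xi -> forall s t : R, 0 < s -> s < t ->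
  f (s * xi) * xi / s < f (t * xi) * xi / t.

Let F := primitive0 f.

Let theta0 : 0 < theta.
Proof. by apply: lt_trans htheta. Qed.

Lemma prim_le0 x : x <= 0 -> F x = 0.
Proof.
have z y : y <= 0 -> \int[mu]_(s in `[y, 0]) f s = 0.
  move=> y0; rewrite (@eq_Rintegral _ _ _ mu _ (fun=> 0)).
    by rewrite Rintegral_cst// mul0r.
  by move=> s; rewrite inE/= in_itv/= => /andP[_ s0]; rewrite hf0.
rewrite le_eqVlt => /predU1P[->|x0]; rewrite /F /primitive0.
  by rewrite lexx z.
by rewrite leNgt x0/= z ?oppr0// ltW.
Qed.

Let primE (a x : R) : a < 0 -> a < x -> F x = \int[mu]_(s in `[a, x]) f s.
Proof.
move=> a0 ax.
have i : mu.-integrable `[a, x] (EFin \o f).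
  apply: continuous_compact_integrable; first exact: segment_compact.
  exact: continuous_subspaceT.
have z y : y <= 0 -> \int[mu]_(s in `[a, y]) f s = 0.
  move=> y0; rewrite (@eq_Rintegral _ _ _ mu _ (fun=> 0)).
    by rewrite Rintegral_cst// mul0r.
  by move=> s; rewrite inE/= in_itv/= => /andP[_ s0]; rewrite hf0// (le_trans s0).
have [x0|x0] := lerP x 0; first by rewrite prim_le0// z.
have := @Rintegral_itvB R f (BLeft a) (BRight x) 0 i.
rewrite !bnd_simp (ltW a0) (ltW x0) => /(_ isT isT).
rewrite (z 0)// subr0 => ->.
rewrite /F /primitive0 (ltW x0) Rintegral_itv_obnd_cbnd//.
by apply: integrableS i => //; apply: subset_itvr; rewrite bnd_simp ltW.
Qed.

Lemma prim_derive (x : R) : is_derive x 1 F (f x).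
Proof.
pose a := - `|x| - 1.
have a0 : a < 0 by rewrite /a subr_lt0; apply: le_lt_trans ltr01; rewrite oppr_le0.
have ax : a < x.
  rewrite /a ltrBlDr; apply: (@le_lt_trans _ _ x); last by rewrite ltrDl.
  by rewrite lerNl -normrN ler_norm.
have xx : x < x + 1 by rewrite ltrDl.
have i : mu.-integrable `[a, x + 1] (EFin \o f).
  apply: continuous_compact_integrable; first exact: segment_compact.
  exact: continuous_subspaceT.
have [d1 d2] := continuous_FTC1_closed xx i ax (@hcont x).
apply: (near_eq_is_derive (f := fun y => \int[mu]_(s in `[a, y]) f s)).
  have : \forall y \near x, a < y by exact: lt_nbhsr.
  by apply: filterS => y ay; rewrite (primE a0 ay).
by rewrite -d2 derive1E; exact: derivableP.
Qed.

Lemma prim_cont : continuous F.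
Proof.
move=> x; apply: differentiable_continuous; apply/derivable1_diffP.
by have [] := prim_derive x.
Qed.

Lemma prim_pos s : 0 < s -> 0 < F s.
Proof. by move=> s0; have /andP[h1 _] := hf1 s0; move: h1; rewrite pmulr_rgt0. Qed.

Lemma prim_ge0 s : 0 <= F s.
Proof. by have [/prim_le0->|/prim_pos/ltW] := lerP s 0. Qed.

Lemma ambrosetti_rabinowitz s : theta * F s <= s * f s.
Proof.
have [s0|s0] := lerP s 0; first by rewrite prim_le0// hf0// !mulr0.
by have /andP[] := hf1 s0.
Qed.

Lemma f_quot_lt s t : 0 < s -> s < t -> f s / s < f t / t.
Proof. by move=> s0 st; have := hf4 ltr01 s0 st; rewrite !mulr1. Qed.

Lemma f_small (e : R) : 0 < e -> exists2 d : R, 0 < d & forall s, `|s| <= d -> `|f s| <= e * `|s|.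
Proof.
move=> e0; have /eqoP h := hf2.
have [d /= d0 hd] := h e e0.
exists (d / 2); first by rewrite divr_gt0.
move=> s sd; have := hd s; rewrite /ball_/= sub0r normrN normr_id; apply.
by apply: le_lt_trans sd _; rewrite ltr_pdivrMr// ltr_pMr// ltrDl.
Qed.

(** This and [f_ray_gt] express the monotonicity of [f s / s] as a sign of the
    radial derivative of the action, on either side of [t = 1]. *)
Lemma f_ray_lt (s t : R) : 0 < s -> 0 < t -> t < 1 -> 0 < s * (f s - f (t * s) / t).
Proof.
move=> s0 t0 t1; rewrite pmulr_rgt0// subr_gt0.
have ts : t * s < s by rewrite gtr_pMl.
have := f_quot_lt (mulr_gt0 t0 s0) ts.
rewrite ltr_pdivlMr//; apply: le_lt_trans.
by apply: eq_ler; field; rewrite !gt_eqF.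
Qed.

Lemma f_ray_gt (s t : R) : 0 < s -> 1 < t -> 0 < s * (f (t * s) / t - f s).
Proof.
move=> s0 t1; have t0 : 0 < t by apply: lt_trans t1.
rewrite pmulr_rgt0// subr_gt0.
have ts : s < t * s by rewrite ltr_pMl.
have := f_quot_lt s0 ts; rewrite ltr_pdivrMr//; move/lt_le_trans; apply.
by apply: eq_ler; field; rewrite !gt_eqF.
Qed.

(** The difference of the two sides vanishes at [t = 1], and by the monotonicity
    of [f s / s] its derivative in [t] has the sign of [t - 1]. *)
Lemma fibre_ge0 (s t : R) : 0 < t -> F s - F (t * s) <= (1 - t ^+ 2) / 2 * (s * f s).
Proof.
move=> t0; have [s0|s0] := lerP s 0.
  by rewrite !prim_le0 ?hf0 ?mulr0 ?subr0// pmulr_rle0.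
pose H (r : R) := F (r * s) + (1 - r ^+ 2) / 2 * (s * f s).
pose dH (r : R) := s * f (r * s) - r * (s * f s).
have dHE (r : R) : is_derive r 1 H (dH r).
  have d1 : is_derive r 1 (fun r : R => r * s) s.
    by apply: is_derive_eq; rewrite /GRing.scale/= ?mulr0 ?mulr1 ?add0r ?addr0.
  have d2 := prim_derive (r * s).
  have d3 := @is_derive1_comp _ F (fun r : R => r * s) r _ _ d2 d1.
  by apply: is_derive_eq; rewrite /GRing.scale/= /dH; field.
have cH a b : {within `[a, b], continuous H}.
  apply: continuous_subspaceT => r; apply: differentiable_continuous.
  by apply/derivable1_diffP; have [] := dHE r.
have H1 : H 1 = F s by rewrite /H expr1n subrr mul1r !mul0r addr0.
suff : H 1 <= H t by rewrite H1 /H lerBlDr addrC.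
have dHf r : 0 < r -> dH r = r * (s * (f (r * s) / r - f s)).
  by move=> r0; rewrite /dH; field; rewrite gt_eqF.
have [t1|t1|->] := ltrgtP t 1; last by [].
- have [c] := MVT t1 (fun r _ => dHE r) (cH _ _).
  rewrite in_itv/= => /andP[tc c1] e.
  have c0 : 0 < c by apply: lt_trans tc.
  rewrite -subr_le0 e; apply: mulr_le0_ge0; last by rewrite subr_ge0 ltW.
  rewrite dHf// pmulr_rle0// -oppr_ge0 -mulrN opprB.
  exact/ltW/f_ray_lt.
- have [c] := MVT t1 (fun r _ => dHE r) (cH _ _).
  rewrite in_itv/= => /andP[c1 ct] e.
  have c0 : 0 < c by apply: lt_trans c1.
  rewrite -subr_ge0 e; apply: mulr_ge0; last by rewrite subr_ge0 ltW.
  by rewrite dHf// pmulr_rge0//; exact/ltW/f_ray_gt.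
Qed.

(** [G r = F r / r ^+ 2] satisfies [G' >= (theta - 2) / r * G]; bounding its
    increase over one doubling to first order gives a growth faster than quadratic
    while avoiding powers with a real exponent. *)
Lemma prim_double (s : R) : 2 * theta * F s <= F (2 * s).
Proof.
have [s0|s0] := lerP s 0.
  by rewrite !prim_le0 ?mulr0// pmulr_rle0.
pose G (r : R) := F r / r ^+ 2.
pose dG (r : R) := (r * f r - 2 * F r) / r ^+ 3.
have dGE (r : R) : 0 < r -> is_derive r 1 G (dG r).
  move=> r0; have d2 := prim_derive r; have rn : r != 0 by rewrite gt_eqF.
  have d3 : is_derive r 1 (fun r : R => (r ^+ 2)^-1) (- 2 / r ^+ 3).
    have r2 : r ^+ 2 != 0 by rewrite expf_neq0.
    apply: is_derive_eq; rewrite /GRing.scale/=.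
    by field.
  by apply: is_derive_eq; rewrite /GRing.scale/= /dG; field.
have dG_ge r : 0 < r -> (theta - 2) * (G r / r) <= dG r.
  move=> r0; rewrite /G /dG.
  have -> : (theta - 2) * (F r / r ^+ 2 / r) = (theta * F r - 2 * F r) / r ^+ 3.
    by field; rewrite gt_eqF.
  by rewrite ler_wpM2r ?invr_ge0 ?exprn_ge0 ?(ltW r0)// lerD2r ambrosetti_rabinowitz.
have cG a b : 0 < a -> {within `[a, b], continuous G}.
  move=> a0; apply: derivable_within_continuous => r; rewrite in_itv/= => /andP[ar _].
  by have [] := dGE r (lt_le_trans a0 ar).
have dGs r x : x \in `]s, r[ -> is_derive x 1 G (dG x).
  by rewrite in_itv/= => /andP[sx _]; apply: dGE; exact: lt_trans sx.
have mono r : s < r -> G s <= G r.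
  move=> sr; have [c] := MVT sr (dGs r) (cG _ _ s0).
  rewrite in_itv/= => /andP[sc cr] e.
  have c0 : 0 < c by exact: lt_trans sc.
  rewrite -subr_ge0 e mulr_ge0 ?subr_ge0 ?(ltW sr)//.
  apply: le_trans (dG_ge _ c0); rewrite mulr_ge0 ?subr_ge0 ?(ltW htheta)//.
  by rewrite /G !divr_ge0 ?prim_ge0 ?exprn_ge0 ?(ltW c0).
have s2 : s < 2 * s by rewrite ltr_pMl// ltrDl.
have [c] := MVT s2 (dGs _) (cG _ _ s0).
rewrite in_itv/= => /andP[sc cr] e.
have c0 : 0 < c by exact: lt_trans sc.
have Gs0 : 0 <= G s by rewrite divr_ge0 ?prim_ge0 ?exprn_ge0 ?(ltW s0).
have h1 : (theta - 2) * (G s / (2 * s)) <= dG c.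
  apply: le_trans (dG_ge _ c0); rewrite ler_wpM2l ?subr_ge0 ?(ltW htheta)//.
  have s20 : 0 < 2 * s by rewrite mulr_gt0.
  apply: ler_pM => //; [by rewrite invr_ge0 ltW|exact: mono|].
  by rewrite lef_pV2 ?posrE// ltW.
have h2 : G s + (theta - 2) * (G s / (2 * s)) * (2 * s - s) <= G (2 * s).
  by rewrite -lerBrDl e ler_wpM2r// subr_ge0 ltW.
have e2 : G s + (theta - 2) * (G s / (2 * s)) * (2 * s - s) = theta / 2 * G s.
  by field; rewrite gt_eqF.
move: h2; rewrite e2 {2}/G ler_pdivlMr ?exprn_gt0 ?mulr_gt0//.
apply: le_trans; apply: eq_ler.
by rewrite /G; field; rewrite gt_eqF.
Qed.

Lemma prim_growth (s : R) n : (2 * theta) ^+ n * F s <= F (2 ^+ n * s).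
Proof.
elim: n => [|n IH]; first by rewrite !expr0 !mul1r.
rewrite !exprS -!mulrA; apply: le_trans (prim_double _); rewrite mulrA.
by rewrite ler_wpM2l// mulr_ge0// ltW.
Qed.

End Nonlinearity.

(** * Almost critical points on the Nehari manifold *)

Section CompactSupport.
Context {R : realType}.
Local Notation mu := (@lebesgue_measure R).
Implicit Types u v phi : R -> R.

Lemma contc_comp (j : R -> R) u : continuous j -> j 0 = 0 -> contc u ->
  contc (fun x => j (u x)).
Proof.
move=> cj j0 [cu [M uM]]; split.
  by move=> x; apply: (@continuous_comp _ _ _ u j); [exact: cu|exact: cj].
by exists M => x xM; rewrite uM.
Qed.

Lemma contcD u v : contc u -> contc v -> contc (fun x => u x + v x).
Proof.
move=> [cu [M uM]] [cv [N vN]]; split.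
  by move=> x; apply: cvgD; [exact: cu|exact: cv].
by exists (Num.max M N) => x; rewrite gt_max => /andP[h1 h2]; rewrite uM// vN// addr0.
Qed.

Lemma contcZ c u : contc u -> contc (fun x => c * u x).
Proof.
move=> [cu [M uM]]; split; last by exists M => x /uM ->; rewrite mulr0.
by move=> x; apply: cvgM; [exact: cvg_cst|exact: cu].
Qed.

Lemma Rintg_indic_itv (L : R) : 0 <= L -> \int[mu]_x (\1_`[- L, L] x : R) = 2 * L.
Proof.
move=> L0; have m : mu `[- L, L]%classic = if - L < L then (L - - L)%R%:E else 0%E.
  by rewrite lebesgue_measure_itv/= lte_fin EFinD.
rewrite /Rintegral integral_indic// setIT; move: m => /= ->.
case: ifPn => [_ /=|]; first by ring.
rewrite -leNgt => LL; have -> : L = 0 by lra.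
by rewrite mulr0.
Qed.

Lemma int_close (j : R -> R) (L K e : R) : continuous j -> j 0 = 0 -> 0 < e ->
  exists2 d : R, 0 < d & forall u v, contc u -> contc v ->
    (forall x, L < `|x| -> u x = v x) -> (forall x, `|u x| <= K) ->
    (forall x, `|v x - u x| < d) ->
    `|\int[mu]_x j (v x) - \int[mu]_x j (u x)| <= e.
Proof.
move=> cj j0 e0; pose N := `|L|.
have N0 : 0 <= N by exact: normr_ge0.
have N1 : 0 < 2 * N + 1 by rewrite ltr_wpDl// mulr_ge0.
have e1 : 0 < e / (2 * N + 1) by rewrite divr_gt0.
have [d d0 hd] := heine K cj e1; exists d => // u v cu cv uv uK uvd.
have iu := contc_intg (contc_comp cj j0 cu).
have iv := contc_intg (contc_comp cj j0 cv).
rewrite -RintgB//; apply: le_trans (le_norm_Rintg (intgB iv iu)) _.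
apply: (@le_trans _ _ (\int[mu]_x (e / (2 * N + 1) * \1_`[- N, N] x))).
  apply: le_Rintg; [exact/intg_norm/intgB|exact/intgZ/intg_indic_itv|].
  move=> x; rewrite indicE; case: (boolP (x \in _)) => h.
    by rewrite mulr1; exact: hd.
  rewrite mulr0 uv ?subrr ?normr0//.
  apply: le_lt_trans (ler_norm L) _; rewrite -/N ltNge; apply/negP.
  by rewrite ler_norml => h'; move/negP : h; apply; rewrite inE/= in_itv.
rewrite RintgZ; last exact: intg_indic_itv.
rewrite Rintg_indic_itv// mulrAC ler_pdivrMr// ler_wpM2l ?(ltW e0)//.
by rewrite lerDl.
Qed.

Lemma int_ge_bump u (r k : R) : contc u -> 0 <= r -> (forall x, 0 <= u x) ->
  (forall x, `|x| <= r -> k <= u x) -> 2 * r * k <= \int[mu]_x u x.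
Proof.
move=> cu r0 u0 uk; rewrite mulrC -Rintg_indic_itv// -RintgZ; last exact: intg_indic_itv.
apply: le_Rintg; [exact/intgZ/intg_indic_itv|exact: contc_intg|].
move=> x; rewrite indicE; case: (boolP (x \in _)) => [|_]; last by rewrite mulr0.
by rewrite inE/= in_itv/= -ler_norml mulr1; exact: uk.
Qed.

End CompactSupport.

Section EnergyBounds.
Context {R : realType}.
Variable alpha : R.
Hypothesis halpha : 2^-1 < alpha < 1.
Implicit Types u phi : R -> R.

Let quad_bound (a b p : R) : 0 <= a + 2 * 1 * b + 1 ^+ 2 * p ->
  0 <= a + 2 * -1 * b + (-1) ^+ 2 * p -> `|2 * b| <= a + p.
Proof. by move=> h1 h2; rewrite ler_norml; apply/andP; split; lra. Qed.

Lemma energyB_le u phi : test_function u -> test_function phi ->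
  `|2 * energyB alpha u phi| <= energy alpha u + energy alpha phi.
Proof.
move=> tu tp; apply: quad_bound.
  by rewrite -(energyD halpha 1 tu tp) energy_ge0.
by rewrite -(energyD halpha (-1) tu tp) energy_ge0.
Qed.

Let perturb_bound (a b p s : R) : 0 < s -> s <= 1 -> 0 <= p -> `|2 * b| <= a + p ->
  `|a + 2 * s * b + s ^+ 2 * p - a| <= s * (a + 2 * p).
Proof.
move=> s0 s1 p0 /ler_normlP[h1 h2].
have h3 : s ^+ 2 * p <= s * p by rewrite ler_wpM2r// expr2 ger_pMl.
have h4 : 0 <= s ^+ 2 * p by rewrite mulr_ge0// sqr_ge0.
have h5 : s * (2 * b) <= s * (a + p) by rewrite ler_pM2l.
have h6 : s * - (2 * b) <= s * (a + p) by rewrite ler_pM2l.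
by rewrite ler_norml; apply/andP; split; lra.
Qed.

Lemma energy_perturb u phi (s : R) : test_function u -> test_function phi ->
  0 < s -> s <= 1 ->
  `|energy alpha (fun x => u x + s * phi x) - energy alpha u| <=
    s * (energy alpha u + 2 * energy alpha phi).
Proof.
move=> tu tp s0 s1; rewrite (energyD halpha s tu tp).
by apply: perturb_bound => //; [exact: energy_ge0|exact: energyB_le].
Qed.

End EnergyBounds.

(* Kept folded so that conversion never unfolds an integral. *)
#[local] Opaque Rintegral primitive0 energy energyB.

(** Estimates on real numbers, kept apart from the integrals and energies to which
    they are applied. *)
Section NehariArithmetic.
Context {R : realType}.

Lemma sq_le_bound (C Q x y : R) : 0 <= C -> 0 <= Q -> x ^+ 2 <= C * y -> y <= Q ->
  `|x| <= C * Q + 1.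
Proof.
move=> C0 Q0 h yQ; have CQ := mulr_ge0 C0 Q0.
have h' : x ^+ 2 <= C * Q by apply: le_trans h _; rewrite ler_wpM2l.
rewrite -(ler_pXn2r (n := 2)) ?nnegrE// ?addr_ge0//.
by rewrite real_normK ?num_real//; nra.
Qed.

Lemma ray_sign (k i j a b y : R) : `|b - a| <= y -> y * 2 < k -> `|j - i| <= k / 2 ->
  (k <= a - i -> 0 <= b - j) /\ (k <= i - a -> b - j <= 0).
Proof.
rewrite !ler_norml => /andP[h1 h2] h3 /andP[h4 h5]; split=> h; lra.
Qed.

Lemma descent_slope (t s e c B p G r eta : R) : 0 < t -> t <= 2 -> 0 < s ->
  `|t - 1| <= e -> `|B| <= c -> 0 <= p -> p <= c -> e * c <= eta / 8 ->
  s * c <= eta / 8 -> r <= eta / 8 -> B - G <= - eta -> 0 < eta ->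
  t * B + t * s / 2 * p - G + r <= - (eta / 2).
Proof.
move=> t0 t2 s0 te Bc p0 pc ec sc r8 h eta0.
have b1 : t * B <= B + e * c.
  have -> : t * B = B + (t - 1) * B by ring.
  by rewrite lerD2l; apply: le_trans (ler_norm _) _; rewrite normrM; exact: ler_pM.
have b2 : t * s / 2 * p <= s * c.
  have -> : t * s / 2 * p = s * (t / 2 * p) by ring.
  rewrite ler_pM2l//; apply: (@le_trans _ _ (1 * p)); last by rewrite mul1r.
  by rewrite ler_wpM2r//; lra.
lra.
Qed.

Lemma descent_sum (t s B p G r I1 I2 qu eta : R) : 0 < t * s ->
  t * s * (G - r) <= I1 - I2 -> t * B + t * s / 2 * p - G + r <= - (eta / 2) ->
  2^-1 * (t ^+ 2 * (qu + 2 * s * B + s ^+ 2 * p)) - I1 <=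
  2^-1 * (t ^+ 2 * qu) - I2 - t * s * (eta / 2).
Proof.
move=> ts0 h1 h2.
have : t * s * (t * B + t * s / 2 * p - G + r) <= t * s * - (eta / 2) by rewrite ler_pM2l.
have -> : 2^-1 * (t ^+ 2 * (qu + 2 * s * B + s ^+ 2 * p)) =
  2^-1 * (t ^+ 2 * qu) + t * s * (t * B + t * s / 2 * p) by field.
lra.
Qed.

Lemma descent_contradiction (t s eta I0 I1 I2 c : R) : 0 < s -> 0 < eta -> 2^-1 <= t ->
  c <= I2 -> I2 <= I1 - t * s * (eta / 2) -> I1 <= I0 -> I0 < c + s * eta / 4 -> False.
Proof.
move=> s0 eta0 t2 h1 h2 h3 h4.
have : 2^-1 * (s * (eta / 2)) <= t * (s * (eta / 2)).
  by rewrite ler_pM2r// mulr_gt0// divr_gt0.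
lra.
Qed.

Lemma fibre_range (e t : R) : e <= 2^-1 -> 1 - e <= t -> t <= 1 + e ->
  [/\ 0 < t, t <= 2 & `|t - 1| <= e].
Proof. by move=> e2 t1 t2; split; [lra|lra|rewrite ler_norml; apply/andP; split; lra]. Qed.

Lemma fibre_half (e t : R) : e <= 2^-1 -> 1 - e <= t -> 2^-1 <= t.
Proof. by move=> e2 t1; lra. Qed.

Lemma midpoint_close (z a u b s P e M r : R) : `|z - a| <= b -> b <= 2 * (s * P) ->
  `|a - u| <= e * M -> 0 < s -> 0 < e -> s * (P + 1) * 4 < r -> e * (M + 1) <= r / 2 ->
  `|z - u| < r.
Proof.
move=> h1 h2 h3 s0 e0; rewrite !mulrDr !mulr1 => h4 h5.
have := ler_distD a z u; lra.
Qed.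

Lemma slope_close (g g' p k : R) : `|g' - g| <= k -> g * p - k * `|p| <= g' * p.
Proof.
move=> h; have : `|(g' - g) * p| <= k * `|p| by rewrite normrM ler_wpM2r.
rewrite ler_norml => /andP[h5 _]; rewrite -[g'](subrK g) mulrDl addrC; lra.
Qed.

End NehariArithmetic.

Section Nehari.
Context {R : realType}.
Local Notation mu := (@lebesgue_measure R).
Implicit Types u v w phi : R -> R.
Variable alpha : R.
Hypothesis halpha : 2^-1 < alpha < 1.
Variables (f : R -> R) (theta : R).
Hypothesis hcont : continuous f.
Hypothesis hf0 : forall xi : R, xi <= 0 -> f xi = 0.
Hypothesis htheta : 2 < theta.
Hypothesis hf1 : forall xi : R, 0 < xi -> 0 < theta * primitive0 f xi <= xi * f xi.
Hypothesis hf2 : f =o_ (0 : R) (fun xi : R => `|xi|).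
Hypothesis hf4 : forall xi : R, 0 < xi -> forall s t : R, 0 < s -> s < t ->
  f (s * xi) * xi / s < f (t * xi) * xi / t.

Let F := primitive0 f.
Let q := energy alpha.
Let B := energyB alpha.

Definition action u : R := 2^-1 * energy alpha u - \int[mu]_x F (u x).

Definition nehari u : Prop :=
  [/\ test_function u, exists x, 0 < u x &
      energy alpha u = \int[mu]_x (u x * f (u x))].

Let theta0 : 0 < theta. Proof. by apply: lt_trans htheta. Qed.
Let f0 : f 0 = 0. Proof. exact: hf0. Qed.
Let F0 : F 0 = 0. Proof. exact: prim_le0. Qed.
Let cF : continuous F. Proof. exact: prim_cont. Qed.

Let cff : continuous (fun s : R => s * f s).
Proof. by move=> s; apply: cvgM => //; exact: hcont. Qed.

Let ff0 : 0 * f 0 = 0. Proof. by rewrite mul0r. Qed.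

Let iF u : contc u -> intg (fun x => F (u x)).
Proof. by move=> cu; exact/contc_intg/contc_comp. Qed.

Let iff u : contc u -> intg (fun x => u x * f (u x)).
Proof. by move=> cu; apply/contc_intg/(contc_comp (j := fun s => s * f s)). Qed.

Let tc u : test_function u -> contc u := @test_function_contc R u.

Let coef : R := 2^-1 - theta^-1.

Let coef_gt0 : 0 < coef.
Proof. by rewrite subr_gt0 ltf_pV2 ?posrE. Qed.

(** On the manifold the energy is the integral of [u f(u)], which dominates [theta]
    times that of [F(u)] by the Ambrosetti-Rabinowitz condition. *)
Lemma nehari_coercive u : nehari u -> coef * q u <= action u.
Proof.
move=> [tu _ e]; rewrite /action mulrBl lerD2l lerN2.
rewrite [in X in _ <= X]/q e -RintgZ; last exact/iff/tc.
apply: le_Rintg; [exact/iF/tc|exact/intgZ/iff/tc|] => x.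
by rewrite mulrC ler_pdivlMr// mulrC; exact: ambrosetti_rabinowitz.
Qed.

(** If [u < d] everywhere, then [u f(u) <= u^2 / 2] because [f] is superlinear at
    the origin, so the energy would be at most half of itself. *)
Lemma nehari_peak : exists2 d : R, 0 < d & forall u, nehari u -> exists x, d <= u x.
Proof.
have h2 : 0 < (2^-1 : R) by rewrite invr_gt0.
have [d d0 hd] := f_small hf2 h2; exists d => // u [tu [x0 ux0] e].
apply: contrapT => /forallNP h.
have ud x : u x < d by rewrite ltNge; apply/negP; exact: h.
have : q u <= 2^-1 * nsq u.
  rewrite [q u]e -RintgZ; last by case: (test_function_sqi tu).
  apply: le_Rintg; [exact/iff/tc|by apply: intgZ; case: (test_function_sqi tu)|] => x.
  have [ux|ux] := lerP (u x) 0.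
    by rewrite (hf0 ux) mulr0 mulr_ge0 ?sqr_ge0// ltW.
  have := hd (u x); rewrite (gtr0_norm ux) => /(_ (ltW (ud x))) hx.
  rewrite expr2 mulrCA ler_wpM2l ?(ltW ux)//.
  exact: le_trans (ler_norm _) hx.
have := energy_nsq alpha u; rewrite -/q => qu.
have q0 : 0 <= q u := energy_ge0 alpha u.
move=> qle; have {}q0 : q u = 0 by lra.
have [C C0 hC] := energy_sup halpha.
have := hC u x0 tu; rewrite -/q q0 mulr0 => ux.
by have := exprn_gt0 2 ux0; rewrite ltNge ux.
Qed.

(** Integration of [fibre_ge0]. *)
Lemma nehari_fibre_max u t : nehari u -> 0 < t -> action (fun x => t * u x) <= action u.
Proof.
move=> [tu _ e] t0.
have i1 := iF (tc tu); have i2 := iF (contcZ t (tc tu)).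
rewrite /action (energyZ halpha t tu) -subr_ge0.
have id (a b c : R) : 2^-1 * a - b - (2^-1 * (t ^+ 2 * a) - c) =
    (1 - t ^+ 2) / 2 * a - (b - c) by field.
rewrite id -(RintgB i1 i2).
rewrite e subr_ge0 -RintgZ; last exact/iff/tc.
apply: le_Rintg; [exact: intgB|exact/intgZ/iff/tc|] => x.
exact: (fibre_ge0 hcont hf0 hf4).
Qed.

Let prim_mvt (a b : R) : exists2 z, `|z - a| <= `|b| & F (a + b) - F a = f z * b.
Proof.
have dF (x : R) : is_derive x 1 F (f x) by exact: prim_derive.
have cFi (x y : R) : {within `[x, y], continuous F} by exact: continuous_subspaceT.
have [b0|b0|<-] := ltgtP 0 b.
- have [|z] := @MVT _ F f a (a + b) _ (fun x _ => dF x) (cFi _ _).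
    by rewrite ltrDl.
  rewrite in_itv/= => /andP[z1 z2] e; exists z; last by rewrite e addrC addKr.
  by rewrite !ger0_norm ?subr_ge0 ?(ltW b0) ?(ltW z1)// lerBlDl ltW.
- have [|z] := @MVT _ F f (a + b) a _ (fun x _ => dF x) (cFi _ _).
    by rewrite gtrDl.
  rewrite in_itv/= => /andP[z1 z2] e; exists z.
    by rewrite !ler0_norm ?subr_le0 ?(ltW b0) ?(ltW z2)// opprB lerBlDl -lerBlDr opprK ltW.
  by rewrite -opprB e; ring.
- by exists a; rewrite ?subrr ?addr0 ?normr0// mulr0 subrr.
Qed.

(** The radial derivative of the action at [t w], multiplied by [t]. *)
Let ray w t := t ^+ 2 * q w - \int[mu]_x ((t * w x) * f (t * w x)).

Let ray_cont w : test_function w -> continuous (ray w).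
Proof.
move=> tw; have cw := tc tw; have [P wP] := contc_bounded cw; have [_ [L wL]] := cw.
have P0 : 0 <= P by exact: le_trans (normr_ge0 _) (wP 0).
move=> t; apply: cvgB.
  by apply: cvgM; [exact: exprn_continuous|exact: cvg_cst].
apply/cvgrPdist_le => e e0.
have [d d0 hd] := @int_close R (fun s : R => s * f s) L (`|t| * P) e cff ff0 e0.
have P1 : 0 < P + 1 by rewrite ltr_wpDl.
have dP : 0 < d / (P + 1) by rewrite divr_gt0.
near=> r; rewrite distrC; apply: (hd (fun x => t * w x) (fun x => r * w x)).
- exact: contcZ.
- exact: contcZ.
- by move=> x xL; rewrite wL// !mulr0.
- by move=> x; rewrite normrM ler_wpM2l.
- move=> x; rewrite -mulrBl normrM.
  apply: (@le_lt_trans _ _ (`|r - t| * P)); first by rewrite ler_wpM2l.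
  apply: (@le_lt_trans _ _ (`|r - t| * (P + 1))); first by rewrite ler_wpM2l// lerDl.
  rewrite -ltr_pdivlMr// distrC; near: r.
Unshelve. all: by end_near. Qed.

Let nehari_of_sign w (t1 t2 : R) : test_function w -> (exists x, 0 < w x) ->
  0 < t1 -> t1 <= t2 -> 0 <= ray w t1 -> ray w t2 <= 0 ->
  exists2 t, t1 <= t <= t2 & nehari (fun x => t * w x).
Proof.
move=> tw [x wx] t10 t12 r1 r2.
have cw : {within `[t1, t2], continuous (ray w)}.
  by apply: continuous_subspaceT; exact: ray_cont.
have [|t] := @IVT _ (ray w) t1 t2 0 t12 cw.
  by rewrite ge_min r2 orbT/= le_max r1.
rewrite in_itv/= => tt rt; exists t => //.
have t0 : 0 < t by case/andP: tt => h _; exact: lt_le_trans h.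
split; first exact: test_functionZ.
  by exists x; rewrite mulr_gt0.
by rewrite (energyZ halpha t tw); apply/eqP; rewrite -subr_eq0; apply/eqP.
Qed.

(** On the ray of a bump function the quadratic part of the action prevails near
    zero, and the nonlinear part far away. *)
Lemma nehari_nonempty : exists u, nehari u.
Proof.
have [w tw [x0 wx]] := @exists_test_function R.
have cw := tc tw; have [P wP] := contc_bounded cw.
have P0 : 0 < P by apply: lt_le_trans (wP x0); rewrite normr_gt0 gt_eqF.
have h2 : 0 < (1 : R) by [].
have [d d0 hd] := f_small hf2 h2.
pose t1 := Num.min (d / P) 1.
have t10 : 0 < t1 by rewrite lt_min divr_gt0//=.
have r1 : 0 <= ray w t1.
  rewrite subr_ge0; apply: (@le_trans _ _ (t1 ^+ 2 * nsq w)); last first.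
    by rewrite ler_wpM2l ?sqr_ge0// energy_nsq.
  rewrite -RintgZ; last by case: (test_function_sqi tw).
  apply: le_Rintg; [exact/iff/contcZ|by apply: intgZ; case: (test_function_sqi tw)|] => x.
  rewrite -exprMn; set s := t1 * w x.
  have sd : `|s| <= d.
    rewrite normrM (gtr0_norm t10); apply: (@le_trans _ _ (d / P * P)).
      by apply: ler_pM => //; [exact: ltW|rewrite ge_min lexx].
    by rewrite divfK// gt_eqF.
  apply: le_trans (ler_norm _) _; rewrite normrM -(real_normK (num_real s)) expr2.
  by rewrite ler_wpM2l//; have := hd s sd; rewrite mul1r.
pose A := \int[mu]_x F (w x).
have A0 : 0 < A.
  have Fw : 0 < F (w x0) by exact: prim_pos hf1 _ _.
  have cFw := contc_comp cF F0 cw.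
  have [|r /= r0 hr] := (@cvgrPdist_lt _ _ _ _ _ _ _).1 (cFw.1 x0) (F (w x0) / 2).
    by rewrite divr_gt0.
  pose v x := F (w (x + x0)).
  have cv : contc v.
    apply: (@contc_comp _ F (fun x => w (x + x0)) cF F0); exact/tc/test_function_shift.
  have := @int_ge_bump _ v (r / 2) (F (w x0) / 2) cv.
  have -> : \int[mu]_x v x = A.
    have := @Rintg_affine R (fun x => F (w x)) 1 x0 ltr01 (iF cw).
    rewrite mul1r /A => <-; apply: eq_Rintegral => x _; by rewrite mul1r.
  move=> h; apply: lt_le_trans (h _ _ _).
  - by rewrite !mulr_gt0// invr_gt0.
  - by rewrite divr_ge0// ltW.
  - by move=> x; exact: (prim_ge0 hf0 htheta hf1).
  - move=> x xr; have := hr (x + x0).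
    rewrite /ball_/= opprD addrA addrAC subrr add0r normrN => h'.
    have {}h' : `|F (w x0) - F (w (x + x0))| < F (w x0) / 2.
      by apply: h'; apply: le_lt_trans xr _; rewrite ltr_pdivrMr// ltr_pMr// ltrDl.
    have := ler_norm (F (w x0) - F (w (x + x0))); rewrite /v; lra.
have [n hn] : exists n, q w < theta * (theta / 2) ^+ n * A.
  have t20 : 0 < theta / 2 by rewrite divr_gt0.
  have z1 : `|(theta / 2)^-1| < 1.
    by rewrite ger0_norm ?invr_ge0 ?(ltW t20)// invf_lt1// ltr_pdivlMr// mul1r.
  have tA : 0 < theta * A by rewrite mulr_gt0.
  have := cvg_geometric (q w) z1 => /cvgrPdist_lt /(_ _ tA) [n _ /(_ n (leqnn n))/=].
  rewrite sub0r normrN => h; exists n; have := le_lt_trans (ler_norm _) h.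
  by rewrite exprVn ltr_pdivrMr ?exprn_gt0// mulrAC.
pose t2 : R := 2 ^+ n.
have t21 : 1 <= t2 by rewrite exprn_ege1// ler1n.
have r2 : ray w t2 <= 0.
  rewrite subr_le0; apply: (@le_trans _ _ (\int[mu]_x (theta * (2 * theta) ^+ n * F (w x)))).
    rewrite RintgZ; last exact: iF.
    have -> : theta * (2 * theta) ^+ n * \int[mu]_x F (w x) =
        t2 ^+ 2 * (theta * (theta / 2) ^+ n * A).
      rewrite /t2 -exprM mulnC exprM -/A.
      have -> : (2 * theta) ^+ n = (2 ^+ 2) ^+ n * (theta / 2) ^+ n.
        by rewrite -exprMn; congr (_ ^+ _); field.
      by ring.
    by rewrite ler_wpM2l ?sqr_ge0// ltW.
  apply: le_Rintg; [exact/intgZ/iF|exact/iff/contcZ|] => x.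
  apply: le_trans (ambrosetti_rabinowitz hf0 hf1 _); rewrite -mulrA ler_wpM2l ?(ltW theta0)//.
  exact: (prim_growth hcont hf0 htheta hf1).
have t12 : t1 <= t2 by apply: le_trans t21; rewrite ge_min lexx orbT.
have [t _ nt] := nehari_of_sign tw (ex_intro _ x0 wx) t10 t12 r1 r2.
by exists (fun x => t * w x).
Qed.

(** On the manifold the ray through [u] crosses it transversally; uniformly so
    when [u] is bounded in energy and stays away from zero near the origin, hence
    also after a small perturbation. *)
Lemma nehari_crossing phi (Q d e : R) : test_function phi -> 0 < d ->
  0 < e -> e <= 2^-1 ->
  exists2 s0 : R, 0 < s0 & forall s u, 0 < s -> s < s0 -> nehari u ->
    q u <= Q -> d <= u 0 ->
    exists2 t, 1 - e <= t <= 1 + e & nehari (fun x => t * (u x + s * phi x)).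
Proof.
move=> tp d0 e0 e2.
have cp := tc tp; have [P pP] := contc_bounded cp; have [_ [L pL]] := cp.
have P0 : 0 <= P by exact: le_trans (normr_ge0 _) (pP 0).
have [Q0|Q0] := ltrP Q 0.
  by exists 1 => // s u _ _ _ uQ; have := le_lt_trans uQ Q0; rewrite ltNge energy_ge0.
have [C C0 hC] := energy_sup halpha.
pose M := C * Q + 1.
have M0 : 1 <= M by rewrite lerDr mulr_ge0.
have uM u : test_function u -> q u <= Q -> forall x, `|u x| <= M.
  by move=> tu uQ x; exact: sq_le_bound (hC u x tu) uQ.
have Q1 : 0 < Q + 1 by rewrite ltr_wpDl.
have er0 : 0 < (d / 2) ^+ 2 / (Q + 1) by rewrite divr_gt0// exprn_gt0// divr_gt0.
have [r r0 hr] := energy_equicontinuous halpha er0.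
have bump u : test_function u -> q u <= Q -> d <= u 0 ->
    forall x, `|x| <= r / 2 -> d / 2 <= u x.
  move=> tu uQ du x xr.
  have := hr u 0 x tu; rewrite sub0r normrN => h.
  have {}h : (u 0 - u x) ^+ 2 <= (d / 2) ^+ 2.
    apply: le_trans (h _) _.
      by apply: le_lt_trans xr _; rewrite ltr_pdivrMr// ltr_pMr// ltrDl.
    rewrite mulrAC ler_pdivrMr// ler_wpM2l ?sqr_ge0//.
    by apply: le_trans uQ _; rewrite lerDl.
  have : u 0 - u x <= d / 2.
    have := ler_norm (u 0 - u x) => h1; apply: le_trans h1 _.
    rewrite -(ler_pXn2r (n := 2)) ?nnegrE ?divr_ge0 ?(ltW d0)//.
    by rewrite real_normK ?num_real.
  by lra.
have t10 : 0 < 1 - e by lra.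
have t20 : 0 < 1 + e by lra.
have d2M : d / 2 <= Num.max M (d / 2) by rewrite le_max lexx orbT.
(* [g t] is the integrand of the nonlinear term at [t u], divided by [t ^+ 2]: its
   integral is compared with the energy of [u]. *)
pose g (t s : R) := s * (f (t * s) / t).
have cg t : continuous (g t).
  move=> s; apply: cvgM => //; apply: cvgM; last exact: cvg_cst.
  apply: (@continuous_comp _ _ _ (fun s : R => t * s) f); last exact: hcont.
  by apply: cvgM => //; exact: cvg_cst.
have g0 t : g t 0 = 0 by rewrite /g mul0r.
have gap (j : R -> R) : continuous j -> (forall s, s <= 0 -> j s = 0) ->
    (forall s, 0 < s -> 0 < j s) ->
    exists2 k, 0 < k & forall u, test_function u -> q u <= Q -> d <= u 0 ->
      k <= \int[mu]_x j (u x).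
  move=> cj jn jp.
  have [|k k0 hk] := @pos_min _ j (d / 2) (Num.max M (d / 2)) d2M cj.
    by move=> x /andP[dx _]; apply: jp; apply: lt_le_trans dx; rewrite divr_gt0.
  exists (2 * (r / 2) * k) => [|u tu uQ du]; first by rewrite !mulr_gt0// divr_gt0.
  apply: (@int_ge_bump _ (fun x => j (u x))).
  - by apply: contc_comp => //; [exact: jn|exact: tc].
  - by rewrite divr_ge0// ltW.
  - by move=> x; have [/jn->|/jp/ltW] := lerP (u x) 0.
  - move=> x xr; apply: hk; rewrite bump//= le_max.
    by rewrite (le_trans (ler_norm _) (uM u tu uQ x)).
have gn t s : 0 < t -> s <= 0 -> g t s = 0.
  move=> t0 s0; have ts : t * s <= 0 by rewrite pmulr_rle0.
  by rewrite /g (hf0 ts) mul0r mulr0.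
have [||| k1 k10 hk1] := gap (fun s => s * f s - g (1 - e) s).
- by move=> s; apply: cvgB; [exact: cff|exact: cg].
- by move=> s s0; rewrite gn// hf0// mulr0 subrr.
- move=> s s0; rewrite /g -mulrBr; apply: (f_ray_lt hf4) => //.
  by rewrite ltrBlDr ltrDl.
have [||| k2 k20 hk2] := gap (fun s => g (1 + e) s - s * f s).
- by move=> s; apply: cvgB; [exact: cg|exact: cff].
- by move=> s s0; rewrite gn// hf0// mulr0 subrr.
- move=> s s0; rewrite /g -mulrBr; apply: (f_ray_gt hf4) => //.
  by rewrite ltrDl.
have k120 : 0 < k1 / 2 by rewrite divr_gt0.
have k220 : 0 < k2 / 2 by rewrite divr_gt0.
have [d1 d10 hd1] := @int_close R (g (1 - e)) L M _ (cg _) (g0 _) k120.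
have [d2 d20 hd2] := @int_close R (g (1 + e)) L M _ (cg _) (g0 _) k220.
pose c := Q + 2 * q phi.
have c0 : 0 <= c by rewrite addr_ge0// mulr_ge0// energy_ge0.
have P1 : 0 < P + 1 by rewrite ltr_wpDl.
have c1 : 0 < c + 1 by rewrite ltr_wpDl.
exists (Num.min (Num.min 1 (d / (P + 1))) (Num.min (Num.min (d1 / (P + 1)) (d2 / (P + 1)))
   (Num.min (k1 / 2 / (c + 1)) (k2 / 2 / (c + 1))))).
  by rewrite !lt_min ltr01 !divr_gt0.
move=> s u s0; rewrite !lt_min !ltr_pdivlMr// => /andP[/andP[s1 sd]].
move=> /andP[/andP[sd1 sd2] /andP[sk1 sk2]] nu uQ du.
have [tu _ eu] := nu; have cu := tc tu.
have tw : test_function (fun x => u x + s * phi x).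
  by apply: test_functionD => //; exact: test_functionZ.
have cw := tc tw.
have close x : s * `|phi x| < s * (P + 1).
  by rewrite ltr_pM2l//; apply: le_lt_trans (pP x) _; rewrite ltrDl.
have near_u x : `|u x + s * phi x - u x| < s * (P + 1).
  by rewrite addrAC subrr add0r normrM gtr0_norm.
have out x : L < `|x| -> u x = u x + s * phi x by move=> xL; rewrite pL// mulr0 addr0.
have rayE t : 0 < t -> ray (fun x => u x + s * phi x) t =
    t ^+ 2 * (q (fun x => u x + s * phi x) - \int[mu]_x g t (u x + s * phi x)).
  move=> t0; rewrite /ray mulrBr -RintgZ; last by apply/contc_intg/contc_comp.
  congr (_ - _); apply: eq_Rintegral => x _; rewrite /g.
  by field; rewrite gt_eqF.
have qw : `|q (fun x => u x + s * phi x) - q u| <= s * (c + 1).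
  apply: le_trans (energy_perturb halpha tu tp s0 (ltW s1)) _.
  rewrite ler_pM2l//; apply: ler_wpDr; first exact: ler01.
  by rewrite /c lerD2r.
have i1 t : intg (fun x => g t (u x)).
  by apply/contc_intg/(contc_comp (cg t) (g0 t)).
have h1 := hd1 u _ cu cw out (uM u tu uQ) (fun x => lt_trans (near_u x) sd1).
have h2 := hd2 u _ cu cw out (uM u tu uQ) (fun x => lt_trans (near_u x) sd2).
have g1 := hk1 u tu uQ du; have g2 := hk2 u tu uQ du.
rewrite RintgB// in g1; last exact: iff.
rewrite RintgB// in g2; last exact: iff.
rewrite -eu -/(q u) in g1 g2.
apply: nehari_of_sign => //.
- exists 0; rewrite -(opprK (s * phi 0)) subr_gt0; apply: lt_le_trans du.
  apply: lt_trans sd; apply: le_lt_trans (close 0).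
  by rewrite -mulrN ler_pM2l// -normrN ler_norm.
- by rewrite lerD2l ge0_cp// ltW.
- rewrite rayE// mulr_ge0 ?sqr_ge0//.
  exact: ((ray_sign qw sk1 h1).1 g1).
- rewrite rayE// mulr_ge0_le0 ?sqr_ge0//.
  exact: ((ray_sign qw sk2 h2).2 g2).
Qed.

Let derivI u phi : R := B u phi - \int[mu]_x (f (u x) * phi x).

Let ifphi u phi : contc u -> contc phi -> intg (fun x => f (u x) * phi x).
Proof.
by move=> cu cp; apply/contc_intg/contcM; [exact: contc_comp|case: cp].
Qed.

(** First-order decrease of the action in a direction of negative slope,
    uniform over the functions of bounded energy and over the nearby fibres. *)
Lemma action_descent phi (Q eta : R) : test_function phi -> 0 < eta ->
  exists e s0 : R, [/\ 0 < e, e <= 2^-1, 0 < s0 &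
    forall s t u, 0 < s -> s < s0 -> 1 - e <= t <= 1 + e ->
      test_function u -> q u <= Q -> derivI u phi <= - eta ->
      action (fun x => t * (u x + s * phi x)) <=
      action (fun x => t * u x) - t * s * (eta / 2)].
Proof.
move=> tp eta0.
have cp := tc tp; have [P pP] := contc_bounded cp.
have P0 : 0 <= P by exact: le_trans (normr_ge0 _) (pP 0).
have [Q0|Q0] := ltrP Q 0.
  exists 2^-1, 1; split => // s t u _ _ _ _ uQ.
  by have := le_lt_trans uQ Q0; rewrite ltNge energy_ge0.
have [C C0 hC] := energy_sup halpha.
pose M := C * Q + 1.
have M0 : 1 <= M by rewrite lerDr mulr_ge0.
have uM u : test_function u -> q u <= Q -> forall x, `|u x| <= M.
  by move=> tu uQ x; exact: sq_le_bound (hC u x tu) uQ.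
pose A := \int[mu]_x `|phi x|.
have A0 : 0 <= A by apply: Rintg_ge0.
have A1 : 0 < A + 1 by rewrite ltr_wpDl.
have P1 : 0 < P + 1 by rewrite ltr_wpDl.
have qp : 0 <= q phi by exact: energy_ge0.
pose c := Q + 2 * q phi.
have c0 : 0 <= c by rewrite addr_ge0// mulr_ge0.
have c1 : 0 < c + 1 by rewrite ltr_wpDl.
have eA : 0 < eta / 8 / (A + 1) by rewrite !divr_gt0.
have [r r0 hr] := heine M hcont eA.
have Mp : 0 < M by exact: lt_le_trans M0.
pose e := Num.min 2^-1 (Num.min (eta / 8 / (c + 1)) (r / 2 / (M + 1))).
have M1 : 0 < M + 1 by rewrite ltr_wpDl// ltW.
have e0 : 0 < e by rewrite !lt_min !divr_gt0// invr_gt0 ltr0n.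
exists e, (Num.min (eta / 8 / (c + 1)) (r / 4 / (P + 1))); split => //.
- by rewrite ge_min lexx.
- by rewrite lt_min !divr_gt0.
move=> s t u s0; rewrite lt_min !ltr_pdivlMr// => /andP[sc sP] /andP[t1 t2] tu uQ du.
have : [/\ e <= 2^-1, e * (c + 1) <= eta / 8 & e * (M + 1) <= r / 2].
  by rewrite -!ler_pdivlMr// !ge_min !lexx ?orbT.
case=> e2 ec eM.
have [t0 t32 te] := fibre_range e2 t1 t2.
have cu := tc tu; have ctu := contcZ t cu.
have csp := contcZ s cp.
have ctw : contc (fun x => t * (u x + s * phi x)) by exact/contcZ/contcD.
have tw : test_function (fun x => u x + s * phi x).
  by apply: test_functionD => //; exact: test_functionZ.
have hB : `|B u phi| <= c.
  have := energyB_le halpha tu tp; rewrite normrM ger0_norm// => h.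
  apply: le_trans (le_trans _ h) _; first by rewrite ler_peMl// ler1n.
  by rewrite /c lerD// ler_peMl// ler1n.
have pt x : t * s * (f (u x) * phi x - eta / 8 / (A + 1) * `|phi x|) <=
    F (t * (u x + s * phi x)) - F (t * u x).
  have [z hz] := prim_mvt (t * u x) (t * (s * phi x)).
  rewrite -mulrDr => ->.
  have zu : `|z - u x| < r.
    have tu1 : `|t * u x - u x| <= e * M.
      rewrite -{2}(mul1r (u x)) -mulrBl normrM; apply: ler_pM => //; exact: uM.
    have ts : `|t * (s * phi x)| <= 2 * (s * P).
      rewrite !normrM (gtr0_norm t0) (gtr0_norm s0).
      apply: ler_pM => //; first exact: ltW.
        by rewrite mulr_ge0// ltW.
      by rewrite ler_pM2l.
    exact: (midpoint_close hz ts tu1 s0 e0 sP eM).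
  have -> : f z * (t * (s * phi x)) = t * s * (f z * phi x) by ring.
  rewrite ler_pM2l ?mulr_gt0//; apply: slope_close.
  exact: hr (uM u tu uQ x) zu.
have ip : intg (fun x => `|phi x|) by apply: intg_norm; exact: contc_intg.
have ifp := ifphi cu cp.
have int : t * s * (\int[mu]_x (f (u x) * phi x) - eta / 8 / (A + 1) * A) <=
    \int[mu]_x F (t * (u x + s * phi x)) - \int[mu]_x F (t * u x).
  rewrite -RintgB; [|exact: iF..].
  rewrite -(RintgZ (eta / 8 / (A + 1)))// -RintgB//; last exact: intgZ.
  rewrite -RintgZ; last by apply: intgB => //; exact: intgZ.
  apply: le_Rintg => //; last by apply: intgB; exact: iF.
  by apply: intgZ; apply: intgB => //; exact: intgZ.
rewrite /action (energyZ halpha t tw) (energyZ halpha t tu) (energyD halpha s tu tp) -/(q u) -/(q phi) -/(B u phi).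
have fA : eta / 8 / (A + 1) * A <= eta / 8.
  by rewrite mulrAC ler_pdivrMr// ler_wpM2l ?lerDl// divr_ge0// ltW.
have ts0 : 0 < t * s by rewrite mulr_gt0.
apply: (descent_sum (q u) ts0 int).
apply: (descent_slope t0 t32 s0 te hB qp) => //.
- by rewrite /c; apply: ler_wpDl => //; rewrite ler_peMl// ler1n.
- by apply: le_trans ec; rewrite ler_wpM2l ?(ltW e0)// lerDl.
- by rewrite ler_pdivlMr//; apply: le_trans (ltW sc); rewrite ler_pM2r// ler_pM2l// lerDl.
Qed.

Let values : set R := [set action u | u in nehari].
Let c : R := inf values.

Let values_lb : has_lbound values.
Proof.
exists 0 => _ [u nu <-]; apply: le_trans (nehari_coercive nu).
by rewrite mulr_ge0 ?(ltW coef_gt0)// energy_ge0.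
Qed.

Let values_inf : has_inf values.
Proof. by split=> //; have [u nu] := nehari_nonempty; exists (action u), u. Qed.

Let c_le u : nehari u -> c <= action u.
Proof. by move=> nu; apply: ge_inf => //; exists u. Qed.

Let Qmax : R := (c + 1) / coef.

Let energy_le u : nehari u -> action u <= c + 1 -> q u <= Qmax.
Proof.
move=> nu Iu; rewrite /Qmax ler_pdivlMr// mulrC.
exact: le_trans (nehari_coercive nu) Iu.
Qed.

(** A function of the manifold with almost minimal action is almost critical:
    otherwise a short move in a direction of negative slope, followed by a return
    to the manifold along the ray, would bring the action below its infimum. *)
Lemma nehari_almost_critical phi (d eta : R) : test_function phi -> 0 < d ->
  0 < eta -> exists2 e : R, 0 < e & forall u, nehari u -> d <= u 0 ->
    action u < c + e -> - eta < derivI u phi.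
Proof.
move=> tp d0 eta0.
have [e [s1 [e0 e2 s10 hs1]]] := action_descent Qmax tp eta0.
have [s2 s20 hs2] := nehari_crossing Qmax tp d0 e0 e2.
pose s := Num.min s1 s2 / 2.
have s0 : 0 < s by rewrite divr_gt0// lt_min s10 s20.
have : s < Num.min s1 s2 by rewrite ltr_pdivrMr// ltr_pMr ?lt_min ?s10 ?s20// ltrDl.
rewrite lt_min => /andP[ss1 ss2].
exists (Num.min 1 (s * eta / 4)); first by rewrite lt_min ltr01 divr_gt0// mulr_gt0.
move=> u nu du; rewrite addr_minr lt_min => /andP[Iu1 Iu].
have uQ := energy_le nu (ltW Iu1); have [tu _ _] := nu.
rewrite ltNge; apply/negP => dI.
have [t tt nt] := hs2 s u s0 ss2 nu uQ du.
have h := hs1 s t u s0 ss1 tt tu uQ dI.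
case/andP: tt => t1 t2; have [t0 _ _] := fibre_range e2 t1 t2.
exact: (descent_contradiction s0 eta0 (fibre_half e2 t1) (c_le nt) h
  (nehari_fibre_max nu t0) Iu).
Qed.

Lemma nehari_shift u y : nehari u -> nehari (fun x => u (x + y)) /\
  action (fun x => u (x + y)) = action u.
Proof.
move=> [tu [x0 ux0] e]; have ts := test_function_shift y tu.
have sh (g : R -> R) : intg (fun x => g (u x)) ->
    \int[mu]_x g (u (x + y)) = \int[mu]_x g (u x).
  move=> ig; have := @Rintg_affine R (fun x => g (u x)) 1 y ltr01 ig.
  by rewrite mul1r => <-; apply: eq_Rintegral => x _; rewrite mul1r.
split; last first.
  by rewrite /action (energy_shift halpha y tu) (sh F)//; exact/iF/tc.
split => //; first by exists (x0 - y); rewrite subrK.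
by rewrite (energy_shift halpha y tu) e (sh (fun s => s * f s))//; exact/iff/tc.
Qed.

(** A minimising sequence. The problem being invariant under translations, each
    term can be moved so that it stays away from zero at the origin, which keeps
    the sequence from escaping to infinity. *)
Lemma palais_smale : exists (Q d : R) (u : nat -> R -> R), [/\ 0 < d,
  forall n, [/\ test_function (u n), energy alpha (u n) <= Q & d <= u n 0] &
  forall phi, test_function phi ->
    energyB alpha (u n) phi - \int[mu]_x (f (u n x) * phi x) @[n --> \oo] --> 0].
Proof.
have [d d0 hd] := nehari_peak.
have ex n : exists u, [/\ nehari u, d <= u 0 & action u < c + n.+1%:R^-1].
  have [|_ [v nv <-] hv] := @inf_adherent _ values n.+1%:R^-1 _ values_inf.
    by rewrite invr_gt0.
  have [y vy] := hd v nv; have [nvy e] := nehari_shift y nv.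
  by exists (fun x => v (x + y)); split; rewrite ?add0r ?e.
have [u hu] := choice ex; exists Qmax, d, u; split => //.
  move=> n; have [nu du Iu] := hu n; split => //; first by case: nu.
  apply: energy_le => //; apply/ltW/(lt_le_trans Iu).
  by rewrite lerD2l invf_le1// ler1n.
move=> phi tp; apply/cvgr0Pnorm_le => eta eta0.
have tn : test_function (fun x => (-1) * phi x) by exact: test_functionZ.
have [e1 e10 h1] := nehari_almost_critical tp d0 eta0.
have [e2 e20 h2] := nehari_almost_critical tn d0 eta0.
have e0 : 0 < Num.min e1 e2 by rewrite lt_min e10 e20.
near=> n; have [nu du Iu] := hu n; have [tu _ _] := nu.
have : n.+1%:R^-1 < Num.min e1 e2.
  by near: n; apply: (cvgr_lt (0 : R)) => //; exact: cvg_harmonic.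
rewrite lt_min => /andP[ne1 ne2].
have {}h1 := h1 _ nu du (lt_trans Iu _); have {}h2 := h2 _ nu du (lt_trans Iu _).
rewrite ltrD2l in h1; rewrite ltrD2l in h2.
have {}h1 := h1 ne1; have {}h2 := h2 ne2.
have eB : B (u n) (fun x => -1 * phi x) = - B (u n) phi.
  by rewrite /B energyBC (energyBZ halpha _ tp tu) energyBC mulN1r.
have ei : \int[mu]_x (f (u n x) * (-1 * phi x)) = - \int[mu]_x (f (u n x) * phi x).
  rewrite -[RHS]mulN1r -RintgZ; last by apply: ifphi; exact: tc.
  by apply: eq_Rintegral => x _; ring.
move: h2; rewrite /derivI eB ei => h2; move: h1; rewrite /derivI => h1.
by rewrite ler_norml; apply/andP; split; apply/ltW => //; rewrite -ltrN2 opprD.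
Unshelve. all: by end_near. Qed.

End Nehari.

(** * Limits of bounded equicontinuous sequences *)

Section PointwiseLimit.
Context {R : realType}.

(** By Tychonoff's theorem the sequence has a cluster point [v] for pointwise
    convergence. Some subsequence converges to [v] at the rationals, taken one
    after the other, and equicontinuity extends this to all points. *)
Lemma pointwise_subsequence (u : nat -> R -> R) (M : R) :
  (forall n x, `|u n x| <= M) ->
  (forall e : R, 0 < e -> exists2 d : R, 0 < d &
     forall n x y, `|x - y| < d -> `|u n x - u n y| <= e) ->
  exists (v : R -> R) (k : nat -> nat), (forall n, (n <= k n)%N) /\
    forall x, u (k n) x @[n --> \oo] --> v x.
Proof.
move=> uM equi.
pose T : topologicalType := prod_topology (fun _ : R => R).
have cptA := @tychonoff R (fun=> R) (fun=> `[- M, M]%classic) (fun=> @segment_compact R (- M) M).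
have [|v [_ clv]] := cptA (fmap (u : nat -> T) (nbhs \oo)) _.
  exists 0%N => // n _ x; rewrite /= in_itv/= -ler_norml; exact: uM.
have near_pt (I : finType) (q : I -> R) (e : R) (N : nat) : 0 < e ->
    exists2 n, (N <= n)%N & forall i, `|v (q i) - u n (q i)| < e.
  move=> e0.
  pose B := [set g : T | forall i, `|v (q i) - g (q i)| < e].
  have nB : nbhs (v : T) B.
    apply: (@filter_forall T I (fun i => [set g : T | `|v (q i) - g (q i)| < e]) (nbhs (v : T)) (nbhs_filter _)) => i.
    have nb : nbhs (v (q i) : R) [set y : R | `|v (q i) - y| < e].
      have := @nbhsx_ballx R R (v (q i)) e e0; exact: filterS.
    exact: (@proj_continuous R (fun=> R : topologicalType) (q i) v _ nb).
  have nF : fmap (u : nat -> T) (nbhs \oo) [set g | exists2 n, (N <= n)%N & g = u n].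
    by exists N => // n Nn; exists n.
  by have [g [[n Nn ->] Bg]] := clv _ _ nF nB; exists n.
have vequi (e : R) : 0 < e -> exists2 d : R, 0 < d &
    forall x y, `|x - y| < d -> `|v x - v y| <= e.
  move=> e0; have e3 : 0 < e / 3 by rewrite divr_gt0.
  have [d d0 hd] := equi _ e3; exists d => // x y xy.
  have [n _ hn] := near_pt bool (fun b => if b then x else y) (e / 3) 0%N e3.
  have h1 := hn true; have h2 := hn false; have h3 := hd n x y xy.
  rewrite /= in h1 h2; move: h1 h2 h3; rewrite !(ltr_norml, ler_norml).
  by move=> /andP[? ?] /andP[? ?] /andP[? ?]; apply/andP; split; lra.
pose q (i : nat) : R := ratr (odflt 0 (unpickle i)).
have ex n : exists m, (n <= m)%N /\ forall i : 'I_n, `|v (q i) - u m (q i)| < n.+1%:R^-1.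
  have [|m ? ?] := near_pt 'I_n (fun i => q i) n.+1%:R^-1 n; first by rewrite invr_gt0.
  by exists m.
have [k hk] := choice ex; exists v, k; split=> [n|x]; first by have [] := hk n.
apply/cvgrPdist_le => e e0; have e3 : 0 < e / 3 by rewrite divr_gt0.
have [d1 d10 hd1] := equi _ e3; have [d2 d20 hd2] := vequi _ e3.
have m0 : 0 < Num.min d1 d2 by rewrite lt_min d10.
have [r] := @rat_in_itvoo _ x (x + Num.min d1 d2) (ltr_pwDr m0 (lexx x)).
rewrite in_itv/= => /andP[xr rx].
have xrd : `|x - ratr r| < Num.min d1 d2 by rewrite ler0_norm; lra.
have [xr1 xr2] : `|x - ratr r| < d1 /\ `|x - ratr r| < d2.
  by move: xrd; rewrite lt_min => /andP.
have qr : q (pickle r) = ratr r by rewrite /q pickleK.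
near=> n.
have [_ hkn] := hk n.
have rn : (pickle r < n)%N by near: n; exact: nbhs_infty_gt.
have h1 := hkn (Ordinal rn); rewrite /= qr in h1.
have h2 : n.+1%:R^-1 < e / 3.
  by near: n; apply: (cvgr_lt (0 : R)) => //; exact: cvg_harmonic.
have h3 := hd1 (k n) _ _ xr1; have h4 := hd2 _ _ xr2.
have {h1}h5 := lt_trans h1 h2; move: h3 h4 h5; rewrite !(ltr_norml, ler_norml).
by move=> /andP[? ?] /andP[? ?] /andP[? ?]; apply/andP; split; lra.
Unshelve. all: by end_near. Qed.

End PointwiseLimit.

(** * Convex combinations that converge in energy *)

Section MazurArithmetic.
Context {R : realType}.

Lemma parallelogram_gap (a b m x y d1 d2 d0 D r e : R) :
  x + y = 2 * a + 2 * b -> m = 4^-1 * x -> d0 <= m -> a < d1 + r -> b < d2 + r ->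
  d1 <= D -> d2 <= D -> D - e / 16 < d0 -> r < e / 16 -> 0 < e -> y < e.
Proof. lra. Qed.

Lemma mid_close (a b l e : R) : `|a - l| <= e -> `|b - l| <= e ->
  `|2^-1 * (a + 1 * b) - l| <= e.
Proof.
rewrite !ler_norml => /andP[? ?] /andP[? ?]; apply/andP; split; lra.
Qed.

End MazurArithmetic.

Section Mazur.
Context {R : realType}.
Variable alpha : R.
Hypothesis halpha : 2^-1 < alpha < 1.
Implicit Types S : (R -> R) -> Prop.

(** Midpoints suffice to run the parallelogram identity; the closure under them
    replaces the convex hull, so that no weights have to be carried. *)
Inductive midhull S : (R -> R) -> Prop :=
| midhull_base u of S u : midhull S u
| midhull_mid u v of midhull S u & midhull S v :
    midhull S (fun x => 2^-1 * (u x + 1 * v x)).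

Lemma midhull_sub S S' : (forall u, S u -> S' u) -> forall u, midhull S u -> midhull S' u.
Proof.
move=> SS u; elim=> [v /SS Sv|a b _ ha _ hb]; first exact: midhull_base.
exact: midhull_mid.
Qed.

Lemma test_function_mid (u v : R -> R) : test_function u -> test_function v ->
  test_function (fun x => u x + 1 * v x).
Proof. by move=> tu tv; apply: test_functionD => //; exact: test_functionZ. Qed.

Lemma midhull_test S : (forall u, S u -> test_function u) ->
  forall u, midhull S u -> test_function u.
Proof.
move=> tS u; elim=> [v /tS//|a b _ ta _ tb].
by apply: test_functionZ; exact: test_function_mid.
Qed.

Lemma midhull_energyB S (phi : R -> R) (L e : R) : test_function phi ->
  (forall u, S u -> test_function u) ->
  (forall u, S u -> `|energyB alpha u phi - L| <= e) ->
  forall u, midhull S u -> `|energyB alpha u phi - L| <= e.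
Proof.
move=> tp tS hS u; elim=> [v /hS//|a b ha iha hb ihb].
have ta := midhull_test tS ha; have tb := midhull_test tS hb.
rewrite (energyBZ halpha 2^-1 (test_function_mid ta tb) tp).
by rewrite (energyBD halpha 1 ta tb tp); exact: mid_close.
Qed.

Lemma midhull_val S (x L e : R) :
  (forall u, S u -> `|u x - L| <= e) ->
  forall u, midhull S u -> `|u x - L| <= e.
Proof.
by move=> hS u; elim=> [v /hS//|a b _ iha _ ihb]; exact: mid_close.
Qed.

Lemma energy_parallelogram (u v : R -> R) : test_function u -> test_function v ->
  energy alpha (fun x => u x + 1 * v x) + energy alpha (fun x => u x - v x) =
  2 * energy alpha u + 2 * energy alpha v.
Proof.
move=> tu tv.
have -> : (fun x => u x - v x) = (fun x => u x + (-1) * v x).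
  by apply/funext => x; rewrite mulN1r.
rewrite (energyD halpha 1 tu tv) (energyD halpha (-1) tu tv).
by move: (energy _ u) (energy _ v) (energyB _ u v) => a b c; ring.
Qed.

(** Mazur's lemma: combinations of the tails that nearly minimise the energy form a
    Cauchy sequence by the parallelogram identity. Bounds that define convex sets
    pass to the combinations, so the limits are the same. *)
Lemma mazur (u : nat -> R -> R) (v : R -> R) (L : (R -> R) -> R) (Q : R) :
  (forall n, test_function (u n)) -> (forall n, energy alpha (u n) <= Q) ->
  (forall x, u n x @[n --> \oo] --> v x) ->
  (forall phi, test_function phi -> energyB alpha (u n) phi @[n --> \oo] --> L phi) ->
  exists w : nat -> R -> R, [/\ forall n, test_function (w n),
    forall e : R, 0 < e -> exists N, forall m n, (N <= m)%N -> (N <= n)%N ->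
      energy alpha (fun x => w m x - w n x) < e,
    forall x, w n x @[n --> \oo] --> v x &
    forall phi, test_function phi -> energyB alpha (w n) phi @[n --> \oo] --> L phi].
Proof.
move=> tu uQ uv uL.
pose base n := fun g : R -> R => exists2 k, (n <= k)%N & g = u k.
have tbase n g : base n g -> test_function g by move=> [k _ ->].
pose tail n := midhull (base n).
have ttail n g : tail n g -> test_function g by exact: (midhull_test (tbase n)).
have tailS m n g : (m <= n)%N -> tail n g -> tail m g.
  move=> mn; apply: midhull_sub => {}g [k nk ->]; exists k => //.
  exact: leq_trans nk.
pose d n := inf [set energy alpha g | g in tail n].
have hasinf n : has_inf [set energy alpha g | g in tail n].
  split; last by exists 0 => _ [g _ <-]; exact: energy_ge0.
  by exists (energy alpha (u n)), (u n) => //; apply: midhull_base; exists n.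
have d_le n g : tail n g -> d n <= energy alpha g.
  by move=> tg; apply: ge_inf; [case: (hasinf n)|exists g].
have dQ n : d n <= Q.
  by apply: le_trans (uQ n); apply: d_le; apply: midhull_base; exists n.
have hassup : has_sup (range d).
  by split; [exists (d 0%N), 0%N|exists Q => _ [n _ <-]].
pose D := sup (range d).
have dD n : d n <= D by apply: sup_upper_bound => //; exists n.
have ex n : exists g, tail n g /\ energy alpha g < d n + n.+1%:R^-1.
  have [|_ [g tg <-] hg] := @inf_adherent _ _ n.+1%:R^-1 _ (hasinf n).
    by rewrite invr_gt0.
  by exists g.
have [w hw] := choice ex; have tw n : test_function (w n) by apply: (ttail n); case: (hw n).
exists w; split; first exact: tw.
- move=> e e0; have e16 : 0 < e / 16 by rewrite divr_gt0.
  have [_ [N1 _ <-] hN1] := sup_adherent e16 hassup.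
  have [N2 _ hN2] : \forall n \near \oo, n.+1%:R^-1 < e / 16.
    by apply: (cvgr_lt (0 : R)) => //; exact: cvg_harmonic.
  exists (maxn N1 N2) => m n; rewrite !geq_max => /andP[m1 m2] /andP[n1 n2].
  have [tm em] := hw m; have [tn en] := hw n.
  have inv k : (N2 <= k)%N -> k.+1%:R^-1 <= N2.+1%:R^-1 :> R.
    by move=> h; rewrite lef_pV2 ?posrE// ler_nat.
  have mid := d_le N1 _ (midhull_mid (tailS _ _ _ m1 tm) (tailS _ _ _ n1 tn)).
  have eZ := energyZ halpha 2^-1 (test_function_mid (tw m) (tw n)).
  rewrite (_ : 2^-1 ^+ 2 = 4^-1 :> R) in eZ; last by field.
  apply: (parallelogram_gap (energy_parallelogram (tw m) (tw n)) eZ mid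
    (lt_le_trans em _) (lt_le_trans en _) (dD m) (dD n) hN1 (hN2 N2 (leqnn _)) e0).
    by rewrite lerD2l; exact: inv.
  by rewrite lerD2l; exact: inv.
- move=> x; apply/cvgrPdist_le => e e0.
  have /cvgrPdist_le /(_ e e0) [N _ hN] := uv x.
  exists N; [exact: I|move=> n /= Nn];  rewrite distrC; have [tn _] := hw n.
  apply: (@midhull_val (base N) _ _ _ _ _ (tailS _ _ _ Nn tn)) => g [k Nk ->].
  by rewrite distrC; exact: hN.
- move=> phi tp; apply/cvgrPdist_le => e e0.
  have /cvgrPdist_le /(_ e e0) [N _ hN] := uL phi tp.
  exists N; [exact: I|move=> n /= Nn];  rewrite distrC; have [tn _] := hw n.
  apply: (@midhull_energyB (base N) _ _ _ tp (tbase N) _ _ (tailS _ _ _ Nn tn)) => g [k Nk ->].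
  by rewrite distrC; exact: hN.
Qed.

End Mazur.

(** * The weak limit of the almost critical points *)

Section WeakLimit.
Context {R : realType}.
Local Notation mu := (@lebesgue_measure R).

Lemma Rintg_limit_comp (g : R -> R) (u : nat -> R -> R) (v phi : R -> R) (M : R) :
  continuous g -> (forall n, measurable_fun setT (u n)) -> measurable_fun setT v ->
  (forall n x, `|u n x| <= M) -> (forall x, u n x @[n --> \oo] --> v x) ->
  intg phi ->
  \int[mu]_x (g (u n x) * phi x) @[n --> \oo] --> \int[mu]_x (g (v x) * phi x).
Proof.
move=> cg mu_ mv uM uv ip; have [K K0 gK] := bounded_on_itv M cg.
have mg w : measurable_fun setT w -> measurable_fun setT (fun x => g (w x) * phi x).
  move=> mw; apply: measurable_funM; last exact: intg_meas.
  exact: (measurableT_comp (cont_meas cg) mw).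
have [] // := @Rintg_dct R (fun n x => g (u n x) * phi x) (fun x => g (v x) * phi x)
  (fun x => K * `|phi x|) (fun n => mg _ (mu_ n)) (mg _ mv) _ _ _.
- apply: aeW => x; apply: cvgM; last exact: cvg_cst.
  exact: (@seq_continuous R g (v x) (fun n => u n x) (cg _) (uv x)).
- by apply: intgZ; exact: intg_norm.
- by move=> n x; rewrite normrM ler_wpM2r// gK.
Qed.

Lemma sq_le_norm (x e y Q : R) : 0 < e -> 0 <= Q -> y <= Q ->
  x ^+ 2 <= e ^+ 2 / (Q + 1) * y -> `|x| <= e.
Proof.
move=> e0 Q0 yQ xe; have e1 := ltW e0.
rewrite -(@ler_pXn2r _ 2)// ?nnegrE// real_normK ?num_real//.
apply: le_trans xe _; rewrite mulrAC ler_pdivrMr; last by lra.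
by rewrite ler_wpM2l ?sqr_ge0//; lra.
Qed.

Variable alpha : R.
Hypothesis halpha : 2^-1 < alpha < 1.
Variables (f : R -> R) (theta : R).
Hypothesis hcont : continuous f.
Hypothesis hf0 : forall xi : R, xi <= 0 -> f xi = 0.
Hypothesis htheta : 2 < theta.
Hypothesis hf1 : forall xi : R, 0 < xi -> 0 < theta * primitive0 f xi <= xi * f xi.
Hypothesis hf2 : f =o_ (0 : R) (fun xi : R => `|xi|).
Hypothesis hf4 : forall xi : R, 0 < xi -> forall s t : R, 0 < s -> s < t ->
  f (s * xi) * xi / s < f (t * xi) * xi / t.

(** The sequence of [palais_smale] is bounded and equicontinuous, so a subsequence
    converges at every point. The nonlinear term passes to the limit by dominated
    convergence on the support of [phi]; the lower bound at the origin persists in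
    a neighbourhood by equicontinuity, hence in the limit. *)
Lemma critical_limit : exists (w : nat -> R -> R) (v : R -> R) (M r k : R),
  [/\ forall n, test_function (w n),
    forall e : R, 0 < e -> exists N, forall m n, (N <= m)%N -> (N <= n)%N ->
      energy alpha (fun x => w m x - w n x) < e,
    forall x, w n x @[n --> \oo] --> v x &
    forall phi, test_function phi ->
      energyB alpha (w n) phi @[n --> \oo] --> \int[mu]_x (f (v x) * phi x)] /\
  [/\ measurable_fun setT v, forall x, `|v x| <= M, 0 < r, 0 < k &
    forall x, `|x| < r -> k <= v x].
Proof.
have [Q [d [u [d0 hu hPS]]]] := palais_smale halpha hcont hf0 htheta hf1 hf2 hf4.
have [C C0 hC] := energy_sup halpha.
have tu n : test_function (u n) by case: (hu n).
have uQ n : energy alpha (u n) <= Q by case: (hu n).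
have ud n : d <= u n 0 by case: (hu n).
have Q0 : 0 <= Q := le_trans (energy_ge0 alpha (u 0%N)) (uQ 0%N).
pose M := C * Q + 1.
have uM n x : `|u n x| <= M := sq_le_bound C0 Q0 (hC _ x (tu n)) (uQ n).
have equi (e : R) : 0 < e -> exists2 h : R, 0 < h &
    forall n x y, `|x - y| < h -> `|u n x - u n y| <= e.
  move=> e0; have e1 : 0 < e ^+ 2 / (Q + 1).
    by rewrite divr_gt0 ?exprn_gt0//; lra.
  have [h h0 hh] := energy_equicontinuous halpha e1; exists h => // n x y xy.
  exact: (sq_le_norm e0 Q0 (uQ n) (hh _ x y (tu n) xy)).
have [v [k [kn uv]]] := pointwise_subsequence uM equi.
have mu_ n := cont_meas (test_function_contc (tu n)).1.
have mv := measurable_fun_cvg (fun n => mu_ (k n)) (fun x _ => uv x).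
have koo : k n @[n --> \oo] --> \oo.
  move=> A [N _ NA]; exists N => // n /= Nn; apply: NA; exact: leq_trans (kn n).
have uL phi : test_function phi ->
    energyB alpha (u (k n)) phi @[n --> \oo] --> \int[mu]_x (f (v x) * phi x).
  move=> tp; rewrite -[X in _ --> X]add0r.
  have h1 := cvg_comp _ _ koo (hPS phi tp).
  have h2 := Rintg_limit_comp hcont (fun n => mu_ (k n)) mv (fun n => uM (k n)) uv (test_function_intg tp).
  pose I n := \int[mu]_x (f (u (k n) x) * phi x).
  have -> : (fun n => energyB alpha (u (k n)) phi) =
      (fun n => (energyB alpha (u (k n)) phi - I n) + I n).
    by apply/funext => n; rewrite subrK.
  exact: (cvgD h1 h2).
have [w [tw wc wv wL]] := mazur halpha (fun n => tu (k n)) (fun n => uQ (k n)) uv uL.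
have [h h0 hh] := equi _ (divr_gt0 d0 (ltr0n _ 2)).
exists w, v, M, h, (d / 2); split; first by split.
split => //.
- by move=> x; apply: (cvgr_to_le (cvg_norm (uv x))); near=> n.
- by rewrite divr_gt0.
- move=> x xh; apply: (cvgr_to_ge (uv x)); near=> n.
  have := hh (k n) x 0; rewrite subr0 => /(_ xh); have := ud (k n).
  by rewrite ler_norml => ? /andP[? _]; lra.
Unshelve. all: by end_near. Qed.

End WeakLimit.

(** * Fourier transforms and the Liouville-Weyl symbol in Hartley form *)

Section SquareLimits.
Context {R : realType}.
Local Notation mu := (@lebesgue_measure R).
Implicit Types u v : R -> R.

Lemma ip_cvg (u_ v_ : nat -> R -> R) u v :
  (forall n, sqi (u_ n)) -> (forall n, sqi (v_ n)) -> sqi u -> sqi v ->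
  nsq (fun x => u_ n x - u x) @[n --> \oo] --> 0 ->
  nsq (fun x => v_ n x - v x) @[n --> \oo] --> 0 ->
  \int[mu]_x (u_ n x * v_ n x) @[n --> \oo] --> \int[mu]_x (u x * v x).
Proof.
move=> su_ sv_ su sv uu vv.
have sdu n := sqiB (su_ n) su; have sdv n := sqiB (sv_ n) sv.
have small a (b_ : nat -> R -> R) b : sqi a -> (forall n, sqi (b_ n)) -> sqi b ->
    nsq (fun x => b_ n x - b x) @[n --> \oo] --> 0 ->
    \int[mu]_x (a x * (b_ n x - b x)) @[n --> \oo] --> 0.
  move=> sa sb_ sb bb; apply/cvgr0Pnorm_le => e e0.
  have K0 : 0 < nsq a + 1 by rewrite ltr_wpDl// nsq_ge0.
  have d0 : 0 < e ^+ 2 / (nsq a + 1) by rewrite divr_gt0// exprn_gt0.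
  have /cvgr0Pnorm_le /(_ _ d0) := bb; apply: filterS => n hn.
  have cs := cauchy_schwarz sa (sqiB (sb_ n) sb).
  have e1 := ltW e0.
  rewrite -(@ler_pXn2r _ 2)// ?nnegrE// real_normK ?num_real//.
  apply: le_trans cs _; move: hn; rewrite ger0_norm ?nsq_ge0// => hn.
  apply: le_trans (ler_wpM2l (nsq_ge0 a) hn) _.
  rewrite mulrCA ger_pMr ?exprn_gt0// ler_pdivrMr// mul1r lerDl.
  exact: ler01.
have h1 := small v u_ u sv su_ su uu.
have h2 := small u v_ v su sv_ sv vv.
have h3 : \int[mu]_x ((u_ n x - u x) * (v_ n x - v x)) @[n --> \oo] --> 0.
  have b n : `|\int[mu]_x ((u_ n x - u x) * (v_ n x - v x))| <=
      nsq (fun x => u_ n x - u x) + nsq (fun x => v_ n x - v x).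
    have cs := cauchy_schwarz (sdu n) (sdv n).
    have a1 := nsq_ge0 (fun x => u_ n x - u x).
    have a2 := nsq_ge0 (fun x => v_ n x - v x).
    rewrite -(@ler_pXn2r _ 2) ?nnegrE ?normr_ge0 ?addr_ge0//.
    rewrite real_normK ?num_real//; apply: le_trans cs _.
    move: (nsq _) (nsq _) a1 a2 => A B A0 B0; have := mulr_ge0 A0 B0.
    have := sqr_ge0 (A - B); nra.
  apply/cvgr0Pnorm_le => e e0; have e2 : 0 < e / 2 by rewrite divr_gt0.
  have /cvgr0Pnorm_le /(_ _ e2) := uu; have /cvgr0Pnorm_le /(_ _ e2) := vv.
  apply: filterS2 => n hv hu.
  rewrite ger0_norm ?nsq_ge0// in hu; rewrite ger0_norm ?nsq_ge0// in hv.
  apply: le_trans (b n) _; rewrite [leRHS](splitr e); exact: lerD.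
have eq n : \int[mu]_x (u_ n x * v_ n x) =
    \int[mu]_x ((u_ n x - u x) * (v_ n x - v x)) +
    \int[mu]_x (v x * (u_ n x - u x)) + \int[mu]_x (u x * (v_ n x - v x)) +
    \int[mu]_x (u x * v x).
  have i1 := sqiM (sdu n) (sdv n); have i2 := sqiM sv (sdu n).
  have i3 := sqiM su (sdv n); have i4 := sqiM su sv.
  rewrite -(RintgD i1 i2) -(RintgD (intgD i1 i2) i3).
  rewrite -(RintgD (intgD (intgD i1 i2) i3) i4).
  by apply: eq_Rintegral => x _; ring.
under eq_fun do rewrite eq.
have h := cvgD (cvgD (cvgD h3 h1) h2) (cvg_cst (\int[mu]_x (u x * v x))).
rewrite !add0r in h; exact: h.
Qed.

Lemma nsq_cvg (u_ : nat -> R -> R) u : (forall n, sqi (u_ n)) -> sqi u ->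
  nsq (fun x => u_ n x - u x) @[n --> \oo] --> 0 -> nsq (u_ n) @[n --> \oo] --> nsq u.
Proof. by move=> su_ su uu; exact: (ip_cvg su_ su_ su su uu uu). Qed.

Lemma nsq_cvg0_le (a_ : nat -> R -> R) (b_ : nat -> R) :
  (forall n, nsq (a_ n) <= b_ n) -> b_ n @[n --> \oo] --> 0 ->
  nsq (a_ n) @[n --> \oo] --> 0.
Proof.
move=> ab b0; apply: (squeeze_cvgr _ (cvg_cst 0) b0).
by near=> n; rewrite nsq_ge0 ab.
Unshelve. all: by end_near. Qed.

End SquareLimits.

Section HartleyFourier.
Context {R : realType}.
Local Notation mu := (@lebesgue_measure R).
Implicit Types u h : R -> R.
Local Open Scope complex_scope.

(** The Fourier transform has the even and the odd part of the Hartley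
    transform as real and opposite imaginary part. *)
Definition fourier_of_hart h (w : R) : R[i] :=
  ((h w + h (- w)) / 2) +i* (- ((h w - h (- w)) / 2)).

Lemma fourierE u w : intg u -> fourier u w = fourier_of_hart (hart u) w.
Proof.
move=> iu.
have ic : intg (fun x => cos (x * w) * u x).
  apply: (intg_eq (f := fun x => u x * cos (x * w))); first by move=> x; rewrite mulrC.
  apply: (@intgM _ _ _ 1 iu) => [|x]; last by rewrite ler_norml cos_geN1 cos_le1.
  apply: cont_meas => x; apply: continuous_comp; last exact: continuous_cos.
  exact: mulrr_continuous.
have is_ : intg (fun x => sin (x * w) * u x).
  apply: (intg_eq (f := fun x => u x * sin (x * w))); first by move=> x; rewrite mulrC.
  apply: (@intgM _ _ _ 1 iu) => [|x]; last by rewrite ler_norml sin_geN1 sin_le1.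
  apply: cont_meas => x; apply: continuous_comp; last exact: continuous_sin.
  exact: mulrr_continuous.
have hp : hart u w = \int[mu]_x (cos (x * w) * u x) + \int[mu]_x (sin (x * w) * u x).
  by rewrite -(RintgD ic is_); apply: eq_Rintegral => x _; rewrite /cas mulrDl.
have hm : hart u (- w) = \int[mu]_x (cos (x * w) * u x) - \int[mu]_x (sin (x * w) * u x).
  rewrite -(RintgB ic is_); apply: eq_Rintegral => x _.
  by rewrite /cas mulrN cosN sinN mulrDl mulNr.
rewrite /fourier /fourier_of_hart hp hm.
move: (\int[mu]_x _) (\int[mu]_x _) => a b; congr (_ +i* _); by field.
Qed.

Lemma fourier_of_hartB h g w :
  fourier_of_hart h w - fourier_of_hart g w = fourier_of_hart (fun x => h x - g x) w.
Proof. by rewrite /fourier_of_hart; simpc; congr (_ +i* _); field. Qed.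

Lemma normc_fourier_of_hart h w :
  ComplexField.Normc.normc (fourier_of_hart h w) =
  Num.sqrt ((h w ^+ 2 + h (- w) ^+ 2) / 2).
Proof. by congr Num.sqrt; field. Qed.

Lemma sqi_normc h : sqi h ->
  sqi (fun w => ComplexField.Normc.normc (fourier_of_hart h w)) /\
  nsq (fun w => ComplexField.Normc.normc (fourier_of_hart h w)) = nsq h.
Proof.
move=> sh; have shN := sqiNx sh.
have ge0 w : 0 <= (h w ^+ 2 + h (- w) ^+ 2) / 2.
  by rewrite divr_ge0// addr_ge0// sqr_ge0.
have E : (fun w => ComplexField.Normc.normc (fourier_of_hart h w) ^+ 2) =
    (fun w => 2^-1 * (h w ^+ 2 + h (- w) ^+ 2)).
  by apply/funext => w; rewrite normc_fourier_of_hart sqr_sqrtr// mulrC.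
have i2 : intg (fun w => h w ^+ 2 + h (- w) ^+ 2) by exact: intgD sh.2 shN.2.
split; first split.
- rewrite (_ : (fun w => _) = (fun w => Num.sqrt ((h w ^+ 2 + h (- w) ^+ 2) / 2))).
    apply: (measurableT_comp (cont_meas (@sqrt_continuous R))).
    exact: measurable_funM (intg_meas i2) (@measurable_cst _ _ _ _ _ _).
  by apply/funext => w; exact: normc_fourier_of_hart.
- by rewrite E; exact: intgZ.
rewrite {1}/nsq E (RintgZ _ i2) (RintgD sh.2 shN.2).
have -> : \int[mu]_x (h (- x) ^+ 2) = nsq h by exact: (nsqNx sh).
by rewrite /nsq; move: (\int[mu]_x _) => a; by field.
Qed.

Lemma cL2norm_fourier_of_hart h : sqi h ->
  cL2norm (fourier_of_hart h) = (Num.sqrt (nsq h))%:E.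
Proof. by move=> sh; have [s e] := sqi_normc sh; rewrite /cL2norm L2normE// e. Qed.

Lemma cL2_fourier_of_hart h : sqi h -> cL2 (fourier_of_hart h).
Proof.
move=> sh; have shN := sqiNx sh; split; apply/L2P => /=.
  have := sqiZ 2^-1 (sqiD sh shN); congr sqi.
  by apply/funext => w; rewrite mulrC.
have := sqiZ (- 2^-1) (sqiB sh shN); congr sqi.
by apply/funext => w; rewrite mulrC mulrN.
Qed.

(** The action of [(iw)^alpha] on Hartley transforms: the argument of the symbol
    rotates the pair [(h w, h (- w))], its modulus is the weight. *)
Definition lw_hart alpha h (w : R) : R :=
  wt alpha w * (cos (pi * alpha / 2) * h w - Num.sg w * sin (pi * alpha / 2) * h (- w)).

Lemma LW_symbol_mul alpha h w : alpha != 0 ->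
  LW_symbol alpha w * fourier_of_hart h w = fourier_of_hart (lw_hart alpha h) w.
Proof.
move=> a0; rewrite /LW_symbol /fourier_of_hart /lw_hart wtN opprK sgrN -/(wt alpha w).
have [->|w0] := eqVneq w 0.
  by rewrite /wt normr0 powR0// !mul0r; simpc.
have [wn|wp|we] := ltgtP w 0; last by rewrite we eqxx in w0.
  rewrite (ltr0_sg wn) mulrN1 mulNr mulNr cosN sinN; simpc; congr (_ +i* _); by field.
rewrite (gtr0_sg wp) mulr1; simpc; congr (_ +i* _); by field.
Qed.

End HartleyFourier.

(** * Truncations and the Fourier transform of square integrable functions *)

Section Truncation.
Context {R : realType}.
Local Notation mu := (@lebesgue_measure R).
Implicit Types u v g h : R -> R.

Lemma nsqBB u : sqi u -> nsq (fun x => u x - u x) = 0.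
Proof.
move=> su; have := nsqZ 0 su; rewrite expr0n mul0r => <-; congr nsq.
by apply/funext => x; rewrite subrr mul0r.
Qed.

(** The truncations in terms of which [is_fourierL2] is defined. *)
Definition trunc (n : nat) u : R -> R := u \_ `[- n%:R, n%:R].

Lemma truncE n u x : trunc n u x = if `|x| <= n%:R then u x else 0.
Proof. by rewrite /trunc patchE mem_setE in_itv/= -ler_norml. Qed.

Lemma trunc_indic n u : trunc n u = (fun x => u x * \1_`[- n%:R, n%:R] x).
Proof.
apply/funext => x; rewrite truncE indicE mem_setE in_itv/= -ler_norml.
by case: ifPn => _; rewrite ?mulr1 ?mulr0.
Qed.

Lemma truncB n u v : trunc n (fun x => u x - v x) = (fun x => trunc n u x - trunc n v x).
Proof. by apply/funext => x; rewrite !truncE; case: ifPn; rewrite ?subr0. Qed.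

Lemma trunc_sqr_le n u x : trunc n u x ^+ 2 <= u x ^+ 2.
Proof. by rewrite truncE; case: ifPn => // _; rewrite expr0n sqr_ge0. Qed.

Lemma sqi_indic (n : nat) : sqi (\1_`[- n%:R, n%:R] : R -> R).
Proof.
split; first exact: intg_meas (intg_indic_itv _).
apply: intg_eq (intg_indic_itv n%:R) => x.
by rewrite indicE; case: (_ \in _); rewrite ?expr1n ?expr0n.
Qed.

Lemma trunc_intg n u : sqi u -> intg (trunc n u).
Proof. by move=> su; rewrite trunc_indic; exact: sqiM su (sqi_indic n). Qed.

Lemma trunc_sqi n u : sqi u -> sqi (trunc n u).
Proof.
move=> su; apply: (le_sqi (intg_meas (trunc_intg n su)) su.2) => x.
exact: trunc_sqr_le.
Qed.

Lemma nsq_trunc_le n u : sqi u -> nsq (trunc n u) <= nsq u.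
Proof.
move=> su; apply: le_Rintg (trunc_sqi n su).2 su.2 _ => x; exact: trunc_sqr_le.
Qed.

Lemma trunc_near u (x : R) : \forall n \near \oo, trunc n u x = u x.
Proof.
near=> n; rewrite truncE ifT//; apply: le_trans (ltW (truncnS_gt _)) _.
by rewrite ler_nat; near: n; exact: nbhs_infty_ge.
Unshelve. all: by end_near. Qed.

Lemma nsq_trunc_cvg u : sqi u -> nsq (trunc n u) @[n --> \oo] --> nsq u.
Proof.
move=> su.
have [] // := @Rintg_dct R (fun n x => trunc n u x ^+ 2) (fun x => u x ^+ 2)
  (fun x => u x ^+ 2) (fun n => intg_meas (trunc_sqi n su).2) (intg_meas su.2) _ su.2 _.
- apply: aeW => x; apply: cvg_near_cst.
  by apply: filterS (trunc_near u x) => n ->.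
- by move=> n x; rewrite ger0_norm ?sqr_ge0// trunc_sqr_le.
Qed.

(** Enough regularity for [plancherel] to apply to every truncation. *)
Definition bcsqi g := [/\ continuous g, exists M, forall x, `|g x| <= M & sqi g].

Lemma bcsqiB g h : bcsqi g -> bcsqi h -> bcsqi (fun x => g x - h x).
Proof.
move=> [cg [M gM] sg] [ch [N hN] sh]; split; last exact: sqiB.
  by move=> x; apply: cvgB; [exact: cg|exact: ch].
by exists (M + N) => x; apply: le_trans (ler_normB _ _) _; exact: lerD.
Qed.

Lemma test_function_bcsqi g : test_function g -> bcsqi g.
Proof.
move=> /test_function_contc cg; split; [exact: cg.1|exact: contc_bounded|].
exact: contc_sqi.
Qed.

Lemma ae_off_points (a b : R) : {ae mu, forall x, x != a /\ x != b}.
Proof.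
exists [set a; b]; split.
- by apply: measurableU; exact: measurable_set1.
- by apply: countable_lebesgue_measure0; exact: finite_set_countable.
- move=> x /= nx; have [->|xa] := eqVneq x a; first by left.
  by right; apply: contrapT => /eqP xb; apply: nx.
Qed.

Lemma plancherel_trunc n g : bcsqi g ->
  sqi (hart (trunc n g)) /\ nsq (hart (trunc n g)) = twopi * nsq (trunc n g).
Proof.
move=> [cg [M gM] sg]; apply: (@plancherel R _ M (trunc_intg n sg)).
  by move=> x; rewrite truncE; case: ifPn => _//; rewrite normr0 (le_trans _ (gM 0)).
apply: filterS (ae_off_points n%:R (- n%:R)) => x [xn xN].
have cn : {for x, continuous (fun y : R => `|y|)} by exact: norm_continuous.
have : `|x| != n%:R.
  by have [_|_] := ger0P x; rewrite // eqr_oppLR.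
rewrite neq_lt => /orP[lt|lt].
  apply: (cvg_trans _ (_ : g y @[y --> x] --> trunc n g x)).
    apply: near_eq_cvg; near=> y; rewrite truncE ifT//; apply/ltW.
    by near: y; exact: (cvgr_lt _ cn).
  by rewrite truncE (ltW lt); exact: cg.
apply: (cvg_trans _ (_ : (0 : R) @[y --> x] --> trunc n g x)).
  apply: near_eq_cvg; near=> y; rewrite truncE ifN// -ltNge.
  by near: y; exact: (cvgr_gt _ cn).
by rewrite truncE ifN -?ltNge//; exact: cvg_cst.
Unshelve. all: by end_near. Qed.

(** Plancherel's inequality survives limits in the mean: the transforms of the
    truncations converge pointwise, so Fatou's lemma applies. *)
Lemma plancherel_limit (g_ : nat -> R -> R) g n :
  (forall k, bcsqi (g_ k)) -> sqi g -> nsq (fun x => g_ k x - g x) @[k --> \oo] --> 0 ->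
  sqi (hart (trunc n g)) /\ nsq (hart (trunc n g)) <= twopi * nsq g.
Proof.
move=> bg sg gg; have sg_ k : sqi (g_ k) by case: (bg k).
have pt w : hart (trunc n (g_ k)) w @[k --> \oo] --> hart (trunc n g) w.
  have sc : sqi (fun x => cas (x * w) * \1_`[- n%:R, n%:R] x).
    have [m1 i1] := sqi_indic n; split.
      by apply: measurable_funM => //; exact: measurable_casM.
    apply: (intg_eq (f := fun x => \1_`[- n%:R, n%:R] x ^+ 2 * cas (x * w) ^+ 2)).
      by move=> x; rewrite exprMn mulrC.
    apply: (@intgM _ _ _ 4 i1) => [|x].
      by apply: measurable_funX; exact: measurable_casM.
    rewrite normrX; have := cas_le2 (x * w); have := normr_ge0 (cas (x * w)).
    by move: `|_| => y; nra.
  have E h : hart (trunc n h) w =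
      \int[mu]_x ((cas (x * w) * \1_`[- n%:R, n%:R] x) * h x).
    by rewrite trunc_indic; apply: eq_Rintegral => x _; rewrite mulrAC mulrA.
  rewrite E; under eq_fun do rewrite E.
  apply: (ip_cvg (fun=> sc) sg_ sc sg _ gg).
  by apply: cvg_near_cst; near=> k; exact: nsqBB sc.
have np := nsq_cvg sg_ sg gg.
have le (e : R) : 0 < e -> sqi (hart (trunc n g)) /\
    nsq (hart (trunc n g)) <= twopi * nsq g + e.
  move=> e0; have ce : twopi * nsq (g_ k) @[k --> \oo] --> twopi * nsq g.
    by apply: cvgM np; exact: cvg_cst.
  have : twopi * nsq g < twopi * nsq g + e by rewrite ltrDl.
  move=> /(cvgr_lt _ ce) [N _ hN].
  apply: (@nsq_fatou R (fun k => hart (trunc n (g_ (k + N)%N)))).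
  - by move=> k; case: (plancherel_trunc n (bg (k + N)%N)).
  - by move=> w; have := pt w; rewrite -(cvg_shiftn N).
  - move=> k; have [_ ->] := plancherel_trunc n (bg (k + N)%N).
    apply/ltW/(le_lt_trans _ (hN (k + N)%N (leq_addl _ _))).
    by rewrite ler_wpM2l ?(ltW twopi_gt0)// nsq_trunc_le.
split; first by have [] := le 1 ltr01.
by apply/ler_addgt0Pr => e /le[].
Unshelve. all: by end_near. Qed.

End Truncation.

(** * The Fourier transform as a closed operator *)

Section ClosedTransform.
Context {R : realType}.
Local Notation mu := (@lebesgue_measure R).
Implicit Types u v g h : R -> R.

(** The Hartley form of [is_fourierL2]. *)
Definition hartL2 u h : Prop :=
  [/\ sqi u, sqi h, forall n, sqi (hart (trunc n u)) &
    nsq (fun w => hart (trunc n u) w - h w) @[n --> \oo] --> 0].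

Lemma hartL2_fourier u h : hartL2 u h -> is_fourierL2 u (fourier_of_hart h).
Proof.
move=> [su sh st cv]; split; [exact/L2P|exact: cL2_fourier_of_hart|].
have E n : (fun w => fourier (u \_ `[- n%:R, n%:R]) w - fourier_of_hart h w) =
    fourier_of_hart (fun w => hart (trunc n u) w - h w).
  apply/funext => w; rewrite -fourier_of_hartB.
  by rewrite (fourierE w (trunc_intg n su)).
have sd n := sqiB (st n) sh.
under eq_fun do rewrite E.
under eq_fun do rewrite (cL2norm_fourier_of_hart (sd _)).
under eq_fun do rewrite -(L2normE (sd _)).
exact/(L2norm_cvg0 sd).
Qed.

Lemma hartL2_compact phi : test_function phi -> hartL2 phi (hart phi).
Proof.
move=> tp; have [sh _] := test_function_hart tp; split => //; first exact: test_function_sqi.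
  move=> n; case: (plancherel_trunc n (test_function_bcsqi tp)) => //.
have [_ [M hM]] := tp; apply: cvg_near_cst; near=> n.
rewrite (_ : trunc n phi = phi) ?nsqBB//; apply/funext => x; rewrite truncE.
case: ifPn => // xn; rewrite hM//; apply: lt_trans (_ : n%:R < _); last by rewrite ltNge.
apply: lt_le_trans (truncnS_gt _) _.
by rewrite ler_nat; near: n; exact: nbhs_infty_ge.
Unshelve. all: by end_near. Qed.

(** By [plancherel_limit] the transforms of the truncations of [g_ k] approach those
    of [g] uniformly in the truncation, so the two limits can be exchanged. *)
Lemma hartL2_closed (g_ h_ : nat -> R -> R) g h :
  (forall k, bcsqi (g_ k)) -> (forall k, hartL2 (g_ k) (h_ k)) -> sqi g -> sqi h ->
  nsq (fun x => g_ k x - g x) @[k --> \oo] --> 0 ->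
  nsq (fun x => h_ k x - h x) @[k --> \oo] --> 0 -> hartL2 g h.
Proof.
move=> bg gh sg sh gg hh; have sg_ k : sqi (g_ k) by case: (bg k).
have sh_ k : sqi (h_ k) by case: (gh k).
have st n : sqi (hart (trunc n g)) by case: (plancherel_limit n bg sg gg).
split=> //; apply/cvgr0Pnorm_le => e e0.
have e1 : 0 < e / 16 / twopi by rewrite !divr_gt0// twopi_gt0.
have e2 : 0 < e / 16 by rewrite divr_gt0.
have near_gg := cvgr0_norm_le _ gg; have near_hh := cvgr0_norm_le _ hh.
have /filter_ex [k [ak bk]] : \forall k \near \oo,
    `|nsq (fun x => g_ k x - g x)| <= e / 16 / twopi /\
    `|nsq (fun x => h_ k x - h x)| <= e / 16.
  by near=> k; split; near: k; [exact: near_gg|exact: near_hh].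
have [_ _ stk cvk] := gh k.
near=> n.
have ck : `|nsq (fun w => hart (trunc n (g_ k)) w - h_ k w)| <= e / 16.
  by near: n; exact: (cvgr0_norm_le _ cvk).
rewrite !ger0_norm ?nsq_ge0// in ak bk ck *.
have [sa na] : sqi (hart (trunc n (fun x => g x - g_ k x))) /\
    nsq (hart (trunc n (fun x => g x - g_ k x))) <= twopi * nsq (fun x => g x - g_ k x).
  apply: (plancherel_limit n (fun j => bcsqiB (bg j) (bg k)) (sqiB sg (sg_ k))).
  apply: cvg_trans gg; apply: near_eq_cvg; near=> j; congr nsq.
  by apply/funext => x; ring.
rewrite (nsqBC g) in na.
have E : hart (trunc n (fun x => g x - g_ k x)) =
    (fun w => hart (trunc n g) w - hart (trunc n (g_ k)) w).
  apply/funext => w; rewrite truncB.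
  exact: (hartB w (trunc_intg n sg) (trunc_intg n (sg_ k))).
have sb := sqiB (stk n) (sh_ k); have sc := sqiB (sh_ k) sh.
have l1 := nsqD_le sb sc; have l2 := nsqD_le sa (sqiD sb sc).
rewrite (_ : (fun w => hart (trunc n g) w - h w) = (fun x => hart (trunc n (fun x => g x - g_ k x)) x +
  (hart (trunc n (g_ k)) x - h_ k x + (h_ k x - h x)))); last first.
  by apply/funext => w; rewrite E; ring.
have na' : twopi * nsq (fun x => g_ k x - g x) <= e / 16.
  by rewrite mulrC -ler_pdivlMr ?twopi_gt0.
move: l1 l2 na na' bk ck; move: (nsq _) (nsq _) (nsq _) (nsq _) (nsq _) (twopi * _).
by move=> ? ? ? ? ? ? ? ? ? ? ? ?; lra.
Unshelve. all: by end_near. Qed.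

End ClosedTransform.

(** * The Liouville-Weyl derivative of a test function *)

Lemma polar_identity {R : realType} (a b c p q p' q' : R) :
  p + p' + 2 * (- 1) * a + (- 1) ^+ 2 * (q + q') =
  p - 2 * b + q + (p' - 2 * c + q') -> a = b + c.
Proof. by move=> h; lra. Qed.

Section LWDerivative.
Context {R : realType}.
Local Notation mu := (@lebesgue_measure R).
Variable alpha : R.
Hypothesis halpha : 2^-1 < alpha < 1.
Implicit Types u v g h phi psi : R -> R.

Local Notation wt := (wt alpha).
Local Notation lw := (lw_hart alpha).

Lemma alpha_neq0 : alpha != 0.
Proof. by have /andP[h _] := halpha; rewrite gt_eqF// (lt_trans _ h)// invr_gt0. Qed.

Lemma measurable_sg : measurable_fun [set: R] (@Num.sg R).
Proof.
apply: nondecreasing_measurable => // x y xy.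
have [x0|x0|x0] := ltgtP x 0.
- by rewrite (ltr0_sg x0); case: (sgrP y) => _; lra.
- by rewrite (gtr0_sg x0) (gtr0_sg (lt_le_trans x0 xy)).
- by rewrite x0 sgr0 sgr_ge0 -x0.
Qed.

Lemma lw_hartE h w : lw h w = cos (pi * alpha / 2) * (wt w * h w) -
  Num.sg w * (sin (pi * alpha / 2) * (wt (- w) * h (- w))).
Proof. by rewrite /lw_hart wtN; ring. Qed.

(** A rotation preserves the sum of the squares at [w] and [- w]. *)
Lemma nsq_lw_hart h : sqi (fun w => wt w * h w) ->
  sqi (lw h) /\ nsq (lw h) = nsq (fun w => wt w * h w).
Proof.
move=> sg; have sgN := sqiNx sg; set g := fun w => wt w * h w in sg sgN *.
pose c := cos (pi * alpha / 2); pose s := sin (pi * alpha / 2).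
have cs : c ^+ 2 + s ^+ 2 = 1 by exact: cos2Dsin2.
have E w : lw h w = c * g w - Num.sg w * (s * g (- w)) by exact: lw_hartE.
have sg2 (w : R) : w != 0 -> Num.sg w ^+ 2 = 1 by move=> w0; rewrite sqr_sg w0.
have g0 : g 0 = 0.
  by rewrite /g wt0// mul0r.
have rot w : lw h w ^+ 2 + lw h (- w) ^+ 2 = g w ^+ 2 + g (- w) ^+ 2.
  rewrite !E sgrN opprK; have [->|w0] := eqVneq w 0.
    by rewrite oppr0 g0 sgr0; ring.
  transitivity ((c ^+ 2 + Num.sg w ^+ 2 * s ^+ 2) * (g w ^+ 2 + g (- w) ^+ 2)); first by ring.
  by rewrite sg2// mul1r cs mul1r.
have slw : sqi (lw h).
  apply: (@le_sqi _ _ (fun w => g w ^+ 2 + g (- w) ^+ 2)).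
  - rewrite (funext E); apply: measurable_funB.
      by apply: measurable_funM => //; exact: sg.1.
    apply: measurable_funM; first exact: measurable_sg.
    by apply: measurable_funM => //; exact: sgN.1.
  - exact: intgD sg.2 sgN.2.
  - by move=> w; rewrite -rot lerDl sqr_ge0.
split=> //; have e1 := nsq_sym slw; have e2 := nsq_sym sg.
have e3 : \int[mu]_x (lw h x ^+ 2 + lw h (- x) ^+ 2) = \int[mu]_x (g x ^+ 2 + g (- x) ^+ 2).
  by apply: eq_Rintegral => w _; exact: rot.
by move: e1; rewrite e3 -e2 => /mulfI; apply; rewrite pnatr_eq0.
Qed.

Lemma lw_hartB h g w : lw (fun x => h x - g x) w = lw h w - lw g w.
Proof. by rewrite /lw_hart; ring. Qed.

Lemma sqi_sqr_mul_hart phi : test_function phi -> sqi (fun w => w ^+ 2 * hart phi w).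
Proof.
move=> tp; have := sqiZ (- 1) (sqiNx (sqi_mul_hart (test_function_derive tp))).
congr sqi; apply/funext => w; rewrite hart_derive// opprK; ring.
Qed.

Lemma intg_wt_hart phi : test_function phi -> intg (fun w => wt w * hart phi w).
Proof.
move=> tp; have [sh _] := test_function_hart tp.
have d0 (w : R) : 0 < 1 + w ^+ 2 by rewrite ltr_wpDr ?sqr_ge0.
have s1 : sqi (fun w => wt w / (1 + w ^+ 2)).
  apply: (@le_sqi _ _ (fun w => 2 * (1 + wt w ^+ 2)^-1)).
  - apply: measurable_funM; first exact: measurable_wt.
    apply: cont_meas => w; apply: cvgV; first by rewrite gt_eqF.
    by apply: cvgD; [exact: cvg_cst|exact: exprn_continuous].
  - by apply: intgZ; exact: intg_wsV.
  - move=> w; have h := wt_le halpha w; have v0 := sqr_ge0 (wt w).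
    have a1 : 1 <= 1 + w ^+ 2 by rewrite lerDl sqr_ge0.
    rewrite expr_div_n ler_pdivrMr ?exprn_gt0 ?d0// mulrAC ler_pdivlMr; last by lra.
    move: a1 h v0; move: (1 + w ^+ 2) (wt w ^+ 2) => a b ? ? ?; nra.
apply: (intg_eq _ (sqiM s1 (sqiD sh (sqi_sqr_mul_hart tp)))) => w.
by field; rewrite gt_eqF.
Qed.

Lemma bounded_wt_hart phi : test_function phi -> exists M, forall w, `|wt w * hart phi w| <= M.
Proof.
move=> tp; have td := test_function_derive tp.
pose A := 2 * \int[mu]_x `|phi x|; pose B := 2 * \int[mu]_x `|derive1 phi x|.
exists (A ^+ 2 + B ^+ 2 + 1) => w.
have hA : `|hart phi w| <= A by exact: le_hart (test_function_intg tp).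
have hB : `|w * hart phi w| <= B.
  have := le_hart (- w) (test_function_intg td); rewrite hart_derive// opprK normrN mulNr normrN.
  exact.
have h2 : `|wt w * hart phi w| ^+ 2 <= A ^+ 2 + B ^+ 2.
  rewrite real_normK ?num_real// exprMn.
  apply: (@le_trans _ _ ((1 + w ^+ 2) * hart phi w ^+ 2)).
    by rewrite ler_wpM2r ?sqr_ge0//; exact: wt_le.
  rewrite mulrDl mul1r -exprMn -(real_normK (num_real (hart _ _))).
  rewrite -(real_normK (num_real (w * _))).
  by rewrite lerD// ler_pXn2r// nnegrE ?(le_trans _ hA)// (le_trans _ hB).
move: h2; move: `|_| => y h2; have := sqr_ge0 (y - 1); nra.
Qed.

Lemma lw_hart_le h w : `|lw h w| <= `|wt w * h w| + `|wt (- w) * h (- w)|.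
Proof.
rewrite lw_hartE; apply: le_trans (ler_normB _ _) _.
apply: lerD; rewrite !normrM.
  by rewrite ler_piMl ?mulr_ge0// ler_norml cos_geN1 cos_le1.
have s1 : `|sin (pi * alpha / 2)| <= 1 by rewrite ler_norml sin_geN1 sin_le1.
have g1 : `|Num.sg w| <= 1 by rewrite normr_sg lern1 leq_b1.
apply: le_trans (ler_wpM2r _ g1) _; first by rewrite !mulr_ge0.
by rewrite mul1r ler_piMl// mulr_ge0.
Qed.

Lemma continuous_wt (w : R) : w != 0 -> {for w, continuous wt}.
Proof.
move=> w0; have cp : {for `|w|, continuous (fun y : R => y `^ alpha)}.
  apply: differentiable_continuous; apply/derivable1_diffP.
  by apply: derivable_powR; rewrite in_itv/= andbT normr_gt0.
exact: (@continuous_comp _ _ _ (fun y : R => `|y|) (fun y : R => y `^ alpha) w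
  (@norm_continuous _ _ w) cp).
Qed.

Lemma continuous_lw_hart h (w : R) : continuous h -> w != 0 -> {for w, continuous (lw h)}.
Proof.
move=> ch w0.
have csg : {for w, continuous (@Num.sg R)}.
  have [wn|wp] : w < 0 \/ 0 < w by move: w0; rewrite neq_lt => /orP.
    apply: cvg_near_cst; near=> y; rewrite !ltr0_sg//.
    by near: y; exact: lt_nbhsl.
  apply: cvg_near_cst; near=> y; rewrite !gtr0_sg//.
  by near: y; exact: lt_nbhsr.
apply: cvgM; first exact: continuous_wt.
apply: cvgB; first by apply: cvgM; [exact: cvg_cst|exact: ch].
apply: cvgM; first by apply: cvgM; [exact: csg|exact: cvg_cst].
apply: (@continuous_comp _ _ _ (@GRing.opp R) h); first exact: opp_continuous.
exact: ch.
Unshelve. all: by end_near. Qed.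

(** The derivative of a test function as an everywhere defined bounded continuous
    function: the inverse transform of the integrable function [lw (hart phi)]. *)
Definition LWd phi (x : R) : R := twopi^-1 * hart (lw (hart phi)) x.

Lemma lw_hart_plancherel phi : test_function phi ->
  [/\ intg (lw (hart phi)), sqi (hart (lw (hart phi))) &
      nsq (hart (lw (hart phi))) = twopi * nsq (lw (hart phi))].
Proof.
move=> tp; have iw := intg_wt_hart tp; have [sh _] := test_function_hart tp.
have [slw _] := nsq_lw_hart (sqi_wt_hart halpha tp).
have il : intg (lw (hart phi)).
  apply: (le_intg slw.1 (intgD (intg_norm iw) (intg_norm (intgNx iw)))) => w.
  exact: lw_hart_le.
have [M hM] := bounded_wt_hart tp.
have [] := @plancherel R (lw (hart phi)) (M + M) il; last by split.
  by move=> w; apply: le_trans (lw_hart_le _ _) _; exact: lerD.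
apply: filterS (ae_off_points 0 0) => w [w0 _].
by apply: continuous_lw_hart => //; exact/continuous_hart/test_function_intg.
Qed.

Lemma bcsqi_LWd phi : test_function phi -> bcsqi (LWd phi).
Proof.
move=> tp; have [il sl _] := lw_hart_plancherel tp; split; last exact: sqiZ.
  by move=> x; apply: cvgM; [exact: cvg_cst|exact: (continuous_hart il)].
exists (`|twopi^-1| * (2 * \int[mu]_x `|lw (hart phi) x|)) => x.
by rewrite normrM ler_wpM2l//; exact: le_hart.
Qed.

Lemma nsq_LWd phi : test_function phi ->
  nsq (LWd phi) = twopi^-1 * nsq (fun w => wt w * hart phi w).
Proof.
move=> tp; have [il sl e] := lw_hart_plancherel tp.
rewrite (nsqZ twopi^-1 sl) e; have [_ ->] := nsq_lw_hart (sqi_wt_hart halpha tp).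
have := @twopi_gt0 R; move: twopi (nsq _) => a b a0; field; exact: lt0r_neq0.
Qed.

Lemma LWdB phi psi : test_function phi -> test_function psi ->
  LWd (fun x => phi x - psi x) = (fun x => LWd phi x - LWd psi x).
Proof.
move=> tp tq; have [ip _ _] := lw_hart_plancherel tp.
have [iq _ _] := lw_hart_plancherel tq; apply/funext => x.
rewrite /LWd -mulrBr -(hartB x ip iq); congr (_ * hart _ _); apply/funext => w.
rewrite -lw_hartB; congr (lw _ w); apply/funext => y.
exact: (hartB y (test_function_intg tp) (test_function_intg tq)).
Qed.

(** By self-adjointness and inversion the squared distance between the transform of
    the truncation and [lw (hart phi)] is [twopi] times the part of [nsq (LWd phi)]
    that the truncation leaves out. *)
Lemma hartL2_LWd phi : test_function phi -> hartL2 (LWd phi) (lw (hart phi)).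
Proof.
move=> tp; have [il sl e] := lw_hart_plancherel tp; have bD := bcsqi_LWd tp.
have [slw nlw] := nsq_lw_hart (sqi_wt_hart halpha tp).
have [_ _ sD] := bD; have t0 := @twopi_gt0 R.
have E n : nsq (fun w => hart (trunc n (LWd phi)) w - lw (hart phi) w) =
    twopi * (nsq (LWd phi) - nsq (trunc n (LWd phi))).
  have [st nt] := plancherel_trunc n bD; have it := trunc_intg n sD.
  have d := hart_dual il it.
  rewrite (nsqB st slw) nt nlw nsq_LWd//.
  have -> : \int[mu]_x (hart (trunc n (LWd phi)) x * lw (hart phi) x) =
      twopi * nsq (trunc n (LWd phi)).
    transitivity (\int[mu]_w (lw (hart phi) w * hart (trunc n (LWd phi)) w)).
      by apply: eq_Rintegral => w _; rewrite mulrC.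
    rewrite d /nsq -(RintgZ twopi (trunc_sqi n sD).2).
    apply: eq_Rintegral => x _.
    have -> : hart (lw (hart phi)) x = twopi * LWd phi x.
      by rewrite /LWd mulVKf// gt_eqF.
    by rewrite truncE; case: ifP => _; ring.
  move: t0 (nsq _) (nsq _); move: twopi => a a0 b c.
  by field; exact: lt0r_neq0.
split=> //; first by move=> n; case: (plancherel_trunc n bD).
under eq_fun do rewrite E.
rewrite -(mulr0 twopi) -(subrr (nsq (LWd phi))).
apply: cvgM; first exact: cvg_cst.
by apply: cvgB; [exact: cvg_cst|exact: nsq_trunc_cvg].
Qed.

Lemma energy_LWd phi : test_function phi ->
  energy alpha phi = nsq phi + nsq (LWd phi).
Proof. by move=> tp; rewrite energyE nsq_LWd. Qed.

(** Polarisation of [energy_LWd]. *)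
Lemma energyB_LWd phi psi : test_function phi -> test_function psi ->
  energyB alpha phi psi = \int[mu]_x (phi x * psi x) +
    \int[mu]_x (LWd phi x * LWd psi x).
Proof.
move=> tp tq; have [_ _ sp] := bcsqi_LWd tp; have [_ _ sq] := bcsqi_LWd tq.
have e1 := energyD halpha (-1) tp tq.
have e2 := energy_LWd (test_functionB tp tq).
have e3 : (fun x => phi x + -1 * psi x) = (fun x => phi x - psi x).
  by apply/funext => x; rewrite mulN1r.
rewrite LWdB// (nsqB (test_function_sqi tp) (test_function_sqi tq)) (nsqB sp sq) -e3 e1 in e2.
rewrite (energy_LWd tp) (energy_LWd tq) in e2.
exact: polar_identity e2.
Qed.

(** * The completed space *)

Let S phi : R := nsq phi + nsq (fun w => wt w * hart phi w).

Lemma HnormE phi : test_function phi ->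
  Hnorm alpha phi = (Num.sqrt (nsq phi + nsq (fun w => wt w * hart phi w)))%:E.
Proof.
move=> tp; have sw := sqi_wt_hart halpha tp.
have E : (fun w => (`|w| `^ alpha)%:C * fourier phi w)%C =
    fourier_of_hart (fun w => wt w * hart phi w).
  apply/funext => w; rewrite (fourierE w (test_function_intg tp)) /fourier_of_hart wtN -/(wt w).
  by simpc; congr (_ +i* _)%C; field.
rewrite /Hnorm E (cL2norm_fourier_of_hart sw) (L2normE (test_function_sqi tp)).
rewrite -!EFin_expe -EFinD !sqr_sqrtr ?nsq_ge0// poweR_EFin powR12_sqrt//.
by rewrite addr_ge0// nsq_ge0.
Qed.

Lemma twopi_ge1 : 1 <= twopi :> R.
Proof. by rewrite /twopi; have := @pi_ge2 R; lra. Qed.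

Lemma energy_le_S phi : energy alpha phi <= S phi.
Proof.
rewrite energyE lerD2l ler_piMl ?nsq_ge0// invf_le1 ?twopi_gt0//.
exact: twopi_ge1.
Qed.

Lemma S_le_energy phi : S phi <= twopi * energy alpha phi.
Proof.
rewrite energyE mulrDr mulVKf ?gt_eqF ?twopi_gt0// lerD2r.
by rewrite ler_peMl ?nsq_ge0// twopi_ge1.
Qed.

Definition energy_cauchy (phi_ : nat -> R -> R) := forall e : R, 0 < e ->
  exists N, forall m n, (N <= m)%N -> (N <= n)%N ->
    energy alpha (fun x => phi_ m x - phi_ n x) < e.

Lemma HalphaP v : Halpha alpha v <-> sqi v /\ exists phi_ : nat -> R -> R,
  [/\ forall n, test_function (phi_ n), energy_cauchy phi_ &
      nsq (fun x => phi_ n x - v x) @[n --> \oo] --> 0].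
Proof.
split=> [[/L2P sv [p [tp cp lp]]]|[sv [p [tp cp lp]]]].
  split=> //; exists p; split=> //.
    move=> e e0; have e1 : 0 < Num.sqrt e by rewrite sqrtr_gt0.
    have [N hN] := cp _ e1.
    exists N => m n Nm Nn; have := hN m n Nm Nn.
    rewrite (HnormE (test_functionB (tp m) (tp n))) lte_fin ltr_sqrt// => h.
    exact: le_lt_trans (energy_le_S _) h.
  have sd n := sqiB (test_function_sqi (tp n)) sv.
  exact/(L2norm_cvg0 sd).
split; first exact/L2P.
exists p; split=> //; last first.
  have sd n := sqiB (test_function_sqi (tp n)) sv.
  exact/(L2norm_cvg0 sd).
move=> e e0; have d0 : 0 < e ^+ 2 / twopi by rewrite divr_gt0 ?exprn_gt0 ?twopi_gt0.
have [N hN] := cp _ d0; exists N => m n Nm Nn.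
rewrite (HnormE (test_functionB (tp m) (tp n))) lte_fin.
rewrite -[ltRHS](gtr0_norm e0) -sqrtr_sqr ltr_sqrt ?exprn_gt0//.
apply: (le_lt_trans (S_le_energy _)); rewrite mulrC -ltr_pdivlMr ?twopi_gt0//.
exact: hN.
Qed.

End LWDerivative.

(** * Limits in energy *)

Section EnergyLimit.
Context {R : realType}.
Local Notation mu := (@lebesgue_measure R).
Variable alpha : R.
Hypothesis halpha : 2^-1 < alpha < 1.
Implicit Types u v g h phi psi : R -> R.

Local Notation wt := (wt alpha).
Local Notation lw := (lw_hart alpha).

Lemma nsq_le u v : sqi u -> sqi v -> (forall x, u x ^+ 2 <= v x ^+ 2) -> nsq u <= nsq v.
Proof. by move=> su sv uv; apply: le_Rintg uv; [exact: su.2|exact: sv.2]. Qed.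

Lemma sqi_ws_hart phi : test_function phi ->
  sqi (fun w => (1 + wt w) * hart phi w) /\
  nsq (fun w => (1 + wt w) * hart phi w) <= 2 * twopi * energy alpha phi.
Proof.
move=> tp; have [sh nh] := test_function_hart tp; have sw := sqi_wt_hart halpha tp.
have E : (fun w => (1 + wt w) * hart phi w) = (fun w => hart phi w + wt w * hart phi w).
  by apply/funext => w; rewrite mulrDl mul1r.
rewrite E; split; first exact: sqiD.
apply: le_trans (nsqD_le sh sw) _; rewrite nh energyE.
rewrite -[leRHS]mulrA mulrDr mulVKf; last by rewrite gt_eqF// twopi_gt0.
by rewrite mulrDr.
Qed.

(** Completeness is applied to the weighted transforms [(1 + |w|^alpha) hart phi_n].
    Dividing their limit by the weight gives one function [h] towards which both the
    transforms of the [phi_n] and, after multiplication by the symbol, those of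
    their derivatives converge; two separate limits would agree only almost
    everywhere. *)
Lemma energy_limit (phi_ : nat -> R -> R) v :
  (forall n, test_function (phi_ n)) -> energy_cauchy alpha phi_ -> sqi v ->
  nsq (fun x => phi_ n x - v x) @[n --> \oo] --> 0 ->
  exists Dv, [/\ is_left_LW_derivative alpha v Dv, sqi Dv &
    nsq (fun x => LWd alpha (phi_ n) x - Dv x) @[n --> \oo] --> 0].
Proof.
move=> tp cp sv pv; have t0 := @twopi_gt0 R.
pose k n w := (1 + wt w) * hart (phi_ n) w.
have sk n : sqi (k n) by case: (sqi_ws_hart (tp n)).
have [K sK kK] : exists2 K, sqi K & nsq (fun x => k n x - K x) @[n --> \oo] --> 0.
  apply: sqi_complete => // e e0.
  have e1 : 0 < e / (2 * twopi) by rewrite divr_gt0// mulr_gt0.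
  have [N hN] := cp _ e1; exists N => m n Nm Nn.
  have td := test_functionB (tp m) (tp n); have [_ le] := sqi_ws_hart td.
  rewrite (_ : (fun x => _) = (fun w => (1 + wt w) * hart (fun x => phi_ m x - phi_ n x) w)).
    apply: le_lt_trans le _; rewrite [ltLHS]mulrC.
    by rewrite -(ltr_pdivlMr _ _ (mulr_gt0 (ltr0n _ 2) t0)); exact: hN.
  by apply/funext => w; rewrite (hartB w (test_function_intg (tp m)) (test_function_intg (tp n))) mulrBr.
have w1 w : 0 < 1 + wt w by rewrite ltr_wpDr// wt_ge0.
have mw1 : measurable_fun [set: R] (fun w => (1 + wt w)^-1).
  apply: measurable_pinv => //.
  by apply: measurable_funD; [exact: measurable_cst|exact: measurable_wt].
pose h w := (1 + wt w)^-1 * K w.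
have contr g (m : R -> R) : sqi g -> measurable_fun setT m -> (forall w, m w ^+ 2 <= 1) ->
    sqi (fun w => m w * g w) /\ nsq (fun w => m w * g w) <= nsq g.
  move=> sg mm m1.
  have le w : (m w * g w) ^+ 2 <= g w ^+ 2 by rewrite exprMn ler_piMl ?sqr_ge0.
  have s : sqi (fun w => m w * g w).
    by apply: (le_sqi _ sg.2 le); exact: measurable_funM mm sg.1.
  by split=> //; exact: nsq_le.
have m1 w : ((1 + wt w)^-1) ^+ 2 <= 1.
  rewrite exprVn invf_le1 ?exprn_gt0//.
  by have := wt_ge0 alpha w; move: (wt w) => y y0; nra.
have mw : measurable_fun [set: R] (fun w => wt w * (1 + wt w)^-1).
  exact: measurable_funM (measurable_wt alpha) mw1.
have m2 w : (wt w * (1 + wt w)^-1) ^+ 2 <= 1.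
  have q0 : 0 <= wt w / (1 + wt w) by rewrite divr_ge0 ?wt_ge0// ltW.
  rewrite expr_le1// ler_pdivrMr// mul1r lerDr; exact: ler01.
have [sh _] := contr _ _ sK mw1 m1; rewrite -/h in sh.
have swh : sqi (fun w => wt w * h w).
  have [s _] := contr _ _ sK mw m2; move: s; congr sqi.
  by apply/funext => w; rewrite /h mulrA.
have hh : nsq (fun w => hart (phi_ n) w - h w) @[n --> \oo] --> 0.
  apply: nsq_cvg0_le kK => n; have [_] := contr _ _ (sqiB (sk n) sK) mw1 m1.
  apply: le_trans; apply: eq_ler; congr nsq.
  by apply/funext => w; rewrite /h /k mulrBr mulKf// gt_eqF.
have ll : nsq (fun w => lw (hart (phi_ n)) w - lw h w) @[n --> \oo] --> 0.
  apply: nsq_cvg0_le kK => n; have [_] := contr _ _ (sqiB (sk n) sK) mw m2.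
  apply: le_trans.
  have E : (fun w => wt w * (1 + wt w)^-1 * (k n w - K w)) =
      (fun w => wt w * (hart (phi_ n) w - h w)).
    by apply/funext => w; rewrite /h /k -mulrA mulrBr mulKf// gt_eqF.
  have sd : sqi (fun w => wt w * (hart (phi_ n) w - h w)).
    have := sqiB (sqi_wt_hart halpha (tp n)) swh; congr sqi.
    by apply/funext => w; rewrite mulrBr.
  have [_ e] := nsq_lw_hart halpha sd; rewrite E -e; apply: eq_ler.
  by congr nsq; apply/funext => w; rewrite lw_hartB.
have [Dv sD DD] : exists2 Dv, sqi Dv &
    nsq (fun x => LWd alpha (phi_ n) x - Dv x) @[n --> \oo] --> 0.
  apply: sqi_complete => [n|e e0]; first by case: (bcsqi_LWd halpha (tp n)).
  have [N hN] := cp _ e0; exists N => m n Nm Nn.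
  rewrite -(LWdB halpha (tp m) (tp n)); apply: le_lt_trans (hN m n Nm Nn).
  by rewrite (energy_LWd halpha (test_functionB (tp m) (tp n))) lerDr nsq_ge0.
exists Dv; split=> //; exists (fourier_of_hart h); split.
  apply: hartL2_fourier.
  exact: (hartL2_closed (fun n => test_function_bcsqi (tp n))
    (fun n => hartL2_compact (tp n)) sv sh pv hh).
rewrite (_ : (fun w => _) = fourier_of_hart (lw h)); last first.
  by apply/funext => w; rewrite LW_symbol_mul// (alpha_neq0 halpha).
apply: hartL2_fourier.
have [slh _] := nsq_lw_hart halpha swh.
exact: (hartL2_closed (fun n => bcsqi_LWd halpha (tp n))
    (fun n => hartL2_LWd halpha (tp n)) sD slh DD ll).
Qed.

End EnergyLimit.

(** * The weak solution *)

Section Conclusion.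
Context {R : realType}.
Local Notation mu := (@lebesgue_measure R).
Variable alpha : R.
Hypothesis halpha : 2^-1 < alpha < 1.
Implicit Types u v g h phi psi : R -> R.

(** On the bounded range of [u] the function [f] is dominated by a linear one: near
    zero because it is superlinear there, elsewhere because it is bounded. *)
Lemma sqi_comp (f : R -> R) u (M : R) : continuous f ->
  f 0 = 0 -> f =o_ (0 : R) (fun xi : R => `|xi|) ->
  sqi u -> (forall x, `|u x| <= M) -> sqi (fun x => f (u x)).
Proof.
move=> cf f0 fo su uM; have [d d0 hd] := f_small fo ltr01.
have [K K0 hK] := bounded_on_itv M cf.
have le x : `|f (u x)| <= (1 + K / d) * `|u x|.
  rewrite mulrDl; have [h|h] := lerP `|u x| d.
    by apply: le_trans (hd _ h) _; rewrite lerDl mulr_ge0// divr_ge0// ltW.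
  apply: le_trans (hK _ (uM x)) _; rewrite mul1r.
  apply: (@le_trans _ _ (K / d * `|u x|)); last by rewrite lerDr.
  by rewrite mulrAC ler_pdivlMr// ler_wpM2l// ltW.
apply: (@le_sqi _ _ (fun x => (1 + K / d) ^+ 2 * u x ^+ 2)).
- exact: (measurableT_comp (cont_meas cf) su.1).
- exact: intgZ su.2.
- move=> x; rewrite -exprMn -(real_normK (num_real (f _))).
  rewrite -[leRHS]real_normK ?num_real// normrM.
  rewrite ler_pXn2r ?nnegrE ?mulr_ge0//.
  by apply: le_trans (le x) _; rewrite ler_wpM2r// ler_norm.
Qed.

(** Fatou's lemma in one of the two indices of the Cauchy condition. *)
Lemma nsq_pointwise_limit (w : nat -> R -> R) v : (forall n, test_function (w n)) ->
  energy_cauchy alpha w -> (forall x, w n x @[n --> \oo] --> v x) ->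
  sqi v /\ nsq (fun x => w n x - v x) @[n --> \oo] --> 0.
Proof.
move=> tw cw wv.
have est (e : R) : 0 < e -> exists N, forall m, (N <= m)%N ->
    sqi (fun x => w m x - v x) /\ nsq (fun x => w m x - v x) <= e.
  move=> e0; have [N hN] := cw e e0; exists N => m Nm.
  apply: (@nsq_fatou R (fun n x => w m x - w (n + N)%N x)).
  - by move=> n; apply: sqiB; exact: test_function_sqi.
  - move=> x; apply: cvgB; first exact: cvg_cst.
    by have := wv x; rewrite -(cvg_shiftn N).
  - move=> n; apply: (le_trans (energy_nsq alpha _)); apply/ltW.
    exact: hN Nm (leq_addl _ _).
split.
  have [N hN] := est 1 ltr01; have [sd _] := hN N (leqnn N).
  have := sqiB (test_function_sqi (tw N)) sd; congr sqi; apply/funext => x; ring.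
apply/cvgr0Pnorm_le => e e0; have [N hN] := est e e0.
exists N; first exact: I.
by move=> n /= Nn; have [_ le] := hN n Nn; rewrite ger0_norm// nsq_ge0.
Qed.

Lemma seq_lim_unique (s : nat -> R) (a b : R) :
  s n @[n --> \oo] --> a -> s n @[n --> \oo] --> b -> a = b.
Proof.
move=> ha hb; rewrite -(cvg_lim (@Rhausdorff R) ha).
exact: (cvg_lim (@Rhausdorff R) hb).
Qed.

(** The equation holds against test functions by uniqueness of the limit of
    [energyB alpha (w n) phi], and against all of the space by density, as [f(u)] is
    square integrable. *)
Lemma weak_solution_of_limit (f : R -> R) (w : nat -> R -> R) u (M : R) :
  continuous f -> f 0 = 0 -> f =o_ (0 : R) (fun xi : R => `|xi|) ->
  (forall n, test_function (w n)) -> energy_cauchy alpha w ->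
  (forall x, w n x @[n --> \oo] --> u x) -> (forall x, `|u x| <= M) ->
  (forall phi, test_function phi ->
     energyB alpha (w n) phi @[n --> \oo] --> \int[mu]_x (f (u x) * phi x)) ->
  weak_solution alpha f u.
Proof.
move=> cf f0 fo tw cw wu uM wf.
have [su wu2] := nsq_pointwise_limit tw cw wu.
split; first by apply/(HalphaP halpha); split=> //; exists w.
have [Du [LDu sDu DDu]] := energy_limit halpha tw cw su wu2.
exists Du => // v /(HalphaP halpha)[sv [p [tp cp pv]]].
have [Dv [LDv sDv DDv]] := energy_limit halpha tp cp sv pv.
exists Dv => //.
have sL g : test_function g -> sqi (LWd alpha g).
  by move=> tg; case: (bcsqi_LWd halpha tg).
have c0 g : sqi g -> nsq (fun x => g x - g x) @[_ --> \oo] --> (0 : R).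
  by move=> sg; rewrite nsqBB//; exact: cvg_cst.
have sfu := sqi_comp cf f0 fo su uM.
have test_eq k : \int[mu]_x (u x * p k x) + \int[mu]_x (Du x * LWd alpha (p k) x) =
    \int[mu]_x (f (u x) * p k x).
  have h1 := wf _ (tp k).
  have sp := test_function_sqi (tp k).
  have h2 := ip_cvg (fun n => test_function_sqi (tw n)) (fun=> sp) su sp wu2 (c0 _ sp).
  have h3 := ip_cvg (fun n => sL _ (tw n)) (fun=> sL _ (tp k)) sDu (sL _ (tp k)) DDu
    (c0 _ (sL _ (tp k))).
  rewrite (_ : (fun n => energyB _ _ _) = (fun n => \int[mu]_x (w n x * p k x) +
    \int[mu]_x (LWd alpha (w n) x * LWd alpha (p k) x))) in h1.
    by apply: (seq_lim_unique _ h1); apply: cvgD; [exact: h2|exact: h3].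
  by apply/funext => n; exact: energyB_LWd.
have lim_eq : \int[mu]_x (u x * v x) + \int[mu]_x (Du x * Dv x) = \int[mu]_x (f (u x) * v x).
  have h1 := ip_cvg (fun=> su) (fun n => test_function_sqi (tp n)) su sv (c0 _ su) pv.
  have h2 := ip_cvg (fun=> sDu) (fun n => sL _ (tp n)) sDu sDv (c0 _ sDu) DDv.
  have h3 := ip_cvg (fun=> sfu) (fun n => test_function_sqi (tp n)) sfu sv (c0 _ sfu) pv.
  rewrite -(funext test_eq) in h3.
  by apply: (seq_lim_unique _ h3); apply: cvgD; [exact: h1|exact: h2].
have iD := sqiM sDu sDv; have iu := sqiM su sv; have iF := sqiM sfu sv.
by rewrite (RintgE (intgD iD iu)) (RintgE iF) (RintgD iD iu) addrC lim_eq.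
Qed.

Lemma not_ae_zero u (r k : R) : 0 < r -> 0 < k ->
  sqi u -> (forall x, `|x| < r -> k <= u x) -> ~ (u = cst 0 %[ae mu]).
Proof.
move=> r0 k0 su uk u0.
have z : nsq u = 0.
  have := nsqZ 0 su; rewrite expr0n mul0r => <-.
  apply: (nsq_ae su.1 (sqiZ 0 su).1); apply: filterS u0 => x h.
  by rewrite mul0r; exact: h.
have r2 : 0 < r / 2 by rewrite divr_gt0.
have : 2 * (r / 2) * k ^+ 2 <= nsq u.
  have e : \int[mu]_x (\1_`[- (r / 2), r / 2] x : R) = 2 * (r / 2).
    exact: Rintg_indic_itv (ltW r2).
  rewrite mulrC -e -(RintgZ (k ^+ 2) (intg_indic_itv (r / 2))).
  apply: le_Rintg su.2 _ => [|x]; first exact/intgZ/intg_indic_itv.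
  rewrite indicE mem_setE in_itv/= -ler_norml.
  have [h|h] := boolP (`|x| <= r / 2); last by rewrite mulr0 sqr_ge0.
  have xr : `|x| < r by apply: (le_lt_trans h); lra.
  by rewrite mulr1 ler_pXn2r// ?nnegrE ?(ltW k0)// ?uk// (le_trans (ltW k0))// uk.
by rewrite z leNgt !mulr_gt0// exprn_gt0.
Qed.

End Conclusion.

Theorem theorem1p1 (R : realType) (alpha : R) (f : R -> R)
  (halpha : 2^-1 < alpha < 1)
  (hcont : continuous f)
  (hf0 : (forall xi : R, 0 <= xi -> 0 <= f xi) /\
         (forall xi : R, xi <= 0 -> f xi = 0))
  (theta : R) (htheta : 2 < theta)
  (hf1 : forall xi : R, 0 < xi -> 0 < theta * primitive0 f xi <= xi * f xi)
  (hf2 : f =o_ (0 : R) (fun xi : R => `|xi|))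
  (hf3 : exists p0 : R, [/\ theta < p0 + 1,
           f xi / `|xi| `^ p0 @[xi --> +oo] --> (0 : R)
         & f xi / `|xi| `^ p0 @[xi --> -oo] --> (0 : R)])
  (hf4 : forall xi : R, 0 < xi -> forall s t : R, 0 < s -> s < t ->
           f (s * xi) * xi / s < f (t * xi) * xi / t) :
  exists u : R -> R, weak_solution alpha f u /\
    ~ (u = cst 0 %[ae (@lebesgue_measure R)]).
Proof.
have f0 := hf0.2; have ff0 : f 0 = 0 by exact: f0.
have [w [u [M [r [k [[tw cw wu wf] [mu_ uM r0 k0 uk]]]]]]] :=
  critical_limit halpha hcont f0 htheta hf1 hf2 hf4.
have [su _] := nsq_pointwise_limit tw cw wu.
exists u; split; last exact: not_ae_zero r0 k0 su uk.
exact: (weak_solution_of_limit halpha hcont ff0 hf2 tw cw wu uM wf).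
Qed.
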